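(* Let $F(z,w)=(f(z)-\delta w,z)$ be a transcendental Hénon map, and suppose the family $\{f_n\}_{n\in\mathbb N}$, $f_n(z)=f(nz)/n$, is quasi-normal on $\mathbb C$. Then $h_{\mathrm{top}}(\mathbb C^2,F)=+\infty$.
   Context: A transcendental Hénon map is $F(z,w)=(f(z)-\delta w,z)$ with $f$ transcendental entire and $\delta\ne0$. A family $\mathcal F$ of holomorphic functions on a domain $\Omega$ is quasi-normal if for every sequence in $\mathcal F$ there exist a finite set $Q\subset\Omega$ and a subsequence converging uniformly on compact subsets of $\Omega\setminus Q$ with respect to the spherical metric (limit $\equiv\infty$ allowed). Topological entropy: for a continuous self-map $g$ of a compact metric space $X$, $h_{\mathrm{top}}(X,g)=\sup_{\varepsilon>0}\limsup_n\frac1n\log K(n,\varepsilon)$, where $K(n,\varepsilon)$ is the maximal cardinality of a set $E$ such that any two distinct points $z,w\in E$ satisfy $d(g^k z,g^k w)>\varepsilon$ for some $0\le k\le n-1$; for a non-compact metric space $Y$, $h_{\mathrm{top}}(Y,g)$ is the supremum of $h_{\mathrm{top}}(X,g|_X)$ over compact $X\subset Y$ with $g(X)\subset X$ ($0$ if none). *)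

(* Defs.v *)
From Stdlib Require Import Reals List.
From Coquelicot Require Import Coquelicot.
Import ListNotations.
Open Scope R_scope.

Definition entire (f : C -> C) : Prop :=
  forall z : C, exists l : C, forall eps : R, 0 < eps ->
    exists del : R, 0 < del /\
      forall h : C, h <> RtoC 0 -> Cmod h < del ->
        Cmod (Cminus (Cdiv (Cminus (f (Cplus z h)) (f z)) h) l) < eps.

Definition polynomial_fun (f : C -> C) : Prop :=
  exists (n : nat) (a : nat -> C), forall z : C,
    f z = fold_right Cplus (RtoC 0) (map (fun k => Cmult (a k) (Cpow z k)) (seq 0 (S n))).

Definition transcendental_entire (f : C -> C) : Prop :=
  entire f /\ ~ polynomial_fun f.

(* Riemann sphere: None = infinity *)
Definition Chat := option C.

Definition chordal (a b : Chat) : R :=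
  match a, b with
  | Some z, Some w =>
      2 * Cmod (Cminus z w) / (sqrt (1 + Cmod z ^ 2) * sqrt (1 + Cmod w ^ 2))
  | Some z, None | None, Some z => 2 / sqrt (1 + Cmod z ^ 2)
  | None, None => 0
  end.

Definition compact_C (K : C -> Prop) : Prop :=
  forall u : nat -> C, (forall k, K (u k)) ->
    exists (phi : nat -> nat) (l : C),
      (forall k, (phi k < phi (S k))%nat) /\ K l /\
      forall eps, 0 < eps -> exists N, forall k, (N <= k)%nat -> Cmod (Cminus (u (phi k)) l) < eps.

Definition sph_cvg_compacta (D : C -> Prop) (g : nat -> C -> C) (lim : C -> Chat) : Prop :=
  forall K : C -> Prop, compact_C K -> (forall z, K z -> D z) ->
    forall eps, 0 < eps -> exists N : nat, forall k z, (N <= k)%nat -> K z ->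
      chordal (Some (g k z)) (lim z) < eps.

Definition quasi_normal {I : Type} (fam : I -> C -> C) (Omega : C -> Prop) : Prop :=
  forall m : nat -> I, exists (Q : list C) (phi : nat -> nat) (lim : C -> Chat),
    (forall k, (phi k < phi (S k))%nat) /\
    sph_cvg_compacta (fun z => Omega z /\ ~ In z Q) (fun k => fam (m (phi k))) lim.

Definition rescaled (f : C -> C) (n : {n : nat | (1 <= n)%nat}) : C -> C :=
  fun z => Cdiv (f (Cmult (RtoC (INR (proj1_sig n))) z)) (RtoC (INR (proj1_sig n))).

Definition henon (f : C -> C) (delta : C) (p : C * C) : C * C :=
  (Cminus (f (fst p)) (Cmult delta (snd p)), fst p).

Definition dist2 (p q : C * C) : R :=
  sqrt (Cmod (Cminus (fst p) (fst q)) ^ 2 + Cmod (Cminus (snd p) (snd q)) ^ 2).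

Definition compact_C2 (X : C * C -> Prop) : Prop :=
  forall u : nat -> C * C, (forall k, X (u k)) ->
    exists (phi : nat -> nat) (l : C * C),
      (forall k, (phi k < phi (S k))%nat) /\ X l /\
      forall eps, 0 < eps -> exists N, forall k, (N <= k)%nat -> dist2 (u (phi k)) l < eps.

Definition separated (g : C * C -> C * C) (X : C * C -> Prop) (n : nat) (eps : R)
  (E : list (C * C)) : Prop :=
  NoDup E /\ (forall p, In p E -> X p) /\
  forall p q, In p E -> In q E -> p <> q ->
    exists k, (k < n)%nat /\ dist2 (Nat.iter k g p) (Nat.iter k g q) > eps.

(* K(n,eps): maximal cardinality of an (n,eps)-separated set (finite for compact X) *)
Definition Ksep (g : C * C -> C * C) (X : C * C -> Prop) (n : nat) (eps : R) : R :=
  real (Lub_Rbar (fun r => exists E, separated g X n eps E /\ r = INR (length E))).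

Definition htop_compact (g : C * C -> C * C) (X : C * C -> Prop) : Rbar :=
  Rbar_lub (fun y => exists eps, 0 < eps /\
    y = LimSup_seq (fun n => ln (Ksep g X n eps) / INR n)).

Definition htop_C2 (g : C * C -> C * C) : Rbar :=
  Rbar_lub (fun y => exists X, compact_C2 X /\ (forall p, X p -> X (g p)) /\
    y = htop_compact g X).

(* Main.v *)
(* A finite spherical limit of [f (n z) / n] on a circle would make [f] affine, so the limits are infinite off finite sets. Hence [f] has infinitely many zeros, and zooming at a large zero gives a point [c] and a radius [r], small compared with [|c|], such that [|f|] is much larger than [|c|] on the circles of radius [r] about [0] and [c], the disc about [c] contains a zero, and the disc about [0] contains as many zeros as desired, say [d]; so [f / c] winds at least [d] times around [0] on the circle [|z| = r].

   For [t = 0] or [t = 1] the set [|f / c - t| < 1/10] then has at least [d / 2] components in the disc about [0]. To see this, colour the disc by the side of the line [Re = 1/2] on which [f / c] lies and recolour the monochromatic components that avoid both sets. The winding still forces [d] arcs of one colour on the boundary circle, alternating with arcs of the other, and as disjoint connected subsets of a disc do not cross, these arcs cannot belong to few components. This is carried out on a fine grid, with chains in place of connected sets.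

   An orbit is a sequence with [z_(k+1) = f z_k - delta z_(k-1)]. Prescribe that it visits with period 3 one of these components, the disc about [c t] and the disc about [0]. By the minimum principle, the parameters that follow a prescribed itinerary up to time [k] are mapped by [z_(k+1)] onto the whole next disc; so every sequence of components is realized by a bounded orbit, and the entropy is at least [log (d / 2) / 5] for every [d]. *)
Require Import Defs.
From Stdlib Require Import Reals List Lra Lia Classical ClassicalEpsilon Relations ZArith ZifyNat.
From Coquelicot Require Import Coquelicot.

Open Scope R_scope.

(** Two target values are needed because the preimage of a single small disc may be connected, as
    for [z ^ d] near 0. A branched cover of degree [d] from a disc to a disc has at most [d - 1]
    critical points by Riemann-Hurwitz, so the preimages of two disjoint discs have at least [d + 1]
    components together. Colouring and winding replace this count by planar combinatorics. They do
    not tell which of [t = 0] and [t = 1] gets the larger share; hence the itinerary must work for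
    both, and a zero of [f] near [c] is needed to return from there to 0.

    The term [delta w] explains the period 3. Landing at [c t] requires [f z = c t + delta w] with
    [w] the previous coordinate, and a piece only controls [f] near [c t]; so [w] must be near 0,
    and each piece is preceded by a visit to the disc about 0. That disc absorbs the term
    [delta c t] left by the visit to [c t], because [|f|] is at least [10 (1 + |delta|) |c|] on its
    boundary. *)

Lemma Cmod_minus_sym (a b : C) : Cmod (a - b) = Cmod (b - a).
Proof. rewrite <- Cmod_opp. f_equal. ring. Qed.

Lemma Cmod_tri_minus (a b c : C) : Cmod (a - c) <= Cmod (a - b) + Cmod (b - c).
Proof. replace (a - c)%C with ((a - b) + (b - c))%C by ring. apply Cmod_triangle. Qed.

Lemma Cmod_sub_le (a b : C) : Cmod (a - b) <= Cmod a + Cmod b.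
Proof. rewrite <- (Cmod_opp b). apply Cmod_triangle. Qed.

Lemma Cmod_le_sub (a b : C) : Cmod a - Cmod b <= Cmod (a - b).
Proof.
  assert (H := Cmod_triangle (a - b) b).
  replace (a - b + b)%C with a in H by ring. lra.
Qed.

Lemma im_le_Cmod (c : C) : Rabs (Im c) <= Cmod c.
Proof. eapply Rle_trans; [ apply Rmax_r | apply (Rmax_Cmod c) ]. Qed.

Lemma Cmod_le_re_im (c : C) : Cmod c <= Rabs (Re c) + Rabs (Im c).
Proof.
  assert (H : c = (RtoC (Re c) + Ci * RtoC (Im c))%C).
  { destruct c; unfold RtoC, Ci, Cplus, Cmult, Re, Im; simpl; f_equal; ring. }
  rewrite H at 1. eapply Rle_trans; [ apply Cmod_triangle |].
  rewrite Cmod_mult, Cmod_Ci, !Cmod_R. lra.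
Qed.

(** * Continuity and complex differentiability *)

Definition cdiff (f : C -> C) (z l : C) : Prop :=
  forall eps, 0 < eps -> exists del, 0 < del /\
    forall h, Cmod h < del -> Cmod (f (z + h) - f z - l * h)%C <= eps * Cmod h.

Definition ccont (f : C -> C) (z : C) : Prop :=
  forall eps, 0 < eps -> exists del, 0 < del /\
    forall w, Cmod (w - z)%C < del -> Cmod (f w - f z)%C < eps.

(* Coquelicot's [C_UniformSpace] uses square balls; these structures use [Cmod]. *)
Notation CU := (AbsRing_UniformSpace C_AbsRing).
Notation CV := (AbsRing_NormedModule C_AbsRing).

Lemma ccont_continuous (f : C -> C) (z : C) : ccont f z <->
  @continuous CU CU f z.
Proof.
  split.
  - intros H P [e He]. destruct (H e (cond_pos e)) as [d [Hd Hf]].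
    exists (mkposreal d Hd). intros w Hw. apply He, Hf, Hw.
  - intros H e He. destruct (H (fun w => Cmod (w - f z)%C < e)) as [d Hd].
    + exists (mkposreal e He). intros w Hw. exact Hw.
    + exists d. split; [apply cond_pos|]. intros w Hw. exact (Hd w Hw).
Qed.

Lemma cdiff_is_derive (f : C -> C) (z l : C) : cdiff f z l <->
  @is_derive C_AbsRing CV f z l.
Proof.
  split.
  - intros H. split; [apply is_linear_scal_l|]. intros x Hx.
    rewrite <- (@is_filter_lim_locally_unique C_AbsRing CV z x Hx). intros e.
    destruct (H e (cond_pos e)) as [d [Hd Hf]]. exists (mkposreal d Hd). intros w Hw. change C in w.
    specialize (Hf (w - z)%C Hw). replace (z + (w - z))%C with w in Hf by ring.
    rewrite (Cmult_comm l) in Hf. exact Hf.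
  - intros [_ H] e He. destruct (H z (fun P HP => HP) (mkposreal e He)) as [d Hd].
    exists d. split; [apply cond_pos|]. intros h Hh. specialize (Hd (z + h)%C).
    assert (E : (z + h - z)%C = h) by ring.
    change (Cmod (z + h - z)%C < d ->
      Cmod (f (z + h)%C - f z - (z + h - z) * l)%C <= e * Cmod (z + h - z)%C) in Hd.
    rewrite E, (Cmult_comm h) in Hd. exact (Hd Hh).
Qed.

Lemma cdiff_ccont (f : C -> C) (z l : C) : cdiff f z l -> ccont f z.
Proof.
  intros H. apply cdiff_is_derive in H. apply ccont_continuous.
  apply (@ex_derive_continuous C_AbsRing CV). now exists l.
Qed.

Lemma ccont_const (c z : C) : ccont (fun _ => c) z.
Proof. apply ccont_continuous, (@continuous_const CU CU). Qed.

Lemma ccont_id (z : C) : ccont (fun w => w) z.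
Proof. apply ccont_continuous, (@continuous_id CU). Qed.

Lemma ccont_plus (f g : C -> C) (z : C) : ccont f z -> ccont g z ->
  ccont (fun w => f w + g w)%C z.
Proof.
  rewrite !ccont_continuous. apply (@continuous_plus CU C_AbsRing CV).
Qed.

Lemma ccont_mult (f g : C -> C) (z : C) : ccont f z -> ccont g z ->
  ccont (fun w => f w * g w)%C z.
Proof. rewrite !ccont_continuous. apply (@continuous_mult CU C_AbsRing). Qed.

Lemma ccont_minus (f g : C -> C) (z : C) : ccont f z -> ccont g z ->
  ccont (fun w => f w - g w)%C z.
Proof.
  rewrite !ccont_continuous. apply (@continuous_minus CU C_AbsRing CV).
Qed.

Lemma ccont_nz (f : C -> C) (z : C) : ccont f z -> f z <> 0 ->
  exists del, 0 < del /\ forall w, Cmod (w - z)%C < del -> Cmod (f z) / 2 < Cmod (f w).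
Proof.
  intros Hf Hz. apply Cmod_gt_0 in Hz.
  destruct (Hf (Cmod (f z) / 2)) as [d [Hd H]]; [lra|].
  exists d; split; auto. intros w Hw. specialize (H w Hw).
  rewrite Cmod_minus_sym in H. pose proof (Cmod_le_sub (f z) (f w)). lra.
Qed.

Lemma Cmod_pos_nz (c : C) : 0 < Cmod c -> c <> 0.
Proof. intros H. now apply Cmod_gt_0. Qed.

Lemma ccont_inv (f : C -> C) (z : C) : ccont f z -> f z <> 0 ->
  ccont (fun w => / f w)%C z.
Proof.
  intros Hf Hz eps He. destruct (ccont_nz f z Hf Hz) as [d1 [Hd1 H1]].
  apply Cmod_gt_0 in Hz as Hp. set (m := Cmod (f z)) in *.
  destruct (Hf (eps * m * m / 2)) as [d2 [Hd2 H2]].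
  { apply Rdiv_lt_0_compat; [|lra]. repeat apply Rmult_lt_0_compat; auto. }
  exists (Rmin d1 d2); split; [apply Rmin_pos; auto|]. intros w Hw.
  specialize (H1 w (Rlt_le_trans _ _ _ Hw (Rmin_l _ _))).
  specialize (H2 w (Rlt_le_trans _ _ _ Hw (Rmin_r _ _))).
  assert (Hw0 : f w <> 0) by (apply Cmod_pos_nz; lra).
  replace (/ f w - / f z)%C with ((f z - f w) / (f w * f z))%C by (field; auto).
  rewrite Cmod_div by (apply Cmult_neq_0; auto).
  rewrite Cmod_mult. fold m.
  assert (Hq : 0 < Cmod (f w) * m) by (apply Rmult_lt_0_compat; lra).
  apply (Rmult_lt_reg_r (Cmod (f w) * m)); auto.
  replace (Cmod (f z - f w) / (Cmod (f w) * m) * (Cmod (f w) * m))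
    with (Cmod (f z - f w)) by (field; split; lra).
  rewrite Cmod_minus_sym. eapply Rlt_le_trans; [exact H2|].
  assert (m / 2 * m <= Cmod (f w) * m) by (apply Rmult_le_compat_r; lra). nra.
Qed.

Lemma ccont_div (f g : C -> C) (z : C) : ccont f z -> ccont g z -> g z <> 0 ->
  ccont (fun w => f w / g w)%C z.
Proof. intros. apply ccont_mult; auto. now apply ccont_inv. Qed.

Lemma ccont_comp (f g : C -> C) (z : C) : ccont g z -> ccont f (g z) ->
  ccont (fun w => f (g w)) z.
Proof. rewrite !ccont_continuous. apply (@continuous_comp CU CU CU). Qed.

Lemma cdiff_const (c z : C) : cdiff (fun _ => c) z 0.
Proof. apply cdiff_is_derive, (@is_derive_const C_AbsRing). Qed.

Lemma cdiff_id (z : C) : cdiff (fun w => w) z 1.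
Proof. apply cdiff_is_derive, (@is_derive_id C_AbsRing). Qed.

Lemma cdiff_plus (f g : C -> C) (z a b : C) : cdiff f z a -> cdiff g z b ->
  cdiff (fun w => f w + g w)%C z (a + b).
Proof. rewrite !cdiff_is_derive. apply (@is_derive_plus C_AbsRing). Qed.

Lemma cdiff_mult (f g : C -> C) (z a b : C) : cdiff f z a -> cdiff g z b ->
  cdiff (fun w => f w * g w)%C z (a * g z + f z * b).
Proof.
  rewrite !cdiff_is_derive. intros Hf Hg. apply (@is_derive_mult C_AbsRing f g z a b Hf Hg), Cmult_comm.
Qed.

Lemma cdiff_comp (f g : C -> C) (z a b : C) : cdiff g z b -> cdiff f (g z) a ->
  cdiff (fun w => f (g w)) z (a * b).
Proof.
  rewrite !cdiff_is_derive, Cmult_comm. intros Hg Hf. now apply (@is_derive_comp C_AbsRing).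
Qed.

Lemma cdiff_inv_at (z : C) : z <> 0 -> cdiff (fun w => / w)%C z (- / (z * z)).
Proof.
  intros Hz. apply Cmod_gt_0 in Hz as Hp. set (m := Cmod z) in *.
  (* The remainder is [h^2 / (z^2 (z + h))]. The first radius keeps [|z + h|] above [m / 2], the
     second then makes [|h|] at most [eps m^2 |z + h|]. *)
  intros eps He. exists (Rmin (m / 2) (eps * (m * m * m) / 2)). split.
  { apply Rmin_pos; [lra|]. apply Rdiv_lt_0_compat; [|lra].
    repeat apply Rmult_lt_0_compat; auto. }
  intros h Hh.
  assert (H1 := Rlt_le_trans _ _ _ Hh (Rmin_l _ _)).
  assert (H2 := Rlt_le_trans _ _ _ Hh (Rmin_r _ _)).
  assert (H3 : m / 2 < Cmod (z + h)).
  { assert (H3 := Cmod_le_sub z (- h)). rewrite Cmod_opp in H3.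
    replace (z - - h)%C with (z + h)%C in H3 by ring. fold m in H3. lra. }
  assert (Hzh : (z + h)%C <> 0) by (apply Cmod_pos_nz; lra).
  replace (/ (z + h) - / z - - / (z * z) * h)%C with (h * h / (z * z * (z + h)))%C
    by (field; auto).
  rewrite Cmod_div, !Cmod_mult. 2:{ repeat apply Cmult_neq_0; auto. }
  fold m. pose proof (Cmod_ge_0 h) as Ph.
  assert (Hq : 0 < m * m * Cmod (z + h)).
  { repeat apply Rmult_lt_0_compat; lra. }
  apply (Rmult_le_reg_r (m * m * Cmod (z + h))); auto.
  replace (Cmod h * Cmod h / (m * m * Cmod (z + h)) * (m * m * Cmod (z + h)))
    with (Cmod h * Cmod h) by (field; split; lra).
  assert (Cmod h <= eps * (m * m * Cmod (z + h))).
  { assert (m * m * (m / 2) <= m * m * Cmod (z + h)).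
    { apply Rmult_le_compat_l; nra. }
    nra. }
  replace (eps * Cmod h * (m * m * Cmod (z + h))) with
    (Cmod h * (eps * (m * m * Cmod (z + h)))) by ring.
  apply Rmult_le_compat_l; auto.
Qed.

Lemma cdiff_ext_loc (f g : C -> C) (z l : C) (r : R) : 0 < r ->
  (forall w, Cmod (w - z)%C < r -> f w = g w) -> cdiff f z l -> cdiff g z l.
Proof.
  rewrite !cdiff_is_derive. intros Hr He. apply is_derive_ext_loc. exists (mkposreal r Hr). exact He.
Qed.

Definition hol (f : C -> C) (z : C) : Prop := exists l, cdiff f z l.

Lemma hol_ccont (f : C -> C) (z : C) : hol f z -> ccont f z.
Proof. intros [l H]. eapply cdiff_ccont; eauto. Qed.
Lemma hol_const (c z : C) : hol (fun _ => c) z.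
Proof. eexists; apply cdiff_const. Qed.
Lemma hol_id (z : C) : hol (fun w => w) z.
Proof. eexists; apply cdiff_id. Qed.
Lemma hol_plus (f g : C -> C) (z : C) : hol f z -> hol g z -> hol (fun w => f w + g w)%C z.
Proof. intros [a Ha] [b Hb]. eexists; apply cdiff_plus; eauto. Qed.
Lemma hol_mult (f g : C -> C) (z : C) : hol f z -> hol g z -> hol (fun w => f w * g w)%C z.
Proof. intros [a Ha] [b Hb]. eexists; apply cdiff_mult; eauto. Qed.
Lemma hol_comp (f g : C -> C) (z : C) : hol g z -> hol f (g z) -> hol (fun w => f (g w)) z.
Proof. intros [a Ha] [b Hb]. eexists; apply (cdiff_comp f g); eauto. Qed.
Lemma hol_ext_loc (f g : C -> C) (z : C) (r : R) : 0 < r ->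
  (forall w, Cmod (w - z)%C < r -> f w = g w) -> hol f z -> hol g z.
Proof. intros H1 H2 [l Hl]. exists l. eapply cdiff_ext_loc; eauto. Qed.
Lemma hol_ext (f g : C -> C) (z : C) : (forall w, f w = g w) -> hol f z -> hol g z.
Proof. intros H. apply (hol_ext_loc f g z 1); auto; lra. Qed.
Lemma hol_opp (f : C -> C) (z : C) : hol f z -> hol (fun w => - f w)%C z.
Proof.
  intros H. apply (hol_ext (fun w => (- (1)) * f w)%C).
  - intros w. ring.
  - apply hol_mult; auto. apply hol_const.
Qed.
Lemma hol_minus (f g : C -> C) (z : C) : hol f z -> hol g z -> hol (fun w => f w - g w)%C z.
Proof. intros. apply hol_plus; auto. now apply hol_opp. Qed.
Lemma hol_inv (f : C -> C) (z : C) : hol f z -> f z <> 0 -> hol (fun w => / f w)%C z.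
Proof.
  intros H Hz. apply (hol_comp (fun w => / w)%C f); auto.
  eexists. now apply cdiff_inv_at.
Qed.
Lemma hol_div (f g : C -> C) (z : C) : hol f z -> hol g z -> g z <> 0 ->
  hol (fun w => f w / g w)%C z.
Proof. intros. apply hol_mult; auto. now apply hol_inv. Qed.

(** * Cauchy theory on discs *)

Definition rcont (u : R -> C) (t : R) : Prop :=
  forall eps, 0 < eps -> exists del, 0 < del /\
    forall s, Rabs (s - t) < del -> Cmod (u s - u t)%C < eps.

Definition CI (u : R -> C) (a b : R) : C :=
  (RInt (fun t => Re (u t)) a b, RInt (fun t => Im (u t)) a b).

Lemma continuous_of_eps (v : R -> R) (t : R) :
  (forall eps, 0 < eps -> exists del, 0 < del /\
    forall s, Rabs (s - t) < del -> Rabs (v s - v t) < eps) -> continuous v t.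
Proof.
  intros H. apply continuity_pt_filterlim. intros eps He.
  destruct (H eps He) as [d [Hd Hv]]. exists d; split; auto.
  intros s [_ Hs]. unfold dist in *; simpl in *. unfold R_dist in *. auto.
Qed.

Lemma rcont_Re (u : R -> C) (t : R) : rcont u t -> continuous (fun s => Re (u s)) t.
Proof.
  intros H. apply continuous_of_eps. intros eps He. destruct (H eps He) as [d [Hd Hu]].
  exists d; split; auto. intros s Hs. specialize (Hu s Hs).
  eapply Rle_lt_trans; [|exact Hu].
  eapply Rle_trans; [|apply re_le_Cmod]. right. f_equal.
Qed.

Lemma rcont_Im (u : R -> C) (t : R) : rcont u t -> continuous (fun s => Im (u s)) t.
Proof.
  intros H. apply continuous_of_eps. intros eps He. destruct (H eps He) as [d [Hd Hu]].
  exists d; split; auto. intros s Hs. specialize (Hu s Hs).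
  eapply Rle_lt_trans; [|exact Hu].
  eapply Rle_trans; [|apply im_le_Cmod]. right. f_equal.
Qed.

Definition rcont_on (u : R -> C) (a b : R) := forall t, a <= t <= b -> rcont u t.

Lemma exI_Re (u : R -> C) (a b : R) : a <= b -> rcont_on u a b ->
  ex_RInt (fun t => Re (u t)) a b.
Proof.
  intros Hab H. apply (ex_RInt_continuous (V := R_CompleteNormedModule)).
  intros z Hz. rewrite Rmin_left, Rmax_right in Hz by auto. apply rcont_Re; auto.
Qed.
Lemma exI_Im (u : R -> C) (a b : R) : a <= b -> rcont_on u a b ->
  ex_RInt (fun t => Im (u t)) a b.
Proof.
  intros Hab H. apply (ex_RInt_continuous (V := R_CompleteNormedModule)).
  intros z Hz. rewrite Rmin_left, Rmax_right in Hz by auto. apply rcont_Im; auto.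
Qed.

Lemma Ceq (a b : C) : Re a = Re b -> Im a = Im b -> a = b.
Proof. destruct a, b; simpl; intros; subst; auto. Qed.

Lemma CI_ext (u v : R -> C) (a b : R) : a <= b ->
  (forall t, a <= t <= b -> u t = v t) -> CI u a b = CI v a b.
Proof.
  intros Hab H. unfold CI. f_equal; apply RInt_ext; intros t Ht;
  rewrite Rmin_left, Rmax_right in Ht by auto; rewrite H; auto; lra.
Qed.

Lemma CI_plus (u v : R -> C) (a b : R) : a <= b -> rcont_on u a b -> rcont_on v a b ->
  CI (fun t => u t + v t)%C a b = (CI u a b + CI v a b)%C.
Proof.
  intros Hab Hu Hv. unfold CI, Cplus. simpl. f_equal.
  - apply (RInt_plus (V := R_CompleteNormedModule)); apply exI_Re; auto.
  - apply (RInt_plus (V := R_CompleteNormedModule)); apply exI_Im; auto.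
Qed.

Lemma RInt_lin (f g : R -> R) (a b p q : R) : ex_RInt f a b -> ex_RInt g a b ->
  RInt (fun t => p * f t + q * g t) a b = p * RInt f a b + q * RInt g a b.
Proof.
  intros Hf Hg.
  rewrite (RInt_plus (V := R_CompleteNormedModule) (fun t => p * f t) (fun t => q * g t)).
  - rewrite (RInt_scal (V := R_CompleteNormedModule) f), (RInt_scal (V := R_CompleteNormedModule) g); auto.
  - apply (ex_RInt_scal (V := R_NormedModule)); auto.
  - apply (ex_RInt_scal (V := R_NormedModule)); auto.
Qed.

Lemma CI_scal (c : C) (u : R -> C) (a b : R) : a <= b -> rcont_on u a b ->
  CI (fun t => c * u t)%C a b = (c * CI u a b)%C.
Proof.
  intros Hab Hu. apply Ceq; unfold CI; simpl.
  - rewrite <- (RInt_ext (fun t => fst c * Re (u t) + - snd c * Im (u t))).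
    2:{ intros. unfold Cmult, Re, Im; simpl; ring. }
    rewrite (RInt_lin (fun t => Re (u t)) (fun t => Im (u t)));
      [unfold Re, Im; ring|now apply exI_Re|now apply exI_Im].
  - rewrite <- (RInt_ext (fun t => fst c * Im (u t) + snd c * Re (u t))).
    2:{ intros. unfold Cmult, Re, Im; simpl; ring. }
    rewrite (RInt_lin (fun t => Im (u t)) (fun t => Re (u t)));
      [unfold Re, Im; ring|now apply exI_Im|now apply exI_Re].
Qed.

Lemma CI_Chasles (u : R -> C) (a b c : R) : a <= b -> b <= c -> rcont_on u a c ->
  CI u a c = (CI u a b + CI u b c)%C.
Proof.
  intros Hab Hbc Hu. unfold CI, Cplus. simpl.
  assert (H1 : rcont_on u a b) by (intros t Ht; apply Hu; lra).
  assert (H2 : rcont_on u b c) by (intros t Ht; apply Hu; lra).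
  f_equal; symmetry.
  - apply (RInt_Chasles (V := R_CompleteNormedModule) (fun t => Re (u t)));
      now apply exI_Re.
  - apply (RInt_Chasles (V := R_CompleteNormedModule) (fun t => Im (u t)));
      now apply exI_Im.
Qed.

Lemma RInt_abs_bound (v : R -> R) (a b M : R) : a <= b -> ex_RInt v a b ->
  (forall t, a <= t <= b -> Rabs (v t) <= M) -> Rabs (RInt v a b) <= M * (b - a).
Proof.
  intros Hab Hv HM. rewrite Rmult_comm. apply abs_RInt_le_const; auto.
Qed.

(** The factor 2 comes from bounding real and imaginary part separately. It is harmless: estimates
    are used up to constants, and the power trick in [max_modulus0] removes it where sharpness
    matters. *)
Lemma CI_bound (u : R -> C) (a b M : R) : a <= b -> rcont_on u a b ->
  (forall t, a <= t <= b -> Cmod (u t) <= M) -> Cmod (CI u a b) <= 2 * M * (b - a).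
Proof.
  intros Hab Hu HM. eapply Rle_trans; [apply Cmod_le_re_im|].
  replace (2 * M * (b - a)) with (M * (b - a) + M * (b - a)) by ring.
  apply Rplus_le_compat; unfold CI; simpl; apply RInt_abs_bound; auto.
  - apply exI_Re; auto.
  - intros; eapply Rle_trans; [apply re_le_Cmod|auto].
  - apply exI_Im; auto.
  - intros; eapply Rle_trans; [apply im_le_Cmod|auto].
Qed.

Lemma RInt_affine (p q a b : R) :
  RInt (fun t => p + q * t) a b = p * (b - a) + q * ((b * b - a * a) / 2).
Proof.
  apply is_RInt_unique.
  replace (p * (b - a) + q * ((b * b - a * a) / 2)) with
    (minus (p * b + q * (b * b / 2)) (p * a + q * (a * a / 2)))
    by (unfold minus, plus, opp; simpl; field).
  apply (is_RInt_derive (fun t => p * t + q * (t * t / 2))).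
  - intros x _. auto_derive; auto. field.
  - intros x _. apply (ex_derive_continuous (fun t => p + q * t)). auto_derive; auto.
Qed.

Lemma CI_affine (p q : C) (a b : R) :
  CI (fun t => p + q * RtoC t)%C a b =
  (p * RtoC (b - a) + q * RtoC ((b * b - a * a) / 2))%C.
Proof.
  apply Ceq; unfold CI; simpl.
  - rewrite <- (RInt_ext (fun t => Re p + Re q * t)).
    2:{ intros; unfold Re, Im; simpl; ring. }
    rewrite RInt_affine. unfold Re, Im; simpl; field.
  - rewrite <- (RInt_ext (fun t => Im p + Im q * t)).
    2:{ intros; unfold Re, Im; simpl; ring. }
    rewrite RInt_affine. unfold Re, Im; simpl; field.
Qed.

Lemma ccont_rcont_h (f : C -> C) (t y : R) : ccont f (t, y) -> rcont (fun s => f (s, y)) t.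
Proof.
  intros H eps He. destruct (H eps He) as [d [Hd Hf]]. exists d; split; auto.
  intros s Hs. apply Hf. replace ((s, y) - (t, y))%C with (RtoC (s - t)).
  - now rewrite Cmod_R.
  - apply Ceq; simpl; ring.
Qed.
Lemma ccont_rcont_v (f : C -> C) (t x : R) : ccont f (x, t) -> rcont (fun s => f (x, s)) t.
Proof.
  intros H eps He. destruct (H eps He) as [d [Hd Hf]]. exists d; split; auto.
  intros s Hs. apply Hf. replace ((x, s) - (x, t))%C with (Ci * RtoC (s - t))%C.
  - now rewrite Cmod_mult, Cmod_Ci, Cmod_R, Rmult_1_l.
  - apply Ceq; simpl; ring.
Qed.

(** The contour integral along the boundary, counterclockwise; on the vertical sides [dz = i dt]. *)
Definition rectI (f : C -> C) (x y w h : R) : C :=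
  (CI (fun t => f (t, y)) x (x + w) + Ci * CI (fun t => f ((x + w)%R, t)) y (y + h)
   - CI (fun t => f (t, (y + h)%R)) x (x + w) - Ci * CI (fun t => f (x, t)) y (y + h))%C.

Definition on_rect (P : C -> Prop) (x y w h : R) : Prop :=
  forall a b, x <= a <= x + w -> y <= b <= y + h -> P (a, b).

Lemma rect_rcont_h (f : C -> C) (x y w h b a a' : R) : on_rect (ccont f) x y w h ->
  y <= b <= y + h -> x <= a -> a' <= x + w -> rcont_on (fun t => f (t, b)) a a'.
Proof. intros H Hb Ha Ha' t Ht. apply ccont_rcont_h, H; lra. Qed.
Lemma rect_rcont_v (f : C -> C) (x y w h a b b' : R) : on_rect (ccont f) x y w h ->
  x <= a <= x + w -> y <= b -> b' <= y + h -> rcont_on (fun t => f (a, t)) b b'.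
Proof. intros H Ha Hb Hb' t Ht. apply ccont_rcont_v, H; lra. Qed.

(** The inner sides are run through twice in opposite directions, so only the four outer sides have
    to be split. *)
Lemma rectI_quarters (f : C -> C) (x y w h : R) : 0 <= w -> 0 <= h ->
  on_rect (ccont f) x y (2 * w) (2 * h) ->
  rectI f x y (2 * w) (2 * h) =
  (rectI f x y w h + rectI f (x + w) y w h + rectI f x (y + h) w h
   + rectI f (x + w) (y + h) w h)%C.
Proof.
  intros Hw Hh Hc. unfold rectI.
  replace (x + w + w) with (x + 2 * w) by ring.
  replace (y + h + h) with (y + 2 * h) by ring.
  rewrite (CI_Chasles (fun t => f (t, y)) x (x + w) (x + 2 * w)); try lra.
  2:{ eapply rect_rcont_h; eauto; lra. }
  rewrite (CI_Chasles (fun t => f (t, (y + 2 * h)%R)) x (x + w) (x + 2 * w)); try lra.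
  2:{ eapply rect_rcont_h; eauto; lra. }
  rewrite (CI_Chasles (fun t => f (x, t)) y (y + h) (y + 2 * h)); try lra.
  2:{ eapply rect_rcont_v; eauto; lra. }
  rewrite (CI_Chasles (fun t => f ((x + 2 * w)%R, t)) y (y + h) (y + 2 * h)); try lra.
  2:{ eapply rect_rcont_v; eauto; lra. }
  ring.
Qed.

(** Affine functions have explicit primitives on each side. In Goursat's argument they are the
    first-order part of [f] at the limit point. *)
Lemma rectI_affine (A B : C) (x y w h : R) : rectI (fun z => A + B * z)%C x y w h = 0.
Proof.
  unfold rectI.
  assert (Hh : forall b a a', CI (fun t => A + B * (t, b))%C a a' =
    CI (fun t => (A + B * (0, b)) + B * RtoC t)%C a a').
  { intros. unfold CI. f_equal; apply RInt_ext; intros; simpl; ring. }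
  assert (Hv : forall a b b', CI (fun t => A + B * (a, t))%C b b' =
    CI (fun t => (A + B * RtoC a) + (B * Ci) * RtoC t)%C b b').
  { intros. unfold CI. f_equal; apply RInt_ext; intros; simpl; ring. }
  rewrite !Hh, !Hv, !CI_affine. apply Ceq; simpl; field.
Qed.

Lemma rectI_plus (f g : C -> C) (x y w h : R) : 0 <= w -> 0 <= h ->
  on_rect (ccont f) x y w h -> on_rect (ccont g) x y w h ->
  rectI (fun z => f z + g z)%C x y w h = (rectI f x y w h + rectI g x y w h)%C.
Proof.
  intros Hw Hh Hf Hg. unfold rectI.
  rewrite !CI_plus; try lra; try (eapply rect_rcont_h; eauto; lra);
    try (eapply rect_rcont_v; eauto; lra). ring.
Qed.

Lemma rectI_ext (f g : C -> C) (x y w h : R) : (forall z, f z = g z) ->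
  rectI f x y w h = rectI g x y w h.
Proof.
  intros H.
  assert (E : forall (u : R -> C) a b, CI (fun t => f (u t)) a b = CI (fun t => g (u t)) a b).
  { intros u a b. unfold CI. f_equal; apply RInt_ext; intros; now rewrite H. }
  unfold rectI. now rewrite (E (fun t => (t, y))), (E (fun t => (x + w, t)%R)),
    (E (fun t => (t, y + h)%R)), (E (fun t => (x, t))).
Qed.

Lemma rectI_bound (f : C -> C) (x y w h M : R) : 0 <= w -> 0 <= h ->
  on_rect (ccont f) x y w h -> on_rect (fun z => Cmod (f z) <= M) x y w h ->
  Cmod (rectI f x y w h) <= 4 * M * (w + h).
Proof.
  intros Hw Hh Hf HM. unfold rectI.
  assert (B1 : forall b, y <= b <= y + h -> Cmod (CI (fun t => f (t, b)) x (x + w))%C <= 2 * M * w).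
  { intros b Hb. replace (2 * M * w) with (2 * M * (x + w - x)) by ring.
    apply CI_bound; try lra. { eapply rect_rcont_h; eauto; lra. }
    intros t Ht. apply HM; lra. }
  assert (B2 : forall a, x <= a <= x + w -> Cmod (Ci * CI (fun t => f (a, t)) y (y + h))%C <= 2 * M * h).
  { intros a Ha. replace (2 * M * h) with (2 * M * (y + h - y)) by ring.
    rewrite Cmod_mult, Cmod_Ci, Rmult_1_l.
    apply CI_bound; try lra. { eapply rect_rcont_v; eauto; lra. }
    intros t Ht. apply HM; lra. }
  eapply Rle_trans; [apply Cmod_sub_le|].
  eapply Rle_trans; [apply Rplus_le_compat_r, Cmod_sub_le|].
  eapply Rle_trans; [apply Rplus_le_compat_r, Rplus_le_compat_r, Cmod_triangle|].
  assert (H1 := B1 y ltac:(lra)). assert (H2 := B1 (y + h) ltac:(lra)).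
  assert (H3 := B2 x ltac:(lra)). assert (H4 := B2 (x + w) ltac:(lra)).
  lra.
Qed.

Lemma goursat_step (f : C -> C) (x y w h : R) : 0 <= w -> 0 <= h ->
  on_rect (ccont f) x y w h ->
  exists x' y', x <= x' <= x + w / 2 /\ y <= y' <= y + h / 2 /\
    Cmod (rectI f x y w h) <= 4 * Cmod (rectI f x' y' (w / 2) (h / 2))%C.
Proof.
  intros Hw Hh Hc.
  assert (E := rectI_quarters f x y (w / 2) (h / 2)).
  replace (2 * (w / 2)) with w in E by field. replace (2 * (h / 2)) with h in E by field.
  specialize (E ltac:(lra) ltac:(lra) Hc).
  set (A := rectI f x y (w / 2) (h / 2)) in *.
  set (B := rectI f (x + w / 2) y (w / 2) (h / 2)) in *.
  set (D := rectI f x (y + h / 2) (w / 2) (h / 2)) in *.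
  set (G := rectI f (x + w / 2) (y + h / 2) (w / 2) (h / 2)) in *.
  assert (Ht : Cmod (rectI f x y w h) <= Cmod A + Cmod B + Cmod D + Cmod G).
  { rewrite E. eapply Rle_trans; [apply Cmod_triangle|]. apply Rplus_le_compat_r.
    eapply Rle_trans; [apply Cmod_triangle|]. apply Rplus_le_compat_r. apply Cmod_triangle. }
  destruct (Rle_dec (Cmod (rectI f x y w h)) (4 * Cmod A)) as [|n1].
  { exists x, y. repeat split; try lra. auto. }
  destruct (Rle_dec (Cmod (rectI f x y w h)) (4 * Cmod B)) as [|n2].
  { exists (x + w / 2), y. repeat split; try lra. auto. }
  destruct (Rle_dec (Cmod (rectI f x y w h)) (4 * Cmod D)) as [|n3].
  { exists x, (y + h / 2). repeat split; try lra. auto. }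
  exists (x + w / 2), (y + h / 2). repeat split; try lra. fold G. lra.
Qed.

Lemma nested_point (u : nat -> R) (w : R) :
  (forall n, u n <= u (S n) <= u n + w / 2 ^ S n) -> 0 <= w ->
  exists p, forall n, u n <= p <= u n + w / 2 ^ n.
Proof.
  intros Hu Hw.
  assert (Hpow : forall n, 0 < 2 ^ n) by (intros; apply pow_lt; lra).
  assert (Hs : forall n, w / 2 ^ n = w / 2 ^ S n + w / 2 ^ S n).
  { intros n. simpl. field. specialize (Hpow n); lra. }
  assert (Hp : forall n, 0 <= w / 2 ^ n).
  { intros n. apply Rmult_le_pos; auto. left. now apply Rinv_0_lt_compat. }
  assert (Hm : forall n k, u n <= u (n + k)%nat /\ u (n + k)%nat + w / 2 ^ (n + k) <= u n + w / 2 ^ n).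
  { intros n k. induction k as [|k IH].
    - rewrite Nat.add_0_r. split; lra.
    - replace (n + S k)%nat with (S (n + k)) by lia.
      specialize (Hu (n + k)%nat). specialize (Hs (n + k)%nat). lra. }
  assert (Hle : forall n m, u m <= u n + w / 2 ^ n).
  { intros n m. destruct (le_ge_dec n m) as [L|L].
    - destruct (Hm n (m - n)%nat) as [_ H]. replace (n + (m - n))%nat with m in H by lia.
      specialize (Hp m). lra.
    - destruct (Hm m (n - m)%nat) as [H _]. replace (m + (n - m))%nat with n in H by lia.
      specialize (Hp n). lra. }
  destruct (completeness (fun r => exists n, r = u n)) as [p [Hub Hlub]].
  - exists (u O + w / 2 ^ 0). intros r [n ->]. apply Hle.
  - exists (u O), O; auto.
  - exists p. intros n. split.
    + apply Hub. now exists n.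
    + apply Hlub. intros r [m ->]. apply Hle.
Qed.

Lemma pow2_large (a : R) : 0 <= a -> forall eps, 0 < eps -> exists n, a / 2 ^ n < eps.
Proof.
  intros Ha eps He.
  destruct (Pow_x_infinity 2 ltac:(rewrite Rabs_right; lra) (a / eps + 1)) as [n Hn].
  exists n. specialize (Hn n (le_n n)).
  assert (0 < 2 ^ n) by (apply pow_lt; lra). rewrite Rabs_right in Hn by lra.
  apply (Rmult_lt_reg_r (2 ^ n)); auto.
  replace (a / 2 ^ n * 2 ^ n) with a by (field; lra).
  assert (a / eps * eps = a) by (field; lra). nra.
Qed.

(* Goursat's bisection argument. *)
Lemma rectI_hol (f : C -> C) (x y w h : R) : 0 <= w -> 0 <= h ->
  on_rect (hol f) x y w h -> rectI f x y w h = 0.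
Proof.
  intros Hw Hh Hf.
  assert (Hc : on_rect (ccont f) x y w h) by (intros a b Ha Hb; apply hol_ccont; auto).
  assert (Hpow : forall n, 0 < 2 ^ n) by (intros; apply pow_lt; lra).
  assert (Hdiv : forall a n, 0 <= a -> 0 <= a / 2 ^ n).
  { intros a n Ha. apply Rmult_le_pos; auto. left. now apply Rinv_0_lt_compat. }
  set (inv := fun n (p : R * R) => x <= fst p /\ fst p + w / 2 ^ n <= x + w /\
                          y <= snd p /\ snd p + h / 2 ^ n <= y + h).
  assert (Hhalf : forall a n, a / 2 ^ n / 2 = a / 2 ^ S n).
  { intros. simpl. field. specialize (Hpow n); lra. }
  assert (step : forall n (p : {p : R * R | inv n p}), exists q : {q : R * R | inv (S n) q},
    fst (proj1_sig p) <= fst (proj1_sig q) <= fst (proj1_sig p) + w / 2 ^ S n /\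
    snd (proj1_sig p) <= snd (proj1_sig q) <= snd (proj1_sig p) + h / 2 ^ S n /\
    Cmod (rectI f (fst (proj1_sig p)) (snd (proj1_sig p)) (w / 2 ^ n) (h / 2 ^ n))%C <=
    4 * Cmod (rectI f (fst (proj1_sig q)) (snd (proj1_sig q)) (w / 2 ^ S n) (h / 2 ^ S n))%C).
  { intros n [[px py] Hi]. unfold inv in Hi. simpl in *.
    destruct (goursat_step f px py (w / 2 ^ n) (h / 2 ^ n)) as [x' [y' [H1 [H2 H3]]]]; auto.
    { intros a b Ha Hb. apply Hc; lra. }
    rewrite !Hhalf in *.
    assert (Hi' : inv (S n) (x', y')).
    { unfold inv; simpl. change (2 * 2 ^ n) with (2 ^ S n).
      assert (w / 2 ^ n = w / 2 ^ S n + w / 2 ^ S n) by (simpl; field; specialize (Hpow n); lra).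
      assert (h / 2 ^ n = h / 2 ^ S n + h / 2 ^ S n) by (simpl; field; specialize (Hpow n); lra).
      simpl pow in *. repeat split; lra. }
    exists (exist _ (x', y') Hi'). simpl. auto. }
  assert (H0 : inv O (x, y)) by (unfold inv; simpl; repeat split; lra).
  set (stepf := fun n p => proj1_sig (constructive_indefinite_description _ (step n p))).
  set (sq := fix sq n : {p : R * R | inv n p} :=
    match n with O => exist _ (x, y) H0 | S k => stepf k (sq k) end).
  assert (Hsq : forall n,
    fst (proj1_sig (sq n)) <= fst (proj1_sig (sq (S n))) <= fst (proj1_sig (sq n)) + w / 2 ^ S n /\
    snd (proj1_sig (sq n)) <= snd (proj1_sig (sq (S n))) <= snd (proj1_sig (sq n)) + h / 2 ^ S n /\
    Cmod (rectI f (fst (proj1_sig (sq n))) (snd (proj1_sig (sq n))) (w / 2 ^ n) (h / 2 ^ n))%C <=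
    4 * Cmod (rectI f (fst (proj1_sig (sq (S n)))) (snd (proj1_sig (sq (S n)))) (w / 2 ^ S n) (h / 2 ^ S n))%C).
  { intros n. change (sq (S n)) with (stepf n (sq n)). unfold stepf.
    apply (proj2_sig (constructive_indefinite_description _ (step n (sq n)))). }
  set (u := fun n => fst (proj1_sig (sq n))). set (v := fun n => snd (proj1_sig (sq n))).
  assert (HI : forall n, Cmod (rectI f x y w h) <= 4 ^ n * Cmod (rectI f (u n) (v n) (w / 2 ^ n) (h / 2 ^ n))%C).
  { induction n as [|n IH].
    - simpl. unfold u, v; simpl. rewrite !Rdiv_1_r. lra.
    - destruct (Hsq n) as [_ [_ H3]]. fold (u n) (v n) (u (S n)) (v (S n)) in H3.
      assert (0 < 4 ^ n) by (apply pow_lt; lra).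
      eapply Rle_trans; [exact IH|].
      apply Rle_trans with (4 ^ n * (4 * Cmod (rectI f (u (S n)) (v (S n)) (w / 2 ^ S n) (h / 2 ^ S n))%C)).
      + apply Rmult_le_compat_l; lra.
      + right. change (4 ^ S n) with (4 * 4 ^ n). ring. }
  destruct (nested_point u w) as [p Hp]; auto. { intros n. apply Hsq. }
  destruct (nested_point v h) as [q Hq]; auto. { intros n. apply Hsq. }
  assert (Hpq : hol f (p, q)).
  { specialize (Hp O). specialize (Hq O). unfold u, v in *. simpl in *.
    rewrite Rdiv_1_r in *. apply Hf; auto. }
  destruct Hpq as [l Hl].
  apply Cmod_eq_0. apply Rle_antisym; [|apply Cmod_ge_0].
  apply le_epsilon. intros eps He. rewrite Rplus_0_l.
  (* The final estimate is [eps / K] times [4 (w + h)^2], the factor [4 ^ n] being compensated by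
     the area of the small rectangle. The summand 1 keeps [K] positive for a degenerate
     rectangle. *)
  set (K := 4 * (w + h) * (w + h) + 1). assert (HK : 0 < K) by (unfold K; nra).
  destruct (Hl (eps / K)) as [d [Hd Hloc]]. { apply Rdiv_lt_0_compat; auto. }
  destruct (pow2_large (w + h) ltac:(lra) d Hd) as [n Hn].
  eapply Rle_trans; [apply (HI n)|].
  set (w' := w / 2 ^ n) in *. set (h' := h / 2 ^ n) in *.
  assert (Hw' : 0 <= w') by (apply Hdiv; auto). assert (Hh' : 0 <= h') by (apply Hdiv; auto).
  assert (Hinv := proj2_sig (sq n)).
  change (x <= u n /\ u n + w' <= x + w /\ y <= v n /\ v n + h' <= y + h) in Hinv.
  destruct Hinv as [Hi1 [Hi2 [Hi3 Hi4]]].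
  specialize (Hp n). specialize (Hq n). fold w' in Hp. fold h' in Hq.
  assert (Hsum : w' + h' < d). { unfold w', h'. rewrite <- Rdiv_plus_distr. exact Hn. }
  set (pq := (p, q) : C) in *.
  (* Removing the tangent at the limit point changes no contour integral and leaves a function that
     is small compared with the sides. *)
  set (r := fun z => (f z - f pq - l * (z - pq))%C).
  assert (Hrc : on_rect (ccont r) (u n) (v n) w' h').
  { intros a b Ha Hb. unfold r. apply ccont_minus.
    - apply ccont_minus; [apply Hc; lra|apply ccont_const].
    - apply ccont_mult; [apply ccont_const|].
      apply ccont_minus; [apply ccont_id|apply ccont_const]. }
  assert (E : rectI f (u n) (v n) w' h' = rectI r (u n) (v n) w' h').
  { transitivity (rectI (fun z => r z + ((f pq - l * pq) + l * z))%C (u n) (v n) w' h').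
    - apply rectI_ext. intros z. unfold r. ring.
    - rewrite rectI_plus, rectI_affine; auto; [ring|].
      intros a b _ _. apply ccont_plus; [apply ccont_const|].
      apply ccont_mult; [apply ccont_const|apply ccont_id]. }
  rewrite E.
  assert (B := rectI_bound r (u n) (v n) w' h' (eps / K * (w' + h')) Hw' Hh' Hrc).
  assert (B' : on_rect (fun z => Cmod (r z) <= eps / K * (w' + h')) (u n) (v n) w' h').
  { intros a b Ha Hb. unfold r.
    set (e := ((a, b) - pq)%C).
    assert (He' : Cmod e <= w' + h').
    { eapply Rle_trans; [apply Cmod_le_re_im|]. unfold e, pq; simpl.
      apply Rplus_le_compat; apply Rabs_le; lra. }
    specialize (Hloc e ltac:(lra)).
    replace (pq + e)%C with ((a, b) : C) in Hloc by (unfold e, pq; apply Ceq; simpl; ring).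
    eapply Rle_trans; [exact Hloc|]. apply Rmult_le_compat_l; auto.
    left. apply Rdiv_lt_0_compat; auto. }
  specialize (B B').
  assert (H4 : 0 < 4 ^ n) by (apply pow_lt; lra).
  eapply Rle_trans; [apply Rmult_le_compat_l; [lra|exact B]|].
  replace (4 ^ n * (4 * (eps / K * (w' + h')) * (w' + h'))) with
    (eps / K * (4 * (w + h) * (w + h))).
  - assert (eps / K * K = eps) by (field; lra).
    assert (0 < eps / K) by (apply Rdiv_lt_0_compat; auto).
    unfold K in *. nra.
  - unfold w', h'. replace 4 with (2 * 2) at 2 by ring. rewrite Rpow_mult_distr.
    field. split; [specialize (Hpow n); lra|lra].
Qed.

(** * Subsequences and compactness *)

Lemma subseq_choice (P : nat -> nat -> Prop) :
  (forall k N, exists p, (N <= p)%nat /\ P k p) ->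
  exists phi : nat -> nat, (forall k, (phi k < phi (S k))%nat) /\ forall k, P k (phi k).
Proof.
  intros H.
  set (g := fun k N => proj1_sig (constructive_indefinite_description _ (H k N))).
  assert (Hg : forall k N, (N <= g k N)%nat /\ P k (g k N)).
  { intros. apply (proj2_sig (constructive_indefinite_description _ (H k N))). }
  set (phi := fix phi k := match k with O => g O O | S j => g (S j) (S (phi j)) end).
  exists phi. split.
  - intros k. change (phi (S k)) with (g (S k) (S (phi k))).
    destruct (Hg (S k) (S (phi k))); lia.
  - intros [|k]; simpl; apply Hg.
Qed.

Lemma incr_ge (phi : nat -> nat) : (forall k, (phi k < phi (S k))%nat) ->
  forall k, (k <= phi k)%nat.
Proof. intros H k. induction k; [lia|]. specialize (H k). lia. Qed.

Lemma incr_mono (phi : nat -> nat) : (forall k, (phi k < phi (S k))%nat) ->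
  forall j k, (j < k)%nat -> (phi j < phi k)%nat.
Proof. intros H j k L. induction L; [apply H|]. specialize (H m). lia. Qed.

Lemma inv_S_pos (k : nat) : 0 < / INR (S k).
Proof. apply Rinv_0_lt_compat, lt_0_INR. lia. Qed.

Lemma inv_S_small (eps : R) : 0 < eps -> exists N, forall k, (N <= k)%nat -> / INR (S k) < eps.
Proof.
  intros He. destruct (nfloor_ex (/ eps)) as [n [_ Hn]].
  { left. now apply Rinv_0_lt_compat. }
  exists n. intros k Hk.
  assert (0 < / eps) by now apply Rinv_0_lt_compat.
  rewrite <- (Rinv_inv eps). apply Rinv_lt_contravar.
  - apply Rmult_lt_0_compat; auto. apply lt_0_INR; lia.
  - rewrite S_INR. apply le_INR in Hk. lra.
Qed.

(** Turns the cluster value of [Bolzano_Weierstrass] into a subsequence. The explicit rate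
    [1 / (k + 1)] is inherited by further subsequences, which [BW_C] uses for the second
    coordinate. *)
Lemma BW_R (u : nat -> R) (M : R) : (forall k, Rabs (u k) <= M) ->
  exists phi l, (forall k, (phi k < phi (S k))%nat) /\
    forall k, Rabs (u (phi k) - l) < / INR (S k).
Proof.
  intros H.
  destruct (Bolzano_Weierstrass u (fun c => - M <= c <= M)) as [l Hl].
  - apply compact_P3.
  - intros n. specialize (H n). now apply Rabs_le_between.
  - destruct (subseq_choice (fun k p => Rabs (u p - l) < / INR (S k))) as [phi [H1 H2]].
    + intros k N.
      destruct (Hl (fun x => Rabs (x - l) < / INR (S k)) N) as [p [Hp1 Hp2]].
      * exists (mkposreal _ (inv_S_pos k)). intros x Hx. exact Hx.
      * now exists p.
    + now exists phi, l.
Qed.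

Lemma BW_C (u : nat -> C) (M : R) : (forall k, Cmod (u k) <= M) ->
  exists phi l, (forall k, (phi k < phi (S k))%nat) /\
    forall eps, 0 < eps -> exists N, forall k, (N <= k)%nat -> Cmod (u (phi k) - l)%C < eps.
Proof.
  intros H.
  destruct (BW_R (fun k => Re (u k)) M) as [f1 [l1 [Hf1 H1]]].
  { intros k. eapply Rle_trans; [apply re_le_Cmod|auto]. }
  destruct (BW_R (fun k => Im (u (f1 k))) M) as [f2 [l2 [Hf2 H2]]].
  { intros k. eapply Rle_trans; [apply im_le_Cmod|auto]. }
  exists (fun k => f1 (f2 k)), ((l1, l2) : C). split.
  - intros k. apply incr_mono; auto.
  - intros eps He. destruct (inv_S_small (eps / 2)) as [N HN]; [lra|].
    exists N. intros k Hk. eapply Rle_lt_trans; [apply Cmod_le_re_im|].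
    assert (A := H1 (f2 k)). assert (B := H2 k). pose proof (incr_ge f2 Hf2 k).
    assert (A' := HN (f2 k) ltac:(lia)). assert (B' := HN k Hk).
    change (Re (u (f1 (f2 k)) - (l1, l2))%C) with (Re (u (f1 (f2 k))) - l1).
    change (Im (u (f1 (f2 k)) - (l1, l2))%C) with (Im (u (f1 (f2 k))) - l2).
    lra.
Qed.

Definition seq_lim (u : nat -> C) (l : C) : Prop :=
  forall eps, 0 < eps -> exists N, forall k, (N <= k)%nat -> Cmod (u k - l)%C < eps.

Definition cclosed (K : C -> Prop) : Prop :=
  forall u l, (forall k, K (u k)) -> seq_lim u l -> K l.

Lemma compact_of_closed (K : C -> Prop) (M : R) :
  (forall z, K z -> Cmod z <= M) -> cclosed K -> compact_C K.
Proof.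
  intros HM Hc u Hu.
  destruct (BW_C u M) as [phi [l [H1 H2]]]; [auto|].
  exists phi, l. repeat split; auto. apply (Hc (fun k => u (phi k))); auto.
Qed.

(** Only [z] is confined to [K]; the nearby point [w] may leave it. This allows a circle to be
    compared with neighbouring circles in [circ_cont]. *)
Lemma unif_ccont (K : C -> Prop) (F : C -> C) : compact_C K ->
  (forall z, K z -> ccont F z) ->
  forall eps, 0 < eps -> exists del, 0 < del /\
    forall z w, K z -> Cmod (w - z)%C < del -> Cmod (F w - F z)%C < eps.
Proof.
  intros HK HF eps He. apply NNPP. intros Hn.
  assert (Hs : forall k : nat, exists p : C * C, K (fst p) /\
    Cmod (snd p - fst p)%C < / INR (S k) /\ eps <= Cmod (F (snd p) - F (fst p))%C).
  { intros k. apply NNPP. intros Hk. apply Hn. exists (/ INR (S k)).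
    split; [apply inv_S_pos|]. intros z w Hz Hw.
    apply Rnot_le_lt. intros Hle. apply Hk. exists (z, w). simpl. auto. }
  set (p := fun k => proj1_sig (constructive_indefinite_description _ (Hs k))).
  assert (Hp : forall k, K (fst (p k)) /\ Cmod (snd (p k) - fst (p k))%C < / INR (S k)
     /\ eps <= Cmod (F (snd (p k)) - F (fst (p k)))%C).
  { intros k. apply (proj2_sig (constructive_indefinite_description _ (Hs k))). }
  destruct (HK (fun k => fst (p k))) as [phi [l [H1 [H2 H3]]]]; [apply Hp|].
  destruct (HF l H2 (eps / 2)) as [d [Hd Hf]]; [lra|].
  destruct (H3 (d / 2)) as [N1 HN1]; [lra|].
  destruct (inv_S_small (d / 2)) as [N2 HN2]; [lra|].
  set (k := (N1 + N2)%nat). specialize (HN1 k ltac:(lia)).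
  assert (HN2' := HN2 (phi k)). pose proof (incr_ge phi H1 k).
  specialize (HN2' ltac:(lia)). destruct (Hp (phi k)) as [_ [A B]].
  assert (C1 := Hf _ (Rlt_trans _ _ d HN1 ltac:(lra))).
  assert (C2 := Hf (snd (p (phi k)))).
  pose proof (Cmod_tri_minus (snd (p (phi k))) (fst (p (phi k))) l).
  specialize (C2 ltac:(lra)).
  pose proof (Cmod_tri_minus (F (snd (p (phi k)))) (F l) (F (fst (p (phi k))))).
  rewrite (Cmod_minus_sym (F l)) in H4. lra.
Qed.

Lemma seq_lim_Cmod_le (u : nat -> C) (l a : C) (M : R) : seq_lim u l ->
  (forall k, Cmod (u k - a)%C <= M) -> Cmod (l - a)%C <= M.
Proof.
  intros H HM. apply le_epsilon. intros eps He. destruct (H eps He) as [N HN].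
  specialize (HN N (le_n N)). specialize (HM N).
  pose proof (Cmod_tri_minus l (u N) a) as T. rewrite (Cmod_minus_sym l (u N)) in T. lra.
Qed.

Lemma seq_lim_Cmod_ge (u : nat -> C) (l a : C) (M : R) : seq_lim u l ->
  (forall k, M <= Cmod (u k - a)%C) -> M <= Cmod (l - a)%C.
Proof.
  intros H HM. apply le_epsilon. intros eps He. destruct (H eps He) as [N HN].
  specialize (HN N (le_n N)). specialize (HM N).
  pose proof (Cmod_tri_minus (u N) l a). lra.
Qed.

Lemma disc_compact (a : C) (r : R) : compact_C (fun z => Cmod (z - a)%C <= r).
Proof.
  apply (compact_of_closed _ (r + Cmod a)).
  - intros z Hz. pose proof (Cmod_triangle (z - a) a).
    replace (z - a + a)%C with z in H by ring. lra.
  - intros u l Hu Hl. eapply seq_lim_Cmod_le; eauto.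
Qed.

Lemma circle_compact (a : C) (r : R) : compact_C (fun z => Cmod (z - a)%C = r).
Proof.
  apply (compact_of_closed _ (r + Cmod a)).
  - intros z Hz. pose proof (Cmod_triangle (z - a) a).
    replace (z - a + a)%C with z in H by ring. lra.
  - intros u l Hu Hl. apply Rle_antisym.
    + eapply seq_lim_Cmod_le; eauto. intros k; right; auto.
    + eapply seq_lim_Cmod_ge; eauto. intros k; right; symmetry; auto.
Qed.

Lemma compact_bounded_fun (K : C -> Prop) (F : C -> C) : compact_C K ->
  (forall z, K z -> ccont F z) -> exists M, 0 < M /\ forall z, K z -> Cmod (F z) <= M.
Proof.
  intros HK HF. apply NNPP. intros Hn.
  assert (Hs : forall k : nat, exists z, K z /\ INR k < Cmod (F z)).
  { intros k. apply NNPP. intros Hk. apply Hn. exists (INR k + 1).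
    split; [pose proof (pos_INR k); lra|]. intros z Hz. apply Rnot_lt_le. intros Hlt.
    apply Hk. exists z. split; auto. lra. }
  set (p := fun k => proj1_sig (constructive_indefinite_description _ (Hs k))).
  assert (Hp : forall k, K (p k) /\ INR k < Cmod (F (p k))).
  { intros k. apply (proj2_sig (constructive_indefinite_description _ (Hs k))). }
  destruct (HK p) as [phi [l [H1 [H2 H3]]]]; [apply Hp|].
  destruct (HF l H2 1) as [d [Hd Hf]]; [lra|].
  destruct (H3 d Hd) as [N HN].
  destruct (nfloor_ex (Cmod (F l) + 1)) as [n [_ Hn']].
  { pose proof (Cmod_ge_0 (F l)); lra. }
  set (k := (N + S n)%nat). specialize (HN k ltac:(lia)). specialize (Hf _ HN).
  destruct (Hp (phi k)) as [_ B]. pose proof (incr_ge phi H1 k).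
  assert (Hk : (S n <= phi k)%nat) by lia. apply le_INR in Hk. rewrite S_INR in Hk.
  pose proof (Cmod_le_sub (F (p (phi k))) (F l)). lra.
Qed.

(** * The exponential and integrals over circles *)

Definition cis (t : R) : C := (cos t, sin t).

Lemma Cmod_cis (t : R) : Cmod (cis t) = 1.
Proof.
  unfold Cmod, cis. simpl. rewrite !Rmult_1_r.
  rewrite <- sqrt_1. f_equal. pose proof (sin2_cos2 t). unfold Rsqr in *. lra.
Qed.

Lemma cis_plus (a b : R) : cis (a + b) = (cis a * cis b)%C.
Proof. unfold cis. apply Ceq; simpl; [rewrite cos_plus|rewrite sin_plus]; ring. Qed.

Definition cexp (z : C) : C := (RtoC (exp (Re z)) * cis (Im z))%C.

Lemma cexp_plus (a b : C) : cexp (a + b)%C = (cexp a * cexp b)%C.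
Proof.
  unfold cexp. change (Re (a + b)) with (Re a + Re b).
  change (Im (a + b)) with (Im a + Im b).
  rewrite exp_plus, cis_plus, RtoC_mult. ring.
Qed.

Lemma deriv_eps (f : R -> R) (l : R) : derivable_pt_lim f 0 l ->
  forall eps, 0 < eps -> exists del, 0 < del /\
    forall x, Rabs x < del -> Rabs (f x - f 0 - l * x) <= eps * Rabs x.
Proof.
  intros H eps He. destruct (H eps He) as [[d Hd] Hf]. exists d; split; auto.
  intros x Hx. destruct (Req_dec x 0) as [->|Hn].
  - replace (f 0 - f 0 - l * 0) with 0 by ring. rewrite Rabs_R0. lra.
  - specialize (Hf x Hn Hx). rewrite Rplus_0_l in Hf.
    replace (f x - f 0 - l * x) with (((f x - f 0) / x - l) * x) by (field; auto).
    rewrite Rabs_mult. apply Rmult_le_compat_r; [apply Rabs_pos|lra].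
Qed.

Lemma cdiff_cexp0 : cdiff cexp 0 1.
Proof.
  (* The remainders of [exp], [cos] and [sin], each at most [e] times its argument, combine to at
     most [8 e |h|]. *)
  intros eps He. set (e := Rmin 1 (eps / 10)).
  assert (He' : 0 < e) by (apply Rmin_pos; lra).
  assert (e <= 1) by apply Rmin_l. assert (e <= eps / 10) by apply Rmin_r.
  clearbody e.
  destruct (deriv_eps exp 1) with (eps := e) as [d1 [Hd1 H1]]; auto.
  { rewrite <- exp_0 at 1. apply derivable_pt_lim_exp. }
  destruct (deriv_eps cos 0) with (eps := e) as [d2 [Hd2 H2]]; auto.
  { replace 0 with (- sin 0) at 2 by (rewrite sin_0; ring). apply derivable_pt_lim_cos. }
  destruct (deriv_eps sin 1) with (eps := e) as [d3 [Hd3 H3]]; auto.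
  { rewrite <- cos_0 at 1. apply derivable_pt_lim_sin. }
  exists (Rmin e (Rmin d1 (Rmin d2 d3))). split; [repeat apply Rmin_pos; auto|].
  intros h Hh.
  assert (L0 := Rlt_le_trans _ _ _ Hh (Rmin_l _ _)).
  assert (L := Rlt_le_trans _ _ _ Hh (Rmin_r _ _)).
  assert (L1 := Rlt_le_trans _ _ _ L (Rmin_l _ _)).
  assert (L' := Rlt_le_trans _ _ _ L (Rmin_r _ _)).
  assert (L2 := Rlt_le_trans _ _ _ L' (Rmin_l _ _)).
  assert (L3 := Rlt_le_trans _ _ _ L' (Rmin_r _ _)).
  pose proof (re_le_Cmod h) as HR. pose proof (im_le_Cmod h) as HI.
  set (x := Re h) in *. set (y := Im h) in *.
  specialize (H1 x ltac:(lra)). specialize (H2 y ltac:(lra)). specialize (H3 y ltac:(lra)).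
  rewrite exp_0 in H1. rewrite cos_0 in H2. rewrite sin_0 in H3.
  pose proof (Rabs_pos x). pose proof (Rabs_pos y).
  eapply Rle_trans; [apply Cmod_le_re_im|].
  replace (Re (cexp (0 + h) - cexp 0 - 1 * h)%C) with
    ((exp x - 1 - 1 * x) * cos y + (1 + x) * (cos y - 1 - 0 * y)).
  2:{ unfold cexp. simpl. rewrite !Rplus_0_l, exp_0, cos_0. fold x y. unfold x, y, Re, Im; simpl. ring. }
  replace (Im (cexp (0 + h) - cexp 0 - 1 * h)%C) with
    ((exp x - 1 - 1 * x + x) * (sin y - 0 - 1 * y + y) + (sin y - 0 - 1 * y)).
  2:{ unfold cexp. simpl. rewrite !Rplus_0_l, exp_0, sin_0. fold x y. unfold x, y, Re, Im; simpl. ring. }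
  set (A := exp x - 1 - 1 * x) in *. set (B := cos y - 1 - 0 * y) in *.
  set (D := sin y - 0 - 1 * y) in *.
  assert (Rabs (A * cos y + (1 + x) * B) <= e * Rabs x * 1 + 2 * (e * Rabs y)).
  { eapply Rle_trans; [apply Rabs_triang|]. rewrite !Rabs_mult.
    apply Rplus_le_compat.
    - apply Rmult_le_compat; auto; try apply Rabs_pos.
      apply Rabs_le. apply COS_bound.
    - apply Rmult_le_compat; auto; try apply Rabs_pos.
      assert (Hx1 : Rabs x <= 1) by lra. apply Rabs_le_between in Hx1.
      apply Rabs_le. lra. }
  assert (Rabs ((A + x) * (D + y) + D) <= (2 * e) * (2 * Rabs y) + e * Rabs y).
  { eapply Rle_trans; [apply Rabs_triang|]. rewrite Rabs_mult.
    apply Rplus_le_compat; auto.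
    apply Rmult_le_compat; try apply Rabs_pos.
    - eapply Rle_trans; [apply Rabs_triang|]. nra.
    - eapply Rle_trans; [apply Rabs_triang|]. nra. }
  assert (e * Rabs x <= e * Cmod h) by (apply Rmult_le_compat_l; lra).
  assert (e * Rabs y <= e * Cmod h) by (apply Rmult_le_compat_l; lra).
  assert (10 * e * Cmod h <= eps * Cmod h).
  { apply Rmult_le_compat_r; [apply Cmod_ge_0|lra]. }
  nra.
Qed.

(** The functional equation carries the derivative at 0 to every point. *)
Lemma hol_cexp (z : C) : hol cexp z.
Proof.
  exists (cexp z). intros eps He.
  assert (Hp : 0 < Cmod (cexp z)).
  { unfold cexp. rewrite Cmod_mult, Cmod_cis, Cmod_R, Rmult_1_r.
    rewrite Rabs_right; [apply exp_pos|left; apply exp_pos]. }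
  destruct (cdiff_cexp0 (eps / Cmod (cexp z))) as [d [Hd H]].
  { apply Rdiv_lt_0_compat; auto. }
  exists d; split; auto. intros h Hh. specialize (H h Hh).
  assert (E0 : cexp 0 = 1).
  { unfold cexp, cis. simpl. rewrite exp_0, cos_0, sin_0. apply Ceq; simpl; ring. }
  rewrite Cplus_0_l, E0 in H. rewrite cexp_plus.
  replace (cexp z * cexp h - cexp z - cexp z * h)%C with
    (cexp z * (cexp h - 1 - 1 * h))%C by ring.
  rewrite Cmod_mult. apply (Rmult_le_compat_l (Cmod (cexp z))) in H; [|lra].
  replace (Cmod (cexp z) * (eps / Cmod (cexp z) * Cmod h)) with (eps * Cmod h) in H
    by (field; lra). exact H.
Qed.

(** Integration against the angle, that is, of [F(z) dz / (i z)]: the result is [2 PI] times a mean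
    value, and the Cauchy kernel takes the form [z / (z - b)]. *)
Definition circ (F : C -> C) (r : R) : C := CI (fun t => F (RtoC r * cis t)%C) 0 (2 * PI).

Lemma twopi_pos : 0 < 2 * PI.
Proof. pose proof PI_RGT_0. lra. Qed.

Lemma Cmod_rcis (r t : R) : 0 <= r -> Cmod (RtoC r * cis t)%C = r.
Proof. intros H. rewrite Cmod_mult, Cmod_cis, Cmod_R, Rabs_right; lra. Qed.

Lemma cis_rcont (t : R) : rcont cis t.
Proof.
  intros eps He.
  assert (H := hol_ccont _ _ (hol_cexp (0, t))).
  destruct (H eps He) as [d [Hd Hf]]. exists d; split; auto. intros s Hs.
  specialize (Hf (0, s)). unfold cexp in Hf. simpl in Hf.
  rewrite exp_0, !Cmult_1_l in Hf. apply Hf.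
  replace ((0, s) - (0, t))%C with (Ci * RtoC (s - t))%C.
  - now rewrite Cmod_mult, Cmod_Ci, Cmod_R, Rmult_1_l.
  - apply Ceq; simpl; ring.
Qed.

Lemma rcont_comp (F : C -> C) (u : R -> C) (t : R) : rcont u t -> ccont F (u t) ->
  rcont (fun s => F (u s)) t.
Proof.
  intros Hu HF eps He. destruct (HF eps He) as [d [Hd Hf]].
  destruct (Hu d Hd) as [d2 [Hd2 H2]]. exists d2; split; auto.
Qed.

Lemma circ_rcont (F : C -> C) (r : R) : 0 <= r -> (forall z, Cmod z = r -> ccont F z) ->
  rcont_on (fun t => F (RtoC r * cis t)%C) 0 (2 * PI).
Proof.
  intros Hr HF t _. apply rcont_comp.
  - apply (rcont_comp (fun w => RtoC r * w)%C cis); [apply cis_rcont|].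
    apply ccont_mult; [apply ccont_const|apply ccont_id].
  - apply HF. now apply Cmod_rcis.
Qed.

Lemma circ_ext (F G : C -> C) (r : R) : 0 <= r -> (forall z, Cmod z = r -> F z = G z) ->
  circ F r = circ G r.
Proof.
  intros Hr H. apply CI_ext; [pose proof twopi_pos; lra|].
  intros t _. apply H. now apply Cmod_rcis.
Qed.

Lemma circ_plus (F G : C -> C) (r : R) : 0 <= r -> (forall z, Cmod z = r -> ccont F z) ->
  (forall z, Cmod z = r -> ccont G z) ->
  circ (fun z => F z + G z)%C r = (circ F r + circ G r)%C.
Proof.
  intros Hr HF HG. unfold circ.
  apply (CI_plus (fun t => F (RtoC r * cis t)%C) (fun t => G (RtoC r * cis t)%C));
    try (apply circ_rcont; auto). pose proof twopi_pos; lra.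
Qed.

Lemma circ_scal (c : C) (F : C -> C) (r : R) : 0 <= r ->
  (forall z, Cmod z = r -> ccont F z) -> circ (fun z => c * F z)%C r = (c * circ F r)%C.
Proof.
  intros Hr HF. unfold circ.
  apply (CI_scal c (fun t => F (RtoC r * cis t)%C)); try (apply circ_rcont; auto).
  pose proof twopi_pos; lra.
Qed.

Lemma circ_minus (F G : C -> C) (r : R) : 0 <= r -> (forall z, Cmod z = r -> ccont F z) ->
  (forall z, Cmod z = r -> ccont G z) ->
  circ (fun z => F z - G z)%C r = (circ F r - circ G r)%C.
Proof.
  intros Hr HF HG.
  rewrite (circ_ext _ (fun z => F z + (- (1)) * G z)%C r) by (auto; intros; ring).
  rewrite circ_plus, circ_scal; auto; [ring|].
  intros z Hz. apply ccont_mult; [apply ccont_const|auto].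
Qed.

Lemma circ_bound (F : C -> C) (r M : R) : 0 <= r -> (forall z, Cmod z = r -> ccont F z) ->
  (forall z, Cmod z = r -> Cmod (F z) <= M) -> Cmod (circ F r) <= 4 * PI * M.
Proof.
  intros Hr HF HM. unfold circ.
  replace (4 * PI * M) with (2 * M * (2 * PI - 0)) by ring.
  apply CI_bound; [pose proof twopi_pos; lra|apply circ_rcont; auto|].
  intros t _. apply HM. now apply Cmod_rcis.
Qed.

Lemma circ_const (c : C) (r : R) : circ (fun _ => c) r = (RtoC (2 * PI) * c)%C.
Proof.
  unfold circ.
  assert (H := CI_affine c 0 0 (2 * PI)).
  transitivity (CI (fun t => c + 0 * RtoC t)%C 0 (2 * PI)).
  - apply CI_ext; [pose proof twopi_pos; lra|]. intros; ring.
  - rewrite H, Rminus_0_r. ring.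
Qed.

(** The exponential maps the rectangle [[ln a, ln b] x [0, 2 PI]] to the annulus. Its horizontal
    sides cancel by periodicity and its vertical sides are the two circle integrals, so Goursat on
    the rectangle is enough. *)
Lemma circ_annulus (F : C -> C) (a b : R) : 0 < a -> a <= b ->
  (forall z, a <= Cmod z <= b -> hol F z) -> circ F a = circ F b.
Proof.
  intros Ha Hab HF. pose proof twopi_pos as Hpi.
  set (g := fun z => F (cexp z)).
  assert (Hln : ln a <= ln b).
  { destruct (Req_dec a b) as [->|]; [lra|]. left. apply ln_increasing; lra. }
  assert (H := rectI_hol g (ln a) 0 (ln b - ln a) (2 * PI) ltac:(lra) ltac:(lra)).
  assert (Hh : on_rect (hol g) (ln a) 0 (ln b - ln a) (2 * PI)).
  { intros x y Hx Hy. unfold g. apply hol_comp; [apply hol_cexp|]. apply HF.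
    unfold cexp. simpl. rewrite Cmod_rcis by (left; apply exp_pos).
    split.
    - rewrite <- (exp_ln a) by lra. destruct (Req_dec (ln a) x) as [->|]; [lra|].
      left; apply exp_increasing; lra.
    - rewrite <- (exp_ln b) by lra. destruct (Req_dec (ln b) x) as [->|]; [lra|].
      left; apply exp_increasing; lra. }
  specialize (H Hh). unfold rectI in H.
  replace (ln a + (ln b - ln a)) with (ln b) in H by ring.
  rewrite Rplus_0_l in H.
  assert (E1 : CI (fun t => g (t, 2 * PI)) (ln a) (ln b) = CI (fun t => g (t, 0)) (ln a) (ln b)).
  { apply CI_ext; auto. intros t _. unfold g, cexp, cis. simpl.
    now rewrite cos_2PI, sin_2PI, cos_0, sin_0. }
  assert (E2 : forall r, 0 < r -> CI (fun t => g (ln r, t)) 0 (2 * PI) = circ F r).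
  { intros r Hr. apply CI_ext; [lra|]. intros t _. unfold g, cexp. simpl.
    now rewrite exp_ln. }
  rewrite E1, !E2 in H by lra.
  assert (H2 : (Ci * (circ F b - circ F a))%C = 0) by (rewrite <- H; ring).
  assert (H3 : Cmod (circ F b - circ F a) = 0).
  { rewrite <- (Rmult_1_l (Cmod _)), <- Cmod_Ci, <- Cmod_mult, H2. apply Cmod_0. }
  apply Cmod_eq_0 in H3.
  replace (circ F a) with (circ F b - (circ F b - circ F a))%C by ring. rewrite H3. ring.
Qed.

(** Continuity in the radius carries a value across the radii that [circ_annulus] cannot reach: 0
    and the modulus of a point where holomorphy is not known. *)
Lemma circ_cont (F : C -> C) (R0 r0 : R) : 0 <= r0 < R0 ->
  (forall z, Cmod z < R0 -> ccont F z) -> forall eps, 0 < eps -> exists del, 0 < del /\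
  forall r, 0 <= r < R0 -> Rabs (r - r0) < del -> Cmod (circ F r - circ F r0)%C < eps.
Proof.
  intros Hr0 HF eps He. pose proof twopi_pos as Hpi.
  set (e := eps / (8 * PI)). assert (He' : 0 < e) by (apply Rdiv_lt_0_compat; lra).
  destruct (unif_ccont (fun z => Cmod (z - 0)%C = r0) F (circle_compact 0 r0)) with (eps := e)
    as [d [Hd H]]; auto.
  { intros z Hz. apply HF. replace (z - 0)%C with z in Hz by ring. lra. }
  exists d; split; auto. intros r Hr Hrd. unfold circ.
  set (u := fun t => F (RtoC r * cis t)%C). set (v := fun t => F (RtoC r0 * cis t)%C).
  assert (Hu : rcont_on u 0 (2 * PI)) by (apply circ_rcont; try lra; intros; apply HF; lra).
  assert (Hv : rcont_on v 0 (2 * PI)) by (apply circ_rcont; try lra; intros; apply HF; lra).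
  assert (Hv' : rcont_on (fun t => - (1) * v t)%C 0 (2 * PI)).
  { intros t Ht. apply (rcont_comp (fun w => - (1) * w)%C v); auto.
    apply ccont_mult; [apply ccont_const|apply ccont_id]. }
  replace (CI u 0 (2 * PI) - CI v 0 (2 * PI))%C with (CI (fun t => u t + - (1) * v t)%C 0 (2 * PI)).
  2:{ rewrite CI_plus, CI_scal; auto; try lra. ring. }
  apply Rle_lt_trans with (2 * e * (2 * PI - 0)).
  - apply CI_bound; try lra.
    + intros t Ht eps' He2.
      destruct (Hu t Ht (eps' / 2)) as [d1 [Hd1 K1]]; [lra|].
      destruct (Hv' t Ht (eps' / 2)) as [d2 [Hd2 K2]]; [lra|].
      exists (Rmin d1 d2). split; [apply Rmin_pos; auto|]. intros s Hs.
      specialize (K1 s (Rlt_le_trans _ _ _ Hs (Rmin_l _ _))).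
      specialize (K2 s (Rlt_le_trans _ _ _ Hs (Rmin_r _ _))).
      replace (u s + - (1) * v s - (u t + - (1) * v t))%C with
        ((u s - u t) + (- (1) * v s - - (1) * v t))%C by ring.
      eapply Rle_lt_trans; [apply Cmod_triangle|]. lra.
    + intros t Ht. left. replace (u t + - (1) * v t)%C with (u t - v t)%C by ring.
      unfold u, v. apply H.
      * replace (RtoC r0 * cis t - 0)%C with (RtoC r0 * cis t)%C by ring.
        apply Cmod_rcis; lra.
      * replace (RtoC r * cis t - RtoC r0 * cis t)%C with (RtoC (r - r0) * cis t)%C
          by (rewrite RtoC_minus; ring).
        rewrite Cmod_mult, Cmod_cis, Cmod_R. lra.
  - unfold e. replace (2 * (eps / (8 * PI)) * (2 * PI - 0)) with (eps / 2) by (field; lra). lra.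
Qed.

(** * Cauchy's formula and removable singularities *)

Lemma small_zero (c : C) : (forall eps, 0 < eps -> Cmod c < eps) -> c = 0.
Proof.
  intros H. apply Cmod_eq_0. apply Rle_antisym; [|apply Cmod_ge_0].
  apply le_epsilon. intros eps He. rewrite Rplus_0_l. left; auto.
Qed.

Lemma Cminus_eq_0 (a b : C) : (a - b)%C = 0 -> a = b.
Proof. intros H. replace a with (b + (a - b))%C by ring. rewrite H. ring. Qed.

(** The exceptional point [b] is there for difference quotients. Their holomorphy at [b] is only
    obtained in [quot_hol_at], through the Cauchy formula that rests on this lemma. The mean is
    constant below and above the radius [|b|], and continuity joins radius 0, radius [|b|] and both
    ranges. *)
Lemma circ_mean (F : C -> C) (R0 r : R) (b : C) : 0 < r < R0 ->
  (forall z, Cmod z < R0 -> ccont F z) -> (forall z, Cmod z < R0 -> z <> b -> hol F z) ->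
  circ F r = (RtoC (2 * PI) * F 0)%C.
Proof.
  intros Hr Hc Hh.
  assert (H00 : circ F 0 = (RtoC (2 * PI) * F 0)%C).
  { rewrite <- (circ_const (F 0) 0). apply circ_ext; [lra|]. intros z Hz. apply Cmod_eq_0 in Hz. now subst. }
  assert (Hann : forall s t, 0 < s -> s <= t -> t < R0 -> (t < Cmod b \/ Cmod b < s) ->
    circ F s = circ F t).
  { intros s t Hs Hst Ht Hb. apply circ_annulus; auto. intros z Hz. apply Hh; [lra|].
    intros ->. lra. }
  assert (Hlow : forall s, 0 < s -> s < R0 -> s < Cmod b \/ Cmod b <= 0 -> circ F s = circ F 0).
  { intros s Hs HsR Hb. apply Cminus_eq_0, small_zero. intros eps He.
    destruct (circ_cont F R0 0 ltac:(lra) Hc eps He) as [d [Hd H]].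
    set (x := Rmin s d / 2). assert (0 < Rmin s d) by (apply Rmin_pos; auto).
    pose proof (Rmin_l s d). pose proof (Rmin_r s d).
    rewrite <- (Hann x s); unfold x; try lra.
    apply H; [lra|]. rewrite Rminus_0_r, Rabs_right; lra. }
  destruct (Rlt_le_dec r (Cmod b)) as [L|L]. { rewrite Hlow; auto; lra. }
  destruct (Rle_lt_dec (Cmod b) 0) as [L0|L0]. { rewrite Hlow; auto; lra. }
  assert (Hb : circ F (Cmod b) = circ F 0).
  { apply Cminus_eq_0, small_zero. intros eps He.
    destruct (circ_cont F R0 (Cmod b) ltac:(lra) Hc eps He) as [d [Hd H]].
    set (m := Rmin (Cmod b) d). assert (0 < m) by (apply Rmin_pos; auto).
    assert (m <= Cmod b) by apply Rmin_l. assert (m <= d) by apply Rmin_r.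
    rewrite <- (Hlow (Cmod b - m / 2)) by lra. rewrite Cmod_minus_sym.
    apply H; [lra|]. rewrite Rabs_left; lra. }
  destruct (Req_dec r (Cmod b)) as [->|Hne]; [congruence|].
  rewrite <- H00, <- Hb. apply Cminus_eq_0, small_zero. intros eps He.
  destruct (circ_cont F R0 (Cmod b) ltac:(lra) Hc eps He) as [d [Hd H]].
  set (m := Rmin (r - Cmod b) d). assert (0 < m) by (apply Rmin_pos; lra).
  assert (m <= r - Cmod b) by apply Rmin_l. assert (m <= d) by apply Rmin_r.
  rewrite <- (Hann (Cmod b + m / 2) r) by lra.
  apply H; [lra|]. rewrite Rabs_right; lra.
Qed.

Lemma hol_kernel (b z : C) : z <> b -> hol (fun z => z / (z - b))%C z.
Proof.
  intros H. apply hol_div; [apply hol_id|apply hol_minus; [apply hol_id|apply hol_const]|].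
  intros E. apply H. now apply Cminus_eq_0.
Qed.

Lemma Cmod_lt_neq (a b : C) : Cmod a < Cmod b -> (b - a)%C <> 0.
Proof. intros H E. apply Cminus_eq_0 in E. subst. lra. Qed.

(** Since [z / (z - b) = 1 + b / (z - b)] and the integral does not depend on the radius, enlarging
    the circle makes the second summand negligible. *)
Lemma circ_kernel (b : C) (r : R) : Cmod b < r -> circ (fun z => z / (z - b))%C r = RtoC (2 * PI).
Proof.
  intros Hb. pose proof (Cmod_ge_0 b) as Hb0.
  apply Cminus_eq_0, small_zero. intros eps He. pose proof PI_RGT_0 as Hpi.
  set (s := r + Cmod b + 8 * PI * Cmod b / eps).
  assert (Hq : 0 <= 8 * PI * Cmod b / eps).
  { apply Rmult_le_pos; [nra|]. left; now apply Rinv_0_lt_compat. }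
  assert (Hs : r <= s) by (unfold s; lra).
  assert (Hd : forall z, Cmod z = s -> (z - b)%C <> 0).
  { intros z Hz. apply Cmod_lt_neq. lra. }
  rewrite (circ_annulus _ r s); try lra.
  2:{ intros z Hz. apply hol_kernel. intros ->. lra. }
  assert (E : circ (fun z => z / (z - b))%C s =
    (circ (fun z => b / (z - b))%C s + RtoC (2 * PI))%C).
  { replace (RtoC (2 * PI)) with (circ (fun _ => 1) s) by (rewrite circ_const; ring).
    rewrite <- circ_plus; try lra.
    - apply circ_ext; [lra|]. intros z Hz. field. auto.
    - intros z Hz. apply ccont_div; [apply ccont_const| |auto].
      apply ccont_minus; [apply ccont_id|apply ccont_const].
    - intros; apply ccont_const. }
  rewrite E.
  match goal with |- Cmod ?X < _ => replace X with (circ (fun z => b / (z - b))%C s) by ring end.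
  set (q := s - Cmod b). assert (Hq0 : 0 < q) by (unfold q, s; lra).
  apply Rle_lt_trans with (4 * PI * (Cmod b / q)).
  - apply circ_bound; [lra| |].
    + intros z Hz. apply ccont_div; [apply ccont_const| |auto].
      apply ccont_minus; [apply ccont_id|apply ccont_const].
    + intros z Hz. rewrite Cmod_div by auto. apply Rmult_le_compat_l; auto.
      apply Rinv_le_contravar; auto. unfold q. rewrite <- Hz. apply Cmod_le_sub.
  - apply (Rmult_lt_reg_r q); auto.
    replace (4 * PI * (Cmod b / q) * q) with (4 * PI * Cmod b) by (field; lra).
    assert (Hqq : r + 8 * PI * Cmod b / eps <= q) by (unfold q, s; lra).
    apply Rlt_le_trans with (eps * (r + 8 * PI * Cmod b / eps)).
    + replace (eps * (r + 8 * PI * Cmod b / eps)) with (eps * r + 8 * PI * Cmod b) by (field; lra).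
      assert (0 < eps * r) by (apply Rmult_lt_0_compat; lra). nra.
    + apply Rmult_le_compat_l; lra.
Qed.

(** In use, [l] is the derivative of [f] at [b]; the quotient is then holomorphic across [b] and
    serves as the cofactor when a zero is divided out. *)
Definition quot (f : C -> C) (b l : C) (z : C) : C :=
  if Ceq_dec z b then l else ((f z - f b) / (z - b))%C.

Lemma quot_b (f : C -> C) (b l : C) : quot f b l b = l.
Proof. unfold quot. destruct (Ceq_dec b b); tauto. Qed.

Lemma quot_neq (f : C -> C) (b l z : C) : z <> b -> quot f b l z = ((f z - f b) / (z - b))%C.
Proof. intros H. unfold quot. destruct (Ceq_dec z b); tauto. Qed.

Lemma Cminus_neq_0 (a b : C) : a <> b -> (a - b)%C <> 0.
Proof. intros H E. apply H. now apply Cminus_eq_0. Qed.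

Lemma quot_mul (f : C -> C) (b l z : C) : f z = (f b + (z - b) * quot f b l z)%C.
Proof.
  destruct (Ceq_dec z b) as [->|H]; [ring|]. rewrite quot_neq by auto. field.
  now apply Cminus_neq_0.
Qed.

Lemma Cmod_minus_pos (a b : C) : a <> b -> 0 < Cmod (a - b)%C.
Proof. intros H. apply Cmod_gt_0. now apply Cminus_neq_0. Qed.

Lemma quot_hol (f : C -> C) (b l z : C) : z <> b -> hol f z -> hol (quot f b l) z.
Proof.
  intros Hz Hf.
  apply (hol_ext_loc (fun z => (f z - f b) / (z - b))%C _ z (Cmod (z - b)%C)).
  - now apply Cmod_minus_pos.
  - intros w Hw. rewrite quot_neq; auto. intros ->. rewrite Cmod_minus_sym in Hw. lra.
  - apply hol_div.
    + apply hol_minus; auto; apply hol_const.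
    + apply hol_minus; [apply hol_id|apply hol_const].
    + now apply Cminus_neq_0.
Qed.

Lemma quot_ccont (f : C -> C) (b l : C) : cdiff f b l -> ccont (quot f b l) b.
Proof.
  intros H eps He. destruct (H (eps / 2)) as [d [Hd Hf]]; [lra|].
  exists d; split; auto. intros w Hw. rewrite quot_b.
  destruct (Ceq_dec w b) as [->|Hn].
  - rewrite quot_b. replace (l - l)%C with (RtoC 0) by ring. now rewrite Cmod_0.
  - rewrite quot_neq by auto. specialize (Hf _ Hw).
    replace (b + (w - b))%C with w in Hf by ring.
    pose proof (Cmod_minus_pos w b Hn).
    replace ((f w - f b) / (w - b) - l)%C with ((f w - f b - l * (w - b)) / (w - b))%C
      by (field; now apply Cminus_neq_0).
    rewrite Cmod_div by now apply Cminus_neq_0.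
    apply (Rmult_lt_reg_r (Cmod (w - b)%C)); auto.
    replace (Cmod (f w - f b - l * (w - b))%C / Cmod (w - b) * Cmod (w - b))
      with (Cmod (f w - f b - l * (w - b))%C) by (field; lra).
    nra.
Qed.

Definition hol_on_ball (f : C -> C) (a : C) (r : R) : Prop :=
  forall z, Cmod (z - a)%C < r -> hol f z.
Definition entire' (f : C -> C) : Prop := forall z, hol f z.

(** The mean value property for [z] times the difference quotient at [b], which vanishes at 0; the
    part containing [f b] is evaluated by [circ_kernel]. *)
Lemma cauchy_formula (f : C -> C) (R0 r : R) (b : C) : Cmod b < r -> r < R0 ->
  (forall z, Cmod z < R0 -> hol f z) ->
  circ (fun z => f z * (z / (z - b)))%C r = (RtoC (2 * PI) * f b)%C.
Proof.
  intros Hb Hr Hf. pose proof (Cmod_ge_0 b) as Hb0.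
  destruct (Hf b ltac:(lra)) as [l Hl].
  set (F := fun z => (z * quot f b l z)%C).
  assert (HF : circ F r = (RtoC (2 * PI) * F 0)%C).
  { apply (circ_mean F R0 r b).
    - lra.
    - intros z Hz. apply ccont_mult; [apply ccont_id|].
      destruct (Ceq_dec z b) as [->|Hn]; [now apply quot_ccont|].
      apply hol_ccont, quot_hol; auto.
    - intros z Hz Hn. apply hol_mult; [apply hol_id|]. apply quot_hol; auto. }
  assert (Hne : forall z, Cmod z = r -> z <> b) by (intros z Hz ->; lra).
  assert (E : circ F r =
    (circ (fun z => f z * (z / (z - b)))%C r - f b * circ (fun z => z / (z - b))%C r)%C).
  { rewrite <- circ_scal, <- circ_minus; try lra.
    - apply circ_ext; [lra|]. intros z Hz. unfold F. rewrite quot_neq by auto.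
      field. apply Cminus_neq_0; auto.
    - intros z Hz. apply hol_ccont, hol_mult; [apply Hf; lra|apply hol_kernel; auto].
    - intros z Hz. apply hol_ccont, hol_mult; [apply hol_const|apply hol_kernel; auto].
    - intros z Hz. apply hol_ccont, hol_kernel; auto. }
  rewrite circ_kernel in E by auto. rewrite E in HF. unfold F in HF.
  apply Cminus_eq_0.
  match goal with |- ?L = _ => transitivity (circ (fun z : C => (f z * (z / (z - b)))%C) r - f b * RtoC (2 * PI))%C; [ring|] end.
  rewrite HF. ring.
Qed.

(** Only continuity of [phi] on the circle is used. Removable singularities and uniform limits are
    settled by recognizing the function in question as such a transform. *)
Lemma cauchy_transform_hol (phi : C -> C) (r : R) (b : C) : Cmod b < r ->
  (forall z, Cmod z = r -> ccont phi z) ->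
  hol (fun b => circ (fun z => phi z / (z - b))%C r) b.
Proof.
  intros Hb Hphi. pose proof (Cmod_ge_0 b) as Hb0.
  destruct (compact_bounded_fun (fun z => Cmod (z - 0)%C = r) phi (circle_compact 0 r))
    as [M [HM0 HM]].
  { intros z Hz. apply Hphi. now replace (z - 0)%C with z in Hz by ring. }
  exists (circ (fun z => phi z / ((z - b) * (z - b)))%C r).
  intros eps He. set (d := r - Cmod b). assert (Hd : 0 < d) by (unfold d; lra).
  (* The circle keeps distance [d] from [b] and [d / 2] from [b + h], so the integrand of the
     remainder is at most [M |h|^2 / (d * d * (d / 2))]; [K] is this coefficient times [4 PI]. *)
  set (K := 8 * PI * M / (d * d * d)). pose proof PI_RGT_0 as Hpi.
  assert (Hddd : 0 < d * d * d) by (repeat apply Rmult_lt_0_compat; auto).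
  assert (HK : 0 < K).
  { unfold K. apply Rdiv_lt_0_compat; auto. nra. }
  exists (Rmin (d / 2) (eps / K)). split.
  { apply Rmin_pos; [lra|]. apply Rdiv_lt_0_compat; auto. }
  intros h Hh.
  assert (L1 := Rlt_le_trans _ _ _ Hh (Rmin_l _ _)).
  assert (L2 := Rlt_le_trans _ _ _ Hh (Rmin_r _ _)).
  assert (D1 : forall z, Cmod z = r -> d <= Cmod (z - b)%C).
  { intros z Hz. pose proof (Cmod_le_sub z b). unfold d; lra. }
  assert (D2 : forall z, Cmod z = r -> d / 2 <= Cmod (z - (b + h))%C).
  { intros z Hz. specialize (D1 z Hz).
    pose proof (Cmod_le_sub (z - b) h) as T.
    replace (z - b - h)%C with (z - (b + h))%C in T by ring. lra. }
  assert (N1 : forall z, Cmod z = r -> (z - b)%C <> 0).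
  { intros z Hz. apply Cmod_pos_nz. specialize (D1 z Hz). lra. }
  assert (N2 : forall z, Cmod z = r -> (z - (b + h))%C <> 0).
  { intros z Hz. apply Cmod_pos_nz. specialize (D2 z Hz). lra. }
  assert (cc : forall c z, ccont (fun z => z - c)%C z).
  { intros c z. apply ccont_minus; [apply ccont_id|apply ccont_const]. }
  assert (C1 : forall z, Cmod z = r -> ccont (fun z => phi z / (z - b))%C z).
  { intros z Hz. apply ccont_div; auto. }
  assert (C2 : forall z, Cmod z = r -> ccont (fun z => phi z / (z - (b + h)))%C z).
  { intros z Hz. apply ccont_div; auto. }
  assert (C3 : forall z, Cmod z = r -> ccont (fun z => phi z / ((z - b) * (z - b)))%C z).
  { intros z Hz. apply ccont_div; auto; [|apply Cmult_neq_0; auto]. apply ccont_mult; auto. }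
  match goal with |- Cmod ?X <= _ => replace X with
    (circ (fun z => phi z / (z - (b + h)) - phi z / (z - b) - h * (phi z / ((z - b) * (z - b))))%C r) end.
  2:{ rewrite (circ_minus (fun z => phi z / (z - (b + h)) - phi z / (z - b))%C), circ_minus, circ_scal;
      auto; try lra; try ring.
      - intros z Hz. apply ccont_minus; auto.
      - intros z Hz. apply ccont_mult; auto. apply ccont_const. }
  apply Rle_trans with (4 * PI * (M * (Cmod h * Cmod h) / (d * d * (d / 2)))).
  - apply circ_bound; [lra| |].
    + intros z Hz. apply ccont_minus; [apply ccont_minus; auto|].
      apply ccont_mult; auto. apply ccont_const.
    + intros z Hz.
      replace (phi z / (z - (b + h)) - phi z / (z - b) - h * (phi z / ((z - b) * (z - b))))%C
        with (phi z * (h * h) / ((z - b) * (z - b) * (z - (b + h))))%C by (field; auto).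
      rewrite Cmod_div by (repeat apply Cmult_neq_0; auto). rewrite !Cmod_mult.
      specialize (D1 z Hz). specialize (D2 z Hz).
      apply Rmult_le_compat.
      * repeat apply Rmult_le_pos; apply Cmod_ge_0.
      * left. apply Rinv_0_lt_compat. repeat apply Rmult_lt_0_compat; lra.
      * apply Rmult_le_compat_r; [apply Rmult_le_pos; apply Cmod_ge_0|].
        apply HM. now replace (z - 0)%C with z by ring.
      * apply Rinv_le_contravar; [repeat apply Rmult_lt_0_compat; lra|].
        repeat apply Rmult_le_compat; nra.
  - replace (4 * PI * (M * (Cmod h * Cmod h) / (d * d * (d / 2)))) with
      (K * Cmod h * Cmod h) by (unfold K; field; lra).
    apply Rmult_le_compat_r; [apply Cmod_ge_0|].
    apply (Rmult_lt_compat_l K) in L2; auto.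
    replace (K * (eps / K)) with eps in L2 by (field; lra). lra.
Qed.

Lemma twopi_nz : RtoC (2 * PI) <> 0.
Proof. pose proof twopi_pos. apply Cmod_pos_nz. rewrite Cmod_R, Rabs_right; lra. Qed.

(** Off 0, partial fractions and two instances of the Cauchy formula show that [2 PI] times the
    quotient is a Cauchy transform. Both sides are continuous, so they also agree at 0, and the
    transform is holomorphic there. *)
Lemma quot_hol0 (f : C -> C) (R0 : R) (l : C) : 0 < R0 ->
  (forall z, Cmod z < R0 -> hol f z) -> cdiff f 0 l -> hol (quot f 0 l) 0.
Proof.
  intros HR Hf Hl. set (r := R0 / 2).
  set (K := fun b => circ (fun z => (f z - f 0) / (z - b))%C r).
  assert (Hg : forall z, Cmod z < R0 -> hol (fun z => f z - f 0)%C z).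
  { intros z Hz. apply hol_minus; auto. apply hol_const. }
  assert (HK : forall b, Cmod b < r -> hol K b).
  { intros b Hb. apply (cauchy_transform_hol (fun z => f z - f 0)%C); auto.
    intros z Hz. apply hol_ccont, Hg. unfold r in *; lra. }
  assert (E : forall b, Cmod b < r -> b <> 0 -> K b = (RtoC (2 * PI) * quot f 0 l b)%C).
  { intros b Hb Hb0. pose proof (Cmod_ge_0 b).
    assert (H1 := cauchy_formula _ R0 r b Hb ltac:(unfold r; lra) Hg).
    assert (H2 := cauchy_formula _ R0 r 0 ltac:(rewrite Cmod_0; unfold r; lra)
       ltac:(unfold r; lra) Hg). cbv beta in *.
    assert (Hn0 : forall z, Cmod z = r -> z <> 0).
    { intros z Hz ->. rewrite Cmod_0 in Hz. unfold r in *; lra. }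
    assert (Hnb : forall z, Cmod z = r -> z <> b) by (intros z Hz ->; lra).
    assert (Hcf : forall z, Cmod z = r -> ccont (fun z => f z - f 0)%C z).
    { intros z Hz. apply hol_ccont, Hg. unfold r in *; lra. }
    assert (H3 : (b * K b = RtoC (2 * PI) * (f b - f 0))%C).
    { unfold K. rewrite <- circ_scal; [|lra|].
      2:{ intros z Hz. apply ccont_div; auto; [|apply Cminus_neq_0; auto].
          apply ccont_minus; [apply ccont_id|apply ccont_const]. }
      rewrite <- H1.
      transitivity (circ (fun z => (f z - f 0) * (z / (z - b)) - (f z - f 0) * (z / (z - 0)))%C r).
      - apply circ_ext; [lra|]. intros z Hz. field. split; [|now apply Cminus_neq_0; auto].
        replace (z - 0)%C with z by ring. auto.
      - rewrite circ_minus, H2; [ring|lra| |].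
        + intros z Hz. apply ccont_mult; auto. apply hol_ccont, hol_kernel; auto.
        + intros z Hz. apply ccont_mult; auto. apply hol_ccont, hol_kernel; auto. }
    rewrite quot_neq by auto. replace (K b) with (b * K b / b)%C by (field; auto).
    rewrite H3. replace (b - 0)%C with b by ring. field. auto. }
  assert (E0 : K 0 = (RtoC (2 * PI) * quot f 0 l 0)%C).
  { apply Cminus_eq_0, small_zero. intros eps He.
    assert (c1 := hol_ccont _ _ (HK 0 ltac:(rewrite Cmod_0; unfold r; lra))).
    assert (c2 : ccont (fun z => RtoC (2 * PI) * quot f 0 l z)%C 0).
    { apply ccont_mult; [apply ccont_const|now apply quot_ccont]. }
    destruct (ccont_minus _ _ _ c1 c2 eps He) as [d [Hd H]].
    set (x := Rmin (d / 2) (r / 2)).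
    assert (Hx : 0 < x) by (unfold x; apply Rmin_pos; unfold r; lra).
    assert (x <= d / 2) by apply Rmin_l. assert (x <= r / 2) by apply Rmin_r.
    assert (Hxm : Cmod (RtoC x) = x) by (rewrite Cmod_R, Rabs_right; lra).
    specialize (H (RtoC x)). replace (RtoC x - 0)%C with (RtoC x) in H by ring.
    rewrite Hxm in H. specialize (H ltac:(lra)).
    rewrite E in H.
    2:{ rewrite Hxm; unfold r in *; lra. }
    2:{ apply Cmod_pos_nz; lra. }
    match type of H with Cmod ?A < _ => replace A with
      (- (K 0 - RtoC (2 * PI) * quot f 0 l 0))%C in H by ring end.
    now rewrite Cmod_opp in H. }
  apply (hol_ext_loc (fun b => / RtoC (2 * PI) * K b)%C _ 0 r).
  - unfold r; lra.
  - intros w Hw. replace (w - 0)%C with w in Hw by ring.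
    pose proof twopi_nz as Hpi.
    destruct (Ceq_dec w 0) as [->|Hn].
    + rewrite E0. field. apply RtoC_neq in Hpi || idtac. exact Hpi.
    + rewrite E by auto. field. exact Hpi.
  - apply hol_mult; [apply hol_const|]. apply HK. rewrite Cmod_0; unfold r; lra.
Qed.

Lemma cdiff_shift (f : C -> C) (b l z : C) : cdiff f (z + b)%C l ->
  cdiff (fun w => f (w + b)%C) z l.
Proof.
  intros H eps He. destruct (H eps He) as [d [Hd Hf]]. exists d; split; auto.
  intros h Hh. specialize (Hf h Hh).
  now replace (z + h + b)%C with (z + b + h)%C by ring.
Qed.

Lemma hol_shift (f : C -> C) (b z : C) : hol f (z + b)%C -> hol (fun w => f (w + b)%C) z.
Proof. intros [l H]. exists l. now apply cdiff_shift. Qed.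

Lemma quot_hol_at (f : C -> C) (R0 : R) (b l : C) : 0 < R0 ->
  hol_on_ball f b R0 -> cdiff f b l -> hol (quot f b l) b.
Proof.
  intros HR Hf Hl. set (f1 := fun w => f (w + b)%C).
  assert (H1 : hol (quot f1 0 l) 0).
  { apply (quot_hol0 f1 R0); auto.
    - intros z Hz. apply hol_shift. apply Hf. now replace (z + b - b)%C with z by ring.
    - apply cdiff_shift. now rewrite Cplus_0_l. }
  apply (hol_ext (fun z => quot f1 0 l (z + (- b)))%C).
  - intros w. unfold quot, f1.
    destruct (Ceq_dec (w + - b) 0) as [E|E], (Ceq_dec w b) as [E'|E']; auto.
    + destruct E'. now apply Cminus_eq_0.
    + destruct E. subst. ring.
    + rewrite Cplus_0_l. replace (w + - b + b)%C with w by ring.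
      f_equal. ring.
  - apply hol_shift. now replace (b + - b)%C with (RtoC 0) by ring.
Qed.

Lemma factor_ball (f : C -> C) (a b : C) (R0 : R) : hol_on_ball f a R0 ->
  Cmod (b - a)%C < R0 -> f b = 0 ->
  exists g, hol_on_ball g a R0 /\ forall z, f z = ((z - b) * g z)%C.
Proof.
  intros Hf Hb H0. destruct (Hf b Hb) as [l Hl]. exists (quot f b l). split.
  - intros z Hz. destruct (Ceq_dec z b) as [->|Hn]; [|now apply quot_hol; auto].
    apply (quot_hol_at f (R0 - Cmod (b - a)%C)); auto; [lra|].
    intros w Hw. apply Hf. pose proof (Cmod_tri_minus w b a). lra.
  - intros z. rewrite (quot_mul f b l z) at 1. rewrite H0. ring.
Qed.

Lemma entire_ball (f : C -> C) (a : C) (r : R) : entire' f -> hol_on_ball f a r.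
Proof. intros H z _. apply H. Qed.

Lemma factor_entire (f : C -> C) (b : C) : entire' f -> f b = 0 ->
  exists g, entire' g /\ forall z, f z = ((z - b) * g z)%C.
Proof.
  intros Hf H0. destruct (Hf b) as [l Hl]. exists (quot f b l). split.
  - intros z. destruct (Ceq_dec z b) as [->|Hn]; [|now apply quot_hol; auto].
    apply (quot_hol_at f 1); auto; [lra|]. now apply entire_ball.
  - intros z. rewrite (quot_mul f b l z) at 1. rewrite H0. ring.
Qed.

(** * Maximum modulus and Liouville's theorem *)

Lemma hol_pow (f : C -> C) (n : nat) (z : C) : hol f z -> hol (fun w => f w ^ n)%C z.
Proof.
  intros H. induction n as [|n IH].
  - apply (hol_ext (fun _ => 1)); [reflexivity|apply hol_const].
  - apply (hol_ext (fun w => f w * f w ^ n)%C); [reflexivity|now apply hol_mult].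
Qed.

Lemma pow_unbounded (q B : R) : 1 < q -> exists n, B < q ^ n.
Proof.
  intros Hq. destruct (Pow_x_infinity q ltac:(rewrite Rabs_right; lra) (B + 1)) as [n Hn].
  exists n. specialize (Hn n (le_n n)). rewrite Rabs_right in Hn; [lra|].
  apply Rle_ge, pow_le; lra.
Qed.

(* Cauchy's formula for [f^n] gives [|f b|^n <= K M^n] with [K] independent of [n]. *)
Lemma max_modulus0 (f : C -> C) (R0 r M : R) (b : C) : Cmod b < r -> r < R0 ->
  (forall z, Cmod z < R0 -> hol f z) -> (forall z, Cmod z = r -> Cmod (f z) <= M) ->
  Cmod (f b) <= M.
Proof.
  intros Hb Hr Hf HM. pose proof (Cmod_ge_0 b) as Hb0. pose proof PI_RGT_0 as Hpi.
  assert (HM0 : 0 <= M).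
  { eapply Rle_trans; [apply Cmod_ge_0|]. apply (HM (RtoC r)).
    rewrite Cmod_R, Rabs_right; lra. }
  set (K := 2 * (r / (r - Cmod b))).
  assert (HK : forall n, Cmod (f b) ^ n <= K * M ^ n).
  { intros n.
    assert (H := cauchy_formula (fun z => f z ^ n)%C R0 r b Hb Hr
      ltac:(intros z Hz; apply hol_pow; auto)).
    apply (f_equal Cmod) in H. rewrite Cmod_mult, Cmod_pow, Cmod_R, Rabs_right in H by lra.
    assert (B : Cmod (circ (fun z => f z ^ n * (z / (z - b)))%C r)%C <= 4 * PI * (M ^ n * (r / (r - Cmod b)))).
    { assert (Hnb : forall z, Cmod z = r -> z <> b) by (intros z Hz ->; lra).
      apply circ_bound; [lra| |].
      - intros z Hz. apply hol_ccont, hol_mult; [apply hol_pow, Hf; lra|apply hol_kernel; auto].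
      - intros z Hz. rewrite Cmod_mult, Cmod_pow, Cmod_div by (apply Cminus_neq_0; auto).
        apply Rmult_le_compat.
        + apply pow_le, Cmod_ge_0.
        + apply Rmult_le_pos; [apply Cmod_ge_0|]. left. apply Rinv_0_lt_compat, Cmod_minus_pos; auto.
        + apply pow_incr. split; [apply Cmod_ge_0|auto].
        + rewrite Hz. apply Rmult_le_compat_l; [lra|]. apply Rinv_le_contravar; [lra|].
          rewrite <- Hz. apply Cmod_le_sub. }
    rewrite H in B. unfold K. nra. }
  apply Rnot_lt_le. intros Hlt.
  destruct (Req_dec M 0) as [->|HMn].
  - specialize (HK 1%nat). simpl in HK. lra.
  - destruct (pow_unbounded (Cmod (f b) / M) K) as [n Hn].
    { apply (Rmult_lt_reg_r M); [lra|]. replace (Cmod (f b) / M * M) with (Cmod (f b)) by (field; lra). lra. }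
    specialize (HK n). assert (HMn' : 0 < M ^ n) by (apply pow_lt; lra).
    apply (Rmult_lt_compat_r (M ^ n)) in Hn; auto.
    unfold Rdiv in Hn. rewrite Rpow_mult_distr, pow_inv in Hn.
    replace (Cmod (f b) ^ n * / M ^ n * M ^ n) with (Cmod (f b) ^ n) in Hn by (field; lra).
    lra.
Qed.

Lemma max_modulus (f : C -> C) (R0 r M : R) (a b : C) : Cmod (b - a)%C <= r -> r < R0 ->
  hol_on_ball f a R0 -> (forall z, Cmod (z - a)%C = r -> Cmod (f z) <= M) ->
  Cmod (f b) <= M.
Proof.
  intros Hb Hr Hf HM. destruct Hb as [Hb|Hb]; [|now apply HM].
  replace b with ((b - a) + a)%C by ring.
  apply (max_modulus0 (fun w => f (w + a)%C) R0 r M (b - a)%C); auto.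
  - intros z Hz. apply hol_shift, Hf. now replace (z + a - a)%C with z by ring.
  - intros z Hz. apply HM. now replace (z + a - a)%C with z by ring.
Qed.

Definition poly_eval (n : nat) (a : nat -> C) (z : C) : C :=
  fold_right Cplus (RtoC 0) (map (fun k => Cmult (a k) (Cpow z k)) (seq 0 (S n))).

Lemma poly_eval_S (n : nat) (a : nat -> C) (z : C) :
  poly_eval (S n) a z = (a O + z * poly_eval n (fun k => a (S k)) z)%C.
Proof.
  unfold poly_eval. change (seq 0 (S (S n))) with (O :: seq 1 (S n)).
  rewrite <- seq_shift, map_cons, map_map.
  change (fold_right Cplus 0 (?x :: ?l)) with (x + fold_right Cplus 0 l)%C.
  cbn [fold_right]. f_equal; [simpl; ring|].
  generalize (seq 0 (S n)). intros l. induction l as [|k l IH]; simpl; [ring|].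
  simpl in IH. rewrite IH. ring.
Qed.

(** Liouville's theorem with polynomial growth; each division by [z] lowers the exponent by one. The
    bound is required only on some arbitrarily large circles, because rescaling provides no more,
    and the maximum modulus principle fills in between them. *)
Lemma growth_poly (N : nat) : forall (f : C -> C) (K : R), entire' f -> 0 <= K ->
  (forall B, exists r, B < r /\ forall z, Cmod z = r -> Cmod (f z) <= K * r ^ N) ->
  exists a, forall z, f z = poly_eval N a z.
Proof.
  induction N as [|N IH]; intros f K Hf HK Hg; destruct (Hf 0) as [l Hl];
  set (g := quot f 0 l);
  assert (Hge : entire' g) by (intros z; destruct (Ceq_dec z 0) as [->|Hn];
     [apply (quot_hol_at f 1); auto; [lra|now apply entire_ball]|apply quot_hol; auto]);
  assert (Hgz : forall z r, 0 < r -> Cmod z = r -> Cmod (g z) <= (Cmod (f z) + Cmod (f 0)) / r).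
  1,3: intros z r Hr Hz; assert (z <> 0) by (intros ->; rewrite Cmod_0 in Hz; lra);
    unfold g; rewrite quot_neq by auto; replace (z - 0)%C with z by ring;
    rewrite Cmod_div by auto; rewrite Hz; apply Rmult_le_compat_r;
    [left; now apply Rinv_0_lt_compat|apply Cmod_sub_le].
  - assert (G0 : forall z, g z = 0).
    { intros z. apply small_zero. intros eps He.
      destruct (Hg (Cmod z + (K + Cmod (f 0)) / eps)) as [r [Hr Hb]].
      pose proof (Cmod_ge_0 z). pose proof (Cmod_ge_0 (f 0)).
      assert (0 <= (K + Cmod (f 0)) / eps).
      { apply Rmult_le_pos; [lra|]. left; now apply Rinv_0_lt_compat. }
      apply Rle_lt_trans with ((K + Cmod (f 0)) / r).
      - apply (max_modulus g (r + 1) r _ 0 z); try lra.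
        + replace (z - 0)%C with z by ring. lra.
        + now apply entire_ball.
        + intros w Hw. replace (w - 0)%C with w in Hw by ring.
          eapply Rle_trans; [apply (Hgz w r); auto; lra|].
          apply Rmult_le_compat_r; [left; apply Rinv_0_lt_compat; lra|].
          specialize (Hb w Hw). simpl in Hb. lra.
      - apply (Rmult_lt_reg_r r); [lra|].
        replace ((K + Cmod (f 0)) / r * r) with (K + Cmod (f 0)) by (field; lra).
        assert ((K + Cmod (f 0)) / eps < r) by lra.
        apply (Rmult_lt_compat_l eps) in H2; auto.
        replace (eps * ((K + Cmod (f 0)) / eps)) with (K + Cmod (f 0)) in H2 by (field; lra). lra. }
    exists (fun _ => f 0). intros z. unfold poly_eval. simpl.
    rewrite (quot_mul f 0 l z). fold (g z). rewrite G0. ring.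
  - destruct (IH g (K + Cmod (f 0)) Hge) as [a Ha].
    + pose proof (Cmod_ge_0 (f 0)); lra.
    (* For [r >= 1] the constant [f 0] is absorbed into [r ^ N], whence the new constant
       [K + |f 0|]. *)
    + intros B. destruct (Hg (Rmax B 1)) as [r [Hr Hb]].
      pose proof (Rmax_l B 1). pose proof (Rmax_r B 1).
      exists r. split; [lra|]. intros z Hz.
      eapply Rle_trans; [apply (Hgz z r); auto; lra|].
      apply (Rmult_le_reg_r r); [lra|].
      replace ((Cmod (f z) + Cmod (f 0)) / r * r) with (Cmod (f z) + Cmod (f 0)) by (field; lra).
      specialize (Hb z Hz). simpl in Hb.
      assert (1 <= r ^ N) by (apply pow_R1_Rle; lra). pose proof (Cmod_ge_0 (f 0)).
      assert (1 <= r * r ^ N) by nra. nra.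
    + exists (fun k => match k with O => f 0 | S j => a j end). intros z.
      rewrite poly_eval_S. rewrite (quot_mul f 0 l z). fold (g z). rewrite Ha.
      replace (z - 0)%C with z by ring. reflexivity.
Qed.

(** * Zeros listed with multiplicity *)

Definition lprod (l : list C) (z : C) : C :=
  fold_right (fun a acc => (z - a) * acc)%C (RtoC 1) l.

Lemma lprod_app (l l' : list C) (z : C) : lprod (l ++ l') z = (lprod l z * lprod l' z)%C.
Proof. induction l as [|a l IH]; simpl; [ring|]. rewrite IH. ring. Qed.

Lemma lprod_le (l : list C) (z : C) (m : R) : (forall a, In a l -> Cmod (z - a)%C <= m) ->
  Cmod (lprod l z) <= m ^ length l.
Proof.
  induction l as [|a l IH]; intros H; simpl; [rewrite Cmod_1; lra|].
  rewrite Cmod_mult. apply Rmult_le_compat; try apply Cmod_ge_0.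
  - apply H; now left.
  - apply IH. intros b Hb. apply H; now right.
Qed.

Lemma lprod_ge (l : list C) (z : C) (m : R) : 0 <= m ->
  (forall a, In a l -> m <= Cmod (z - a)%C) -> m ^ length l <= Cmod (lprod l z).
Proof.
  intros Hm. induction l as [|a l IH]; intros H; simpl; [rewrite Cmod_1; lra|].
  rewrite Cmod_mult. apply Rmult_le_compat; auto.
  - now apply pow_le.
  - apply H; now left.
  - apply IH. intros b Hb. apply H; now right.
Qed.

Lemma pow_small (q : R) : 0 <= q < 1 -> forall eps, 0 < eps -> exists n, q ^ n < eps.
Proof.
  intros Hq eps He. destruct (pow_lt_1_zero q ltac:(rewrite Rabs_right; lra) eps He) as [n Hn].
  exists n. specialize (Hn n (le_n n)). rewrite Rabs_right in Hn; auto.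
  apply Rle_ge, pow_le; lra.
Qed.

(** A crude form of Jensen's inequality: dividing by [n] zeros of modulus at most [rho] makes the
    cofactor at most [M / (r - rho)^n] on the circle of radius [r], while their product at [z] is at
    most [(|z| + rho)^n]. With arbitrarily many zeros the quotient of these powers tends to 0. It
    serves as the identity theorem and shows that zeros in a disc can be exhausted. *)
Lemma many_zeros (f : C -> C) (R0 rho : R) : 0 <= rho ->
  (forall z, Cmod z < R0 -> hol f z) ->
  (forall m, exists l g, length l = m /\ (forall a, In a l -> Cmod a <= rho) /\
     (forall z, Cmod z < R0 -> hol g z) /\ forall z, f z = (lprod l z * g z)%C) ->
  forall z, Cmod z + 2 * rho < R0 -> f z = 0.
Proof.
  intros Hrho Hf Hm z Hz. pose proof (Cmod_ge_0 z) as Hz0.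
  set (s := Cmod z). fold s in Hz, Hz0.
  (* A radius above [s + 2 rho] makes the ratio [(s + rho) / (r - rho)] less than 1. *)
  set (r := (R0 + (s + 2 * rho)) / 2).
  assert (Hr : s + 2 * rho < r < R0) by (unfold r; lra).
  destruct (compact_bounded_fun (fun z => Cmod (z - 0)%C = r) f (circle_compact 0 r))
    as [M [HM0 HM]].
  { intros w Hw. apply hol_ccont, Hf. replace (w - 0)%C with w in Hw by ring. lra. }
  apply small_zero. intros eps He.
  destruct (pow_small ((s + rho) / (r - rho))) with (eps := eps / M) as [n Hn].
  { split; [apply Rmult_le_pos; [lra|left; apply Rinv_0_lt_compat; lra]|].
    apply (Rmult_lt_reg_r (r - rho)); [lra|].
    replace ((s + rho) / (r - rho) * (r - rho)) with (s + rho) by (field; lra). lra. }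
  { apply Rdiv_lt_0_compat; auto. }
  destruct (Hm n) as [l [g [Hl [Ha [Hg E]]]]].
  assert (Hp : 0 < (r - rho) ^ n) by (apply pow_lt; lra).
  assert (B : Cmod (g z) <= M / (r - rho) ^ n).
  { apply (max_modulus g R0 r _ 0 z).
    - replace (z - 0)%C with z by ring. fold s. lra.
    - lra.
    - intros w Hw. apply Hg. now replace (w - 0)%C with w in Hw by ring.
    - intros w Hw. specialize (HM w Hw). replace (w - 0)%C with w in Hw by ring.
      rewrite E, Cmod_mult in HM.
      assert (L := lprod_ge l w (r - rho) ltac:(lra)). rewrite Hl in L.
      assert (L' : (r - rho) ^ n <= Cmod (lprod l w)).
      { apply L. intros a Hin. specialize (Ha a Hin). pose proof (Cmod_le_sub w a). lra. }
      apply (Rmult_le_reg_r ((r - rho) ^ n)); auto.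
      replace (M / (r - rho) ^ n * (r - rho) ^ n) with M by (field; lra).
      pose proof (Cmod_ge_0 (g w)). nra. }
  rewrite E, Cmod_mult.
  assert (L := lprod_le l z (s + rho)). rewrite Hl in L.
  assert (L' : Cmod (lprod l z) <= (s + rho) ^ n).
  { apply L. intros a Hin. specialize (Ha a Hin). pose proof (Cmod_sub_le z a). unfold s. lra. }
  apply Rle_lt_trans with ((s + rho) ^ n * (M / (r - rho) ^ n)).
  { apply Rmult_le_compat; auto; apply Cmod_ge_0. }
  unfold Rdiv in Hn. rewrite Rpow_mult_distr, pow_inv in Hn.
  apply (Rmult_lt_compat_l M) in Hn; auto.
  replace (M * (eps * / M)) with eps in Hn by (field; lra). unfold Rdiv. lra.
Qed.

Lemma Cpolar (c : C) : c <> 0 -> exists t, c = (RtoC (Cmod c) * cis t)%C.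
Proof.
  intros Hc. apply Cmod_gt_0 in Hc as Hp. set (m := Cmod c) in *.
  set (x := Re c / m).
  assert (Hx : -1 <= x <= 1).
  { pose proof (re_le_Cmod c) as H. fold m in H. apply Rabs_le_between in H. unfold x.
    split; apply (Rmult_le_reg_r m); auto; replace (Re c / m * m) with (Re c) by (field; lra); lra. }
  assert (Hm : m * m = Re c * Re c + Im c * Im c).
  { pose proof (Cmod2_alt c) as H. fold m in H. simpl in H. lra. }
  assert (Hs : m * sin (acos x) = Rabs (Im c)).
  { rewrite sin_acos by auto.
    rewrite <- (sqrt_Rsqr m) at 1 by lra. rewrite <- sqrt_mult_alt by (unfold Rsqr; nra).
    rewrite <- sqrt_Rsqr_abs. f_equal. unfold Rsqr, x.
    replace (m * m * (1 - Re c / m * (Re c / m))) with (m * m - Re c * Re c) by (field; lra).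
    rewrite Hm. ring. }
  assert (Hcs : m * cos (acos x) = Re c).
  { rewrite cos_acos by auto. unfold x. field. lra. }
  destruct (Rle_lt_dec 0 (Im c)) as [L|L].
  - exists (acos x). rewrite Rabs_right in Hs by lra.
    apply Ceq; simpl; unfold Re, Im in *; lra.
  - exists (- acos x). rewrite Rabs_left in Hs by lra.
    apply Ceq; simpl; rewrite ?cos_neg, ?sin_neg; unfold Re, Im in *; lra.
Qed.

Lemma cis_pow (t : R) (n : nat) : (cis t ^ n)%C = cis (INR n * t).
Proof.
  induction n as [|n IH].
  - simpl. rewrite Rmult_0_l. unfold cis. now rewrite cos_0, sin_0.
  - rewrite Cpow_S, IH, <- cis_plus, S_INR. f_equal. ring.
Qed.

Lemma lprod_repeat0 (m : nat) (z : C) : lprod (repeat (RtoC 0) m) z = (z ^ m)%C.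
Proof. induction m as [|m IH]; simpl; [reflexivity|]. rewrite IH. ring. Qed.

(** A function divisible by every power of [z] vanishes by [many_zeros] with [rho = 0]. Otherwise a
    power that divides without its successor dividing gives the order. *)
Lemma zero_order (h : C -> C) (R0 : R) : 0 < R0 -> (forall z, Cmod z < R0 -> hol h z) ->
  (forall z, Cmod z < R0 -> h z = 0) \/
  exists m g, (forall z, Cmod z < R0 -> hol g z) /\ (forall z, h z = (z ^ m * g z)%C) /\ g 0 <> 0.
Proof.
  intros HR Hh.
  set (P := fun m : nat => exists g, (forall z, Cmod z < R0 -> hol g z) /\
     forall z, h z = (z ^ m * g z)%C).
  destruct (classic (forall m, P m)) as [Hall|Hnall].
  { left. intros z Hz. apply (many_zeros h R0 0); auto; try lra.
    intros m. destruct (Hall m) as [g [Hg E]]. exists (repeat (RtoC 0) m), g.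
    split; [apply repeat_length|]. split.
    { intros a Ha. apply repeat_spec in Ha. subst. rewrite Cmod_0; lra. }
    split; auto. intros w. now rewrite lprod_repeat0. }
  right.
  assert (Hm : exists m, P m /\ ~ P (S m)).
  { apply NNPP. intros Hn. apply Hnall. intros m. induction m as [|m IH].
    - exists h. split; auto. intros z. simpl. ring.
    - apply NNPP. intros Hc. apply Hn. now exists m. }
  destruct Hm as [m [[g [Hg E]] HnP]]. exists m, g. split; [auto|]. split; [auto|].
  intros E0. apply HnP. destruct (factor_ball g 0 0 R0) as [k [Hk Ek]]; auto.
  - intros z Hz. apply Hg. now replace (z - 0)%C with z in Hz by ring.
  - replace (0 - 0)%C with (RtoC 0) by ring. now rewrite Cmod_0.
  - exists k. split.
    + intros z Hz. apply Hk. now replace (z - 0)%C with z by ring.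
    + intros z. rewrite E, Ek, Cpow_S. ring.
Qed.

(* Near a point where [f - f 0] vanishes to order [m], move in a direction in which the leading term points opposite to [f 0]. *)
Lemma local_min0 (f : C -> C) (R0 : R) : 0 < R0 -> (forall z, Cmod z < R0 -> hol f z) ->
  f 0 <> 0 -> (forall z, Cmod z < R0 -> f z = f 0) \/
  (forall s, 0 < s -> exists z, Cmod z < s /\ Cmod (f z) < Cmod (f 0)).
Proof.
  intros HR Hf H0. set (h := fun z => (f z - f 0)%C).
  assert (Hh : forall z, Cmod z < R0 -> hol h z).
  { intros z Hz. apply hol_minus; auto. apply hol_const. }
  destruct (zero_order h R0 HR Hh) as [Hz|[m [g [Hg [E Hg0]]]]].
  { left. intros z Hz'. now apply Cminus_eq_0, Hz. }
  right.
  assert (Hm1 : m <> O).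
  { intros ->. apply Hg0. specialize (E 0). simpl in E. unfold h in E.
    replace (g 0) with (1 * g 0)%C by ring. rewrite <- E. ring. }
  intros s Hs.
  apply Cmod_gt_0 in H0 as Hf0. apply Cmod_gt_0 in Hg0 as Hgp.
  destruct (hol_ccont g 0 (Hg 0 ltac:(rewrite Cmod_0; lra)) (Cmod (g 0)) Hgp)
    as [d [Hd Hgd]].
  destruct (Cpolar (- f 0 / g 0)%C) as [t Ht].
  { apply Cmod_pos_nz. rewrite Cmod_div, Cmod_opp by auto. now apply Rdiv_lt_0_compat. }
  set (q := Cmod (- f 0 / g 0)%C) in *.
  assert (Hq : q = Cmod (f 0) / Cmod (g 0)).
  { unfold q. rewrite Cmod_div, Cmod_opp by auto. reflexivity. }
  assert (Hqp : 0 < q) by (rewrite Hq; apply Rdiv_lt_0_compat; auto).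
  (* The four bounds keep the point within [s], keep [g] within [|g 0|] of its value at 0, give
     [rho ^ m <= rho], and make the factor [1 - rho ^ m / q] nonnegative. *)
  set (rho := Rmin (Rmin (s / 2) (d / 2)) (Rmin 1 q)).
  assert (Hrho : 0 < rho) by (unfold rho; repeat apply Rmin_pos; lra).
  assert (Hr1 : rho <= s / 2) by (eapply Rle_trans; apply Rmin_l).
  assert (Hr2 : rho <= d / 2) by (eapply Rle_trans; [apply Rmin_l|apply Rmin_r]).
  assert (Hr3 : rho <= 1) by (eapply Rle_trans; [apply Rmin_r|apply Rmin_l]).
  assert (Hr4 : rho <= q) by (eapply Rle_trans; apply Rmin_r).
  clearbody rho.
  set (z := (RtoC rho * cis (t / INR m))%C).
  assert (Hz : Cmod z = rho) by (apply Cmod_rcis; lra).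
  assert (Hzm : (z ^ m)%C = (RtoC (rho ^ m) * cis t)%C).
  { unfold z. rewrite Cpow_mult_l, cis_pow, <- RtoC_pow. do 2 f_equal. field.
    now apply not_0_INR. }
  assert (Hrm : 0 < rho ^ m) by (apply pow_lt; auto).
  assert (Hrm' : rho ^ m <= rho).
  { destruct m as [|m]; [tauto|]. simpl.
    assert (rho ^ m <= 1) by (rewrite <- (pow1 m); apply pow_incr; lra). nra. }
  exists z. split; [lra|].
  specialize (Hgd z). replace (z - 0)%C with z in Hgd by ring. specialize (Hgd ltac:(lra)).
  assert (Hcis : (RtoC q * cis t * g 0)%C = (- f 0)%C).
  { rewrite <- Ht. field. auto. }
  assert (Ef : f z = (RtoC (1 - rho ^ m / q) * f 0 + z ^ m * (g z - g 0))%C).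
  { replace (f z) with (f 0 + h z)%C by (unfold h; ring). rewrite E.
    replace (f 0) with (- (RtoC q * cis t * g 0))%C by (rewrite Hcis; ring).
    rewrite Hzm, RtoC_minus, RtoC_div by lra. field. apply Cmod_pos_nz.
    rewrite Cmod_R, Rabs_right; lra. }
  assert (Hle1 : 0 <= 1 - rho ^ m / q).
  { assert (rho ^ m / q <= 1); [|lra]. apply (Rmult_le_reg_r q); auto.
    replace (rho ^ m / q * q) with (rho ^ m) by (field; lra). lra. }
  rewrite Ef. eapply Rle_lt_trans; [apply Cmod_triangle|].
  rewrite !Cmod_mult, Cmod_R, Rabs_right by lra. rewrite Cmod_pow, Hz.
  assert (Eq : rho ^ m / q * Cmod (f 0) = rho ^ m * Cmod (g 0)) by (rewrite Hq; field; lra).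
  nra.
Qed.

Lemma local_min (f : C -> C) (p : C) (R0 : R) : 0 < R0 -> hol_on_ball f p R0 ->
  f p <> 0 -> (forall z, Cmod (z - p)%C < R0 -> f z = f p) \/
  (forall s, 0 < s -> exists z, Cmod (z - p)%C < s /\ Cmod (f z) < Cmod (f p)).
Proof.
  intros HR Hf H0.
  destruct (local_min0 (fun w => f (w + p)%C) R0 HR) as [H|H].
  - intros z Hz. apply hol_shift, Hf. now replace (z + p - p)%C with z by ring.
  - now rewrite Cplus_0_l.
  - left. intros z Hz. specialize (H _ Hz). rewrite Cplus_0_l in H.
    now replace (z - p + p)%C with z in H by ring.
  - right. intros s Hs. destruct (H s Hs) as [z [Hz1 Hz2]]. exists (z + p)%C.
    rewrite Cplus_0_l in Hz2. split; auto. now replace (z + p - p)%C with z by ring.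
Qed.

(** * The minimum principle *)

Lemma compact_argmin (K : C -> Prop) (F : C -> C) (z0 : C) : compact_C K -> K z0 ->
  (forall z, K z -> ccont F z) -> exists p, K p /\ forall z, K z -> Cmod (F p) <= Cmod (F z).
Proof.
  intros HK Hz0 HF.
  destruct (completeness (fun r => exists z, K z /\ r = - Cmod (F z))) as [m [Hub Hlub]].
  - exists 0. intros r [z [_ ->]]. pose proof (Cmod_ge_0 (F z)); lra.
  - exists (- Cmod (F z0)), z0; auto.
  - assert (Hs : forall k : nat, exists z, K z /\ Cmod (F z) < - m + / INR (S k)).
    { intros k. apply NNPP. intros Hn. pose proof (inv_S_pos k).
      assert (m <= m - / INR (S k)); [|lra]. apply Hlub. intros r [z [Hz ->]].
      apply Rnot_lt_le. intros L. apply Hn. exists z. split; auto. lra. }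
    set (u := fun k => proj1_sig (constructive_indefinite_description _ (Hs k))).
    assert (Hu : forall k, K (u k) /\ Cmod (F (u k)) < - m + / INR (S k)).
    { intros k. apply (proj2_sig (constructive_indefinite_description _ (Hs k))). }
    destruct (HK u) as [phi [p [H1 [H2 H3]]]]; [apply Hu|].
    exists p. split; auto. intros z Hz.
    assert (Hmz : - m <= Cmod (F z)).
    { assert (- Cmod (F z) <= m); [|lra]. apply Hub. now exists z. }
    apply Rle_trans with (- m); auto. apply le_epsilon. intros eps He.
    destruct (HF p H2 (eps / 2)) as [d [Hd Hc]]; [lra|].
    destruct (H3 d Hd) as [N1 HN1]. destruct (inv_S_small (eps / 2)) as [N2 HN2]; [lra|].
    set (k := (N1 + N2)%nat). specialize (HN1 k ltac:(lia)). specialize (Hc _ HN1).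
    pose proof (incr_ge phi H1 k). specialize (HN2 (phi k) ltac:(lia)).
    destruct (Hu (phi k)) as [_ B]. rewrite Cmod_minus_sym in Hc.
    pose proof (Cmod_le_sub (F p) (F (u (phi k)))). lra.
Qed.

Definition copen (O : C -> Prop) : Prop :=
  forall z, O z -> exists s, 0 < s /\ forall w, Cmod (w - z)%C < s -> O w.
Definition closure (O : C -> Prop) (z : C) : Prop :=
  forall eps, 0 < eps -> exists w, O w /\ Cmod (w - z)%C < eps.

Lemma closure_incl (O : C -> Prop) (z : C) : O z -> closure O z.
Proof.
  intros H eps He. exists z. split; auto.
  replace (z - z)%C with (RtoC 0) by ring. now rewrite Cmod_0.
Qed.

Lemma closure_compact (O : C -> Prop) (M : R) : (forall z, O z -> Cmod z <= M) ->
  compact_C (closure O).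
Proof.
  intros HM. apply (compact_of_closed _ (M + 1)).
  - intros z Hz. destruct (Hz 1) as [w [Hw Hd]]; [lra|]. specialize (HM w Hw).
    rewrite Cmod_minus_sym in Hd. pose proof (Cmod_le_sub z w). lra.
  - intros u l Hu Hl eps He. destruct (Hl (eps / 2)) as [N HN]; [lra|].
    destruct (Hu N (eps / 2)) as [w [Hw Hd]]; [lra|]. exists w. split; auto.
    specialize (HN N (le_n N)). pose proof (Cmod_tri_minus w (u N) l). lra.
Qed.

(** The source of every surjectivity statement about [f] and its orbits, in place of Rouché's
    theorem. A minimum of [|h|] over the closure is below [c], hence interior, and [local_min]
    leaves only the values 0 or a constant function. No connectedness of [O] is assumed, which
    matters for sets of parameters. *)
Lemma min_principle (h : C -> C) (O : C -> Prop) (M c : R) (p : C) : entire' h -> copen O ->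
  (forall z, O z -> Cmod z <= M) ->
  (forall z, closure O z -> ~ O z -> c <= Cmod (h z)) ->
  O p -> Cmod (h p) < c -> exists z, O z /\ h z = 0.
Proof.
  intros Hh HO HM Hb Hp Hpc.
  assert (HK := closure_compact O M HM).
  destruct (compact_argmin (closure O) h p HK (closure_incl O p Hp)) as [p0 [Hp0 Hmin]].
  { intros z _. now apply hol_ccont. }
  assert (Hp0c : Cmod (h p0) < c).
  { eapply Rle_lt_trans; [|exact Hpc]. apply Hmin. now apply closure_incl. }
  assert (HO0 : O p0).
  { apply NNPP. intros Hn. specialize (Hb p0 Hp0 Hn). lra. }
  destruct (Ceq_dec (h p0) 0) as [E|Hn]; [now exists p0|]. exfalso.
  set (R0 := Rabs M + 1 + Cmod p0 + 1).
  assert (HR0 : 0 < R0) by (unfold R0; pose proof (Rabs_pos M); pose proof (Cmod_ge_0 p0); lra).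
  destruct (local_min h p0 R0 HR0 (entire_ball _ _ _ Hh) Hn) as [Hc|Hl].
  (* The constant case still needs a boundary point, where [|h| >= c] is violated. The point of the
     closure nearest to [|M| + 2], which lies outside, cannot be interior, as a small move towards
     [|M| + 2] would bring it nearer. *)
  - destruct (compact_argmin (closure O) (fun z => z - RtoC (Rabs M + 2))%C p HK (closure_incl O p Hp))
      as [p1 [Hp1 Hmin1]].
    { intros z _. apply ccont_minus; [apply ccont_id|apply ccont_const]. }
    assert (Hp1M : Cmod p1 <= Rabs M + 1).
    { destruct (Hp1 1) as [w [Hw Hd]]; [lra|]. specialize (HM w Hw).
      rewrite Cmod_minus_sym in Hd. pose proof (Cmod_le_sub p1 w). pose proof (Rle_abs M). lra. }
    destruct (classic (O p1)) as [HO1|HO1].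
    + set (v := (p1 - RtoC (Rabs M + 2))%C) in *.
      assert (Hv : 0 < Cmod v).
      { unfold v. apply Cmod_minus_pos. intros E. rewrite E, Cmod_R, Rabs_right in Hp1M; try lra.
        pose proof (Rabs_pos M); lra. }
      destruct (HO p1 HO1) as [s [Hs Hball]].
      set (e := Rmin (1 / 2) (s / (2 * Cmod v))).
      assert (He : 0 < e) by (unfold e; apply Rmin_pos; [lra|apply Rdiv_lt_0_compat; lra]).
      assert (He1 : e <= 1 / 2) by apply Rmin_l.
      assert (He2 : e <= s / (2 * Cmod v)) by apply Rmin_r.
      set (w := (p1 - RtoC e * v)%C).
      assert (Hw : O w).
      { apply Hball. unfold w. replace (p1 - RtoC e * v - p1)%C with (- (RtoC e * v))%C by ring.
        rewrite Cmod_opp, Cmod_mult, Cmod_R, Rabs_right by lra.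
        apply (Rmult_le_compat_r (Cmod v)) in He2; [|lra].
        replace (s / (2 * Cmod v) * Cmod v) with (s / 2) in He2 by (field; lra). lra. }
      specialize (Hmin1 w (closure_incl _ _ Hw)). unfold w in Hmin1.
      replace (p1 - RtoC e * v - RtoC (Rabs M + 2))%C with (RtoC (1 - e) * v)%C in Hmin1
        by (unfold v; rewrite RtoC_minus; ring).
      rewrite Cmod_mult, Cmod_R, Rabs_right in Hmin1 by lra. nra.
    + specialize (Hb p1 Hp1 HO1). rewrite (Hc p1) in Hb; [lra|].
      pose proof (Cmod_sub_le p1 p0). unfold R0. lra.
  - destruct (HO p0 HO0) as [s [Hs Hball]]. destruct (Hl s Hs) as [z [Hz1 Hz2]].
    specialize (Hmin z (closure_incl _ _ (Hball z Hz1))). lra.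
Qed.

(** * Spherical limits *)

Lemma entire_of_Defs (f : C -> C) : entire f -> entire' f.
Proof.
  intros H z. destruct (H z) as [l Hl]. exists l. intros eps He.
  destruct (Hl eps He) as [d [Hd Hf]]. exists d. split; auto. intros h Hh.
  destruct (Ceq_dec h 0) as [->|Hn].
  - replace (f (z + 0) - f z - l * 0)%C with (RtoC 0) by (rewrite Cplus_0_r; ring). rewrite Cmod_0. lra.
  - specialize (Hf h Hn Hh).
    replace (f (z + h) - f z - l * h)%C with (((f (z + h) - f z) / h - l) * h)%C by (field; auto).
    rewrite Cmod_mult. apply Rmult_le_compat_r; [apply Cmod_ge_0|lra].
Qed.

(** A quarter of the chordal distance from the circle [|z| = B] to infinity. Points this close to
    one of modulus at most [B] stay bounded, and points this close to infinity exceed [B]. *)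
Definition chord_eps (B : R) : R := / (2 * sqrt (1 + B ^ 2)).

Lemma sqrt1_pos (B : R) : 0 < sqrt (1 + B ^ 2).
Proof. apply sqrt_lt_R0. pose proof (pow2_ge_0 B). lra. Qed.

Lemma chord_eps_pos (B : R) : 0 < chord_eps B.
Proof. apply Rinv_0_lt_compat. pose proof (sqrt1_pos B). lra. Qed.

Lemma sqrt1_le (B : R) : 0 <= B -> sqrt (1 + B ^ 2) <= 1 + B.
Proof. intros H. rewrite <- (sqrt_pow2 (1 + B)) by lra. apply sqrt_le_1_alt. nra. Qed.

Lemma sqrt1_mono (a B : R) : 0 <= a -> a <= B -> sqrt (1 + a ^ 2) <= sqrt (1 + B ^ 2).
Proof. intros H1 H2. apply sqrt_le_1_alt. nra. Qed.

Lemma chordal_sym (a b : C) : chordal (Some a) (Some b) = chordal (Some b) (Some a).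
Proof. simpl. rewrite (Cmod_minus_sym a b). f_equal. rewrite Rmult_comm. reflexivity. Qed.

Lemma chordal_bounded (a b : C) (B : R) : Cmod a <= B ->
  chordal (Some a) (Some b) < chord_eps B -> Cmod b <= 2 * B + 1.
Proof.
  intros Ha H. unfold chordal, chord_eps in H.
  pose proof (sqrt1_pos (Cmod a)) as P1. pose proof (sqrt1_pos (Cmod b)) as P2.
  pose proof (sqrt1_pos B) as P3. pose proof (Cmod_ge_0 a) as A0. pose proof (Cmod_ge_0 b) as B0.
  pose proof (sqrt1_mono (Cmod a) B A0 Ha) as M. pose proof (sqrt1_le (Cmod b) B0) as L.
  set (x := sqrt (1 + Cmod a ^ 2)) in *. set (y := sqrt (1 + Cmod b ^ 2)) in *.
  set (s := sqrt (1 + B ^ 2)) in *.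
  apply (Rmult_lt_compat_r (x * y)) in H; [|nra].
  replace (2 * Cmod (a - b) / (x * y) * (x * y)) with (2 * Cmod (a - b)) in H by (field; lra).
  assert (K : / (2 * s) * (x * y) <= y / 2).
  { apply (Rmult_le_reg_l (2 * s)); [lra|]. replace (2 * s * (/ (2 * s) * (x * y))) with (x * y) by (field; lra).
    replace (2 * s * (y / 2)) with (s * y) by field. apply Rmult_le_compat_r; lra. }
  pose proof (Cmod_le_sub b a) as T. rewrite Cmod_minus_sym in T. lra.
Qed.

Lemma chordal_none (a : C) (B : R) : 0 <= B -> chordal (Some a) None < chord_eps B -> B < Cmod a.
Proof.
  intros HB H. apply Rnot_le_lt. intros Ha. revert H. apply Rle_not_lt. unfold chordal, chord_eps.
  pose proof (sqrt1_pos (Cmod a)) as P1. pose proof (sqrt1_pos B) as P3.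
  pose proof (sqrt1_mono (Cmod a) B (Cmod_ge_0 a) Ha) as M.
  apply Rle_trans with (/ sqrt (1 + B ^ 2)).
  - apply Rinv_le_contravar; lra.
  - apply Rle_trans with (/ sqrt (1 + Cmod a ^ 2)); [apply Rinv_le_contravar; lra|].
    unfold Rdiv. assert (0 < / sqrt (1 + Cmod a ^ 2)) by now apply Rinv_0_lt_compat. lra.
Qed.

(** Inversion is a chordal isometry, and on the closed unit disc the Euclidean distance is at most
    the chordal one. Convergence near infinity thus becomes uniform convergence of reciprocals. *)
Lemma chordal_inv (a b : C) : 1 <= Cmod a -> 1 <= Cmod b ->
  Cmod (/ a - / b)%C <= chordal (Some a) (Some b).
Proof.
  intros Ha Hb. assert (Na : a <> 0) by (apply Cmod_pos_nz; lra). assert (Nb : b <> 0) by (apply Cmod_pos_nz; lra).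
  replace (/ a - / b)%C with ((b - a) / (a * b))%C by (field; auto).
  rewrite Cmod_div, Cmod_mult, Cmod_minus_sym by (apply Cmult_neq_0; auto). unfold chordal.
  assert (S : forall x, 1 <= x -> sqrt (1 + x ^ 2) <= sqrt 2 * x).
  { intros x Hx. rewrite <- (sqrt_pow2 x) at 2 by lra. rewrite <- sqrt_mult_alt by lra.
    apply sqrt_le_1_alt. nra. }
  pose proof (S _ Ha) as Sa. pose proof (S _ Hb) as Sb.
  pose proof (sqrt1_pos (Cmod a)) as P1. pose proof (sqrt1_pos (Cmod b)) as P2.
  assert (S2 : sqrt 2 * sqrt 2 = 2) by (apply sqrt_sqrt; lra).
  assert (S0 : 0 < sqrt 2) by (apply sqrt_lt_R0; lra).
  set (x := sqrt (1 + Cmod a ^ 2)) in *. set (y := sqrt (1 + Cmod b ^ 2)) in *.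
  assert (Hxy : x * y <= 2 * (Cmod a * Cmod b)).
  { apply Rle_trans with ((sqrt 2 * Cmod a) * (sqrt 2 * Cmod b)); [apply Rmult_le_compat; lra|].
    replace ((sqrt 2 * Cmod a) * (sqrt 2 * Cmod b)) with ((sqrt 2 * sqrt 2) * (Cmod a * Cmod b)) by ring.
    rewrite S2. lra. }
  assert (Hab : 0 < Cmod a * Cmod b) by nra.
  apply (Rmult_le_reg_r (Cmod a * Cmod b)); auto.
  replace (Cmod (a - b) / (Cmod a * Cmod b) * (Cmod a * Cmod b)) with (Cmod (a - b)) by (field; lra).
  apply (Rmult_le_reg_r (x * y)); [nra|].
  replace (2 * Cmod (a - b) / (x * y) * (Cmod a * Cmod b) * (x * y)) with
    (Cmod (a - b) * (2 * (Cmod a * Cmod b))) by (field; lra).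
  apply Rmult_le_compat_l; [apply Cmod_ge_0|auto].
Qed.

Lemma chordal_inv_none (a : C) : 1 <= Cmod a -> Cmod (/ a)%C <= chordal (Some a) None.
Proof.
  intros Ha. assert (Na : a <> 0) by (apply Cmod_pos_nz; lra). rewrite Cmod_inv by auto. unfold chordal.
  pose proof (sqrt1_pos (Cmod a)) as P1. pose proof (sqrt1_le (Cmod a) ltac:(lra)) as L.
  set (x := sqrt (1 + Cmod a ^ 2)) in *. apply (Rmult_le_reg_r (Cmod a * x)); [nra|].
  replace (/ Cmod a * (Cmod a * x)) with x by (field; lra).
  replace (2 / x * (Cmod a * x)) with (2 * Cmod a) by (field; lra). lra.
Qed.

(** The Cauchy formula passes to a uniform limit, which is therefore a Cauchy transform of its own
    values on a circle. *)
Lemma hol_limit (v : nat -> C -> C) (k : C -> C) (s : R) : 0 < s ->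
  (exists N0, forall j, (N0 <= j)%nat -> forall z, Cmod z < s -> hol (v j) z) ->
  (forall eps, 0 < eps -> exists N, forall j z, (N <= j)%nat -> Cmod z < s -> Cmod (v j z - k z)%C <= eps) ->
  forall b, Cmod b < s / 2 -> hol k b.
Proof.
  intros Hs [N0 Hv] Hu b Hb. pose proof PI_RGT_0 as Hpi. set (r := s / 2) in *.
  assert (Hkc : forall z, Cmod z < s -> ccont k z).
  { intros z Hz eps He. destruct (Hu (eps / 4)) as [N HN]; [lra|].
    set (j := (N + N0)%nat).
    destruct (hol_ccont _ _ (Hv j ltac:(lia) z Hz) (eps / 4)) as [d [Hd Hc]]; [lra|].
    exists (Rmin d (s - Cmod z)). split; [apply Rmin_pos; lra|]. intros w Hw.
    specialize (Hc w (Rlt_le_trans _ _ _ Hw (Rmin_l _ _))).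
    assert (W := Rlt_le_trans _ _ _ Hw (Rmin_r _ _)). pose proof (Cmod_le_sub w z).
    assert (A := HN j z ltac:(lia) Hz). assert (B := HN j w ltac:(lia) ltac:(lra)).
    pose proof (Cmod_tri_minus (k w) (v j w) (k z)). pose proof (Cmod_tri_minus (v j w) (v j z) (k z)).
    rewrite (Cmod_minus_sym (k w) (v j w)) in *. lra. }
  assert (E : forall b, Cmod b < r -> circ (fun z => k z * (z / (z - b)))%C r = (RtoC (2 * PI) * k b)%C).
  { intros b0 Hb0. pose proof (Cmod_ge_0 b0).
    assert (Hne : forall z, Cmod z = r -> z <> b0) by (intros z Hz ->; lra).
    apply Cminus_eq_0, small_zero. intros eps He.
    set (Q := 4 * PI * (r / (r - Cmod b0)) + 2 * PI + 1).
    assert (HQ0 : 0 <= r / (r - Cmod b0)).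
    { apply Rmult_le_pos; [unfold r; lra|left; apply Rinv_0_lt_compat; lra]. }
    assert (HQ : 0 < Q) by (unfold Q; nra).
    destruct (Hu (eps / (2 * Q))) as [N HN]. { apply Rdiv_lt_0_compat; lra. }
    set (j := (N + N0)%nat). set (e := eps / (2 * Q)) in *.
    assert (Hj := cauchy_formula (v j) s r b0 Hb0 ltac:(unfold r; lra) (Hv j ltac:(lia))).
    assert (D1 : Cmod (circ (fun z => (k z - v j z) * (z / (z - b0)))%C r)%C <= 4 * PI * (e * (r / (r - Cmod b0)))).
    { apply circ_bound; [unfold r; lra| |].
      - intros z Hz. apply ccont_mult; [|now apply hol_ccont, hol_kernel; auto].
        apply ccont_minus; [apply Hkc; unfold r in *; lra|apply hol_ccont, Hv; [lia|unfold r in *; lra]].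
      - intros z Hz. rewrite Cmod_mult, Cmod_div, Hz by (apply Cminus_neq_0; auto).
        apply Rmult_le_compat; try apply Cmod_ge_0.
        + apply Rmult_le_pos; [unfold r; lra|]. left. apply Rinv_0_lt_compat, Cmod_minus_pos; auto.
        + rewrite Cmod_minus_sym. apply HN; [lia|unfold r in *; lra].
        + apply Rmult_le_compat_l; [unfold r; lra|]. apply Rinv_le_contravar; [lra|].
          rewrite <- Hz. apply Cmod_le_sub. }
    assert (D2 : circ (fun z => (k z - v j z) * (z / (z - b0)))%C r =
      (circ (fun z => k z * (z / (z - b0)))%C r - RtoC (2 * PI) * v j b0)%C).
    { rewrite <- Hj, <- circ_minus; [|unfold r; lra| |].
      - apply circ_ext; [unfold r; lra|]. intros z Hz. ring.
      - intros z Hz. apply ccont_mult; [apply Hkc; unfold r in *; lra|now apply hol_ccont, hol_kernel; auto].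
      - intros z Hz. apply ccont_mult; [apply hol_ccont, Hv; [lia|unfold r in *; lra]|now apply hol_ccont, hol_kernel; auto]. }
    assert (D3 := HN j b0 ltac:(lia) ltac:(unfold r in *; lra)).
    replace (circ (fun z => k z * (z / (z - b0)))%C r - RtoC (2 * PI) * k b0)%C with
      (circ (fun z => (k z - v j z) * (z / (z - b0)))%C r + RtoC (2 * PI) * (v j b0 - k b0))%C
      by (rewrite D2; ring).
    eapply Rle_lt_trans; [apply Cmod_triangle|]. rewrite (Cmod_mult (RtoC _)), Cmod_R, Rabs_right by lra.
    assert (Ee : e * Q = eps / 2) by (unfold e; field; lra).
    assert (He0 : 0 < e) by (unfold e; apply Rdiv_lt_0_compat; lra).
    assert (D4 : 2 * PI * Cmod (v j b0 - k b0) <= 2 * PI * e) by (apply Rmult_le_compat_l; lra).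
    unfold Q in Ee. lra. }
  apply (hol_ext_loc (fun b => / RtoC (2 * PI) * circ (fun z => (k z * z) / (z - b))%C r)%C _ b (r - Cmod b)).
  - lra.
  - intros w Hw. assert (Hwr : Cmod w < r).
    { pose proof (Cmod_triangle (w - b) b) as T. replace (w - b + b)%C with w in T by ring. lra. }
    pose proof twopi_nz. pose proof (Cmod_ge_0 w).
    rewrite (circ_ext _ (fun z => k z * (z / (z - w)))%C); [rewrite E by auto; field; auto|lra|].
    intros z Hz. field. apply Cminus_neq_0. intros ->. lra.
  - apply hol_mult; [apply hol_const|]. apply (cauchy_transform_hol (fun z => k z * z)%C); auto.
    intros z Hz. apply ccont_mult; [apply Hkc; unfold r in *; lra|apply ccont_id].
Qed.

Lemma finite_far (Q : list C) (z : C) : ~ In z Q -> exists s, 0 < s /\ forall w, Cmod (w - z)%C <= s -> ~ In w Q.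
Proof.
  induction Q as [|q Q IH]; intros H.
  - exists 1. split; [lra|]. intros w _ [].
  - destruct IH as [s [Hs H1]]. { intros Hq. apply H. now right. }
    assert (Hq : 0 < Cmod (q - z)%C). { apply Cmod_minus_pos. intros ->. apply H. now left. }
    exists (Rmin s (Cmod (q - z)%C / 2)). split; [apply Rmin_pos; lra|].
    intros w Hw [<-|Hin].
    + pose proof (Rle_trans _ _ _ Hw (Rmin_r _ _)). lra.
    + apply (H1 w); auto. eapply Rle_trans; [exact Hw|apply Rmin_l].
Qed.

Lemma avoid_radius (l : list R) : forall a b, a < b -> exists x, a < x < b /\ ~ In x l.
Proof.
  induction l as [|y l IH]; intros a b Hab.
  - exists ((a + b) / 2). split; [lra|]. intros [].
  - destruct (Rle_lt_dec y ((a + b) / 2)) as [L|L].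
    + destruct (IH ((a + b) / 2) b) as [x [Hx Hn]]; [lra|]. exists x. split; [lra|].
      intros [E|Hin]; [lra|auto].
    + destruct (IH a ((a + b) / 2)) as [x [Hx Hn]]; [lra|]. exists x. split; [lra|].
      intros [E|Hin]; [lra|auto].
Qed.

(** One radius is found for all centres in [l] together, because [good_scale] needs equal circles
    about 0 and about the limit of the rescaled zeros. *)
Lemma circle_avoid (Q l : list C) (a b : R) : a < b -> exists x, a < x < b /\ forall q, In q Q ->
  forall c, In c l -> Cmod (q - c)%C <> x.
Proof.
  intros Hab. destruct (avoid_radius (flat_map (fun q => map (fun c => Cmod (q - c)%C) l) Q) a b Hab) as [x [Hx Hn]].
  exists x. split; auto. intros q Hq c Hc E. apply Hn. apply in_flat_map. exists q. split; auto.
  apply in_map_iff. exists c. auto.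
Qed.

(** The points [z1 + (z - z1) (1/2 + i x)] fill the perpendicular bisector, so [z1] and [z] are
    joined by two segments over such an apex. Seen from [z] the sign of [x] is reversed, hence the
    parameter [sg] in [segments_avoid]. *)
Definition half_plus_i (x : R) : C := (1 / 2, x).

(* A point of [Q] lies on at most one of the segments from [p] to [p + e (1/2 + n i)]. *)
Lemma segments_avoid (Q : list C) (p e : C) (sg : R) : e <> 0 -> sg <> 0 -> ~ In p Q -> exists M, forall n, (M <= n)%nat ->
  forall t, 0 <= t <= 1 -> ~ In (p + RtoC t * (e * half_plus_i (sg * INR n)))%C Q.
Proof.
  intros He Hsg. induction Q as [|q Q' IH]; intros Hp.
  - exists O. intros n _ t _ [].
  - destruct IH as [M HM]. { intros Hq. apply Hp. now right. }
    assert (Hq : q <> p). { intros ->. apply Hp. now left. }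
    set (x := ((q - p) / e)%C).
    assert (Huniq : forall n t, q = (p + RtoC t * (e * half_plus_i (sg * INR n)))%C ->
      t <> 0 /\ Re x = t / 2 /\ Im x = t * (sg * INR n)).
    { intros n t E. assert (Ex : x = (RtoC t * half_plus_i (sg * INR n))%C).
      { unfold x. rewrite E. field. auto. }
      split; [|rewrite Ex; simpl; split; field].
      intros ->. apply Hq. rewrite E. ring. }
    destruct (classic (exists n0 t0, q = (p + RtoC t0 * (e * half_plus_i (sg * INR n0)))%C)) as [[n0 [t0 E0]]|Hn].
    + exists (S (n0 + M)). intros n Hn t Ht [E|Hin].
      * destruct (Huniq n0 t0 E0) as [A1 [A2 A3]]. destruct (Huniq n t E) as [B1 [B2 B3]].
        assert (t = t0) by lra. subst t0. rewrite A3 in B3.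
        apply Rmult_eq_reg_l in B3; auto. apply Rmult_eq_reg_l in B3; auto. apply INR_eq in B3. lia.
      * apply (HM n ltac:(lia) t Ht Hin).
    + exists M. intros n Hn' t Ht [E|Hin].
      * apply Hn. exists n, t. exact E.
      * apply (HM n Hn' t Ht Hin).
Qed.

Section SphericalLimits.
Variables (F : nat -> C -> C) (Q : list C) (lim : C -> Chat).
Hypothesis HF : forall k, entire' (F k).
Hypothesis Hcvg : sph_cvg_compacta (fun z => True /\ ~ In z Q) F lim.

Lemma local_cvg (z : C) : ~ In z Q -> exists s, 0 < s /\
  (forall w, Cmod (w - z)%C <= s -> ~ In w Q) /\
  forall eps, 0 < eps -> exists N, forall k w, (N <= k)%nat -> Cmod (w - z)%C <= s ->
    chordal (Some (F k w)) (lim w) < eps.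
Proof.
  intros Hz. destruct (finite_far Q z Hz) as [s [Hs H]]. exists s. split; [auto|]. split; [auto|].
  intros eps He. apply (Hcvg _ (disc_compact z s)); auto.
Qed.

(** [lim] is not known to be continuous. Boundedness travels from [lim z] to [F N z], then by
    continuity of this one function to [F N u], then to [lim u], and finally to all later [F k u];
    [B0], [B1] and [B2] bound the successive stations. *)
Lemma lim_finite_nearby (z : C) (w : C) : ~ In z Q -> lim z = Some w ->
  exists B N s, 0 < s /\ forall u, Cmod (u - z)%C < s -> lim u <> None /\
    forall k, (N <= k)%nat -> Cmod (F k u) <= B.
Proof.
  intros Hz Hw. destruct (local_cvg z Hz) as [s [Hs [Hq Hc]]].
  set (B0 := Cmod w). assert (P0 : 0 <= B0) by apply Cmod_ge_0.
  set (B1 := 2 * B0 + 2). set (B2 := 2 * B1 + 1).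
  destruct (Hc (Rmin (chord_eps B0) (Rmin (chord_eps B1) (chord_eps B2)))) as [N HN].
  { repeat apply Rmin_pos; apply chord_eps_pos. }
  assert (M0 := Rmin_l (chord_eps B0) (Rmin (chord_eps B1) (chord_eps B2))).
  assert (M1 := Rle_trans _ _ _ (Rmin_r (chord_eps B0) _) (Rmin_l (chord_eps B1) (chord_eps B2))).
  assert (M2 := Rle_trans _ _ _ (Rmin_r (chord_eps B0) _) (Rmin_r (chord_eps B1) (chord_eps B2))).
  assert (HNz : Cmod (F N z) <= 2 * B0 + 1).
  { apply (chordal_bounded w); [right; reflexivity|]. rewrite chordal_sym, <- Hw.
    eapply Rlt_le_trans; [apply HN; auto|exact M0].
    replace (z - z)%C with (RtoC 0) by ring. rewrite Cmod_0. lra. }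
  destruct (hol_ccont _ _ (HF N z) 1) as [d [Hd Hcd]]; [lra|].
  exists (2 * B2 + 1), N, (Rmin s d). split; [apply Rmin_pos; auto|]. intros u Hu.
  assert (U1 := Rlt_le_trans _ _ _ Hu (Rmin_l _ _)). assert (U2 := Rlt_le_trans _ _ _ Hu (Rmin_r _ _)).
  assert (Hu1 : Cmod (F N u) <= B1).
  { specialize (Hcd u U2). pose proof (Cmod_le_sub (F N u) (F N z)). unfold B1. lra. }
  assert (HNu := HN N u (le_n _) ltac:(lra)).
  destruct (lim u) as [w'|] eqn:Eu.
  - assert (Hw' : Cmod w' <= B2) by (apply (chordal_bounded (F N u)); auto; lra).
    split; [discriminate|]. intros k Hk. apply (chordal_bounded w'); auto.
    rewrite chordal_sym, <- Eu. eapply Rlt_le_trans; [apply HN; auto; lra|exact M2].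
  - exfalso. assert (B1 < Cmod (F N u)); [|lra]. apply chordal_none; [unfold B1; lra|lra].
Qed.

(** The route of [lim_finite_nearby] with lower bounds, starting from a large one at [z]. *)
Lemma lim_infinite_nearby (z : C) (B : R) : 0 <= B -> ~ In z Q -> lim z = None ->
  exists N s, 0 < s /\ forall u, Cmod (u - z)%C < s ->
    (forall w, lim u = Some w -> B < Cmod w) /\ forall k, (N <= k)%nat -> B < Cmod (F k u).
Proof.
  intros HB Hz Hw. destruct (local_cvg z Hz) as [s [Hs [Hq Hc]]].
  set (B1 := 2 * B + 1). set (B2 := 2 * B1 + 2).
  destruct (Hc (Rmin (chord_eps B) (Rmin (chord_eps B1) (chord_eps B2)))) as [N HN].
  { repeat apply Rmin_pos; apply chord_eps_pos. }
  assert (M0 := Rmin_l (chord_eps B) (Rmin (chord_eps B1) (chord_eps B2))).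
  assert (M1 := Rle_trans _ _ _ (Rmin_r (chord_eps B) _) (Rmin_l (chord_eps B1) (chord_eps B2))).
  assert (M2 := Rle_trans _ _ _ (Rmin_r (chord_eps B) _) (Rmin_r (chord_eps B1) (chord_eps B2))).
  assert (HNz : B2 < Cmod (F N z)).
  { apply chordal_none; [unfold B2, B1; lra|]. rewrite <- Hw.
    eapply Rlt_le_trans; [apply HN; auto|exact M2].
    replace (z - z)%C with (RtoC 0) by ring. rewrite Cmod_0. lra. }
  destruct (hol_ccont _ _ (HF N z) 1) as [d [Hd Hcd]]; [lra|].
  exists N, (Rmin s d). split; [apply Rmin_pos; auto|]. intros u Hu.
  assert (U1 := Rlt_le_trans _ _ _ Hu (Rmin_l _ _)). assert (U2 := Rlt_le_trans _ _ _ Hu (Rmin_r _ _)).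
  assert (Hu1 : 2 * B1 + 1 < Cmod (F N u)).
  { specialize (Hcd u U2). rewrite Cmod_minus_sym in Hcd.
    pose proof (Cmod_le_sub (F N z) (F N u)). unfold B2 in HNz. lra. }
  destruct (lim u) as [w'|] eqn:Eu.
  - assert (Hw' : B1 < Cmod w').
    { apply Rnot_le_lt. intros L. assert (Cmod (F N u) <= 2 * B1 + 1); [|lra].
      apply (chordal_bounded w'); auto. rewrite chordal_sym, <- Eu.
      eapply Rlt_le_trans; [apply HN; auto; lra|exact M1]. }
    split.
    + intros w E. injection E as <-. unfold B1 in Hw'. lra.
    + intros k Hk. apply Rnot_le_lt. intros L. assert (Cmod w' <= 2 * B + 1); [|unfold B1 in Hw'; lra].
      apply (chordal_bounded (F k u)); auto. rewrite <- Eu.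
      eapply Rlt_le_trans; [apply HN; auto; lra|exact M0].
  - split; [discriminate|]. intros k Hk. apply chordal_none; auto. rewrite <- Eu.
    eapply Rlt_le_trans; [apply HN; auto; lra|exact M0].
Qed.

(* Hurwitz: [1 / F k] is eventually zero-free near [z] and converges to a holomorphic function vanishing at [z]. *)
Lemma lim_infinite_open (z : C) : ~ In z Q -> lim z = None ->
  exists s, 0 < s /\ forall u, Cmod (u - z)%C < s -> lim u = None.
Proof.
  intros Hz Hw. destruct (local_cvg z Hz) as [s1 [Hs1 [Hq Hc]]].
  destruct (lim_infinite_nearby z 2 ltac:(lra) Hz Hw) as [N0 [s2 [Hs2 Hbig]]].
  set (s := Rmin s1 s2). assert (Hs : 0 < s) by (apply Rmin_pos; auto).
  assert (L1 : s <= s1) by apply Rmin_l. assert (L2 : s <= s2) by apply Rmin_r. clearbody s.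
  set (v := fun j x => (/ F j (x + z))%C).
  set (k := fun x => match lim (x + z)%C with Some w => (/ w)%C | None => RtoC 0 end).
  assert (Hxz : forall x, (x + z - z)%C = x) by (intros; ring).
  assert (Hv : forall j, (N0 <= j)%nat -> forall x, Cmod x < s -> hol (v j) x).
  { intros j Hj x Hx. apply hol_inv; [apply hol_shift, HF|].
    destruct (Hbig (x + z)%C) as [_ Hb]; [rewrite Hxz; lra|]. apply Cmod_pos_nz.
    specialize (Hb j Hj). lra. }
  assert (Hu : forall eps, 0 < eps -> exists N, forall j x, (N <= j)%nat -> Cmod x < s -> Cmod (v j x - k x)%C <= eps).
  { intros eps He. destruct (Hc eps He) as [N HN]. exists (N + N0)%nat. intros j x Hj Hx.
    destruct (Hbig (x + z)%C) as [Hb1 Hb2]; [rewrite Hxz; lra|]. specialize (Hb2 j ltac:(lia)).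
    specialize (HN j (x + z)%C ltac:(lia)). rewrite Hxz in HN. specialize (HN ltac:(lra)).
    unfold v, k. destruct (lim (x + z)) as [w|].
    - specialize (Hb1 w eq_refl). eapply Rle_trans; [apply chordal_inv; lra|]. lra.
    - replace (/ F j (x + z) - 0)%C with (/ F j (x + z))%C by ring.
      eapply Rle_trans; [apply chordal_inv_none; lra|]. lra. }
  assert (Hk : forall x, Cmod x < s / 2 -> hol k x).
  { apply (hol_limit v k s Hs); auto. exists N0. exact Hv. }
  destruct (zero_order k (s / 2) ltac:(lra) Hk) as [H0|[m [g [Hg [E Hg0]]]]].
  - exists (s / 2). split; [lra|]. intros u Hu'. specialize (H0 (u - z)%C Hu').
    unfold k in H0. replace (u - z + z)%C with u in H0 by ring.
    destruct (lim u) as [w|] eqn:Eu; auto. exfalso.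
    destruct (Hbig u) as [Hb1 _]; [lra|]. specialize (Hb1 w Eu).
    assert (Nw : w <> 0) by (apply Cmod_pos_nz; lra). apply (f_equal Cmod) in H0.
    rewrite Cmod_inv, Cmod_0 in H0 by auto. assert (0 < / Cmod w) by (apply Rinv_0_lt_compat; lra). lra.
  (* If [k] did not vanish identically, it would be bounded below by [c] on a small circle, and
     [F j] above by [2 / c] there. The maximum modulus principle carries this bound to [z], where
     [F j] is eventually larger. *)
  - exfalso. apply Cmod_gt_0 in Hg0 as Hgp.
    destruct (ccont_nz g 0) as [d [Hd Hgd]]; [apply hol_ccont, Hg; rewrite Cmod_0; lra|auto|].
    set (x := Rmin (d / 2) (s / 4)). assert (Hx : 0 < x) by (apply Rmin_pos; lra).
    assert (X1 : x <= d / 2) by apply Rmin_l. assert (X2 : x <= s / 4) by apply Rmin_r. clearbody x.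
    set (c := x ^ m * (Cmod (g 0) / 2)).
    assert (Hcp : 0 < c) by (apply Rmult_lt_0_compat; [apply pow_lt; auto|lra]).
    assert (Hkc : forall y, Cmod y = x -> c <= Cmod (k y)).
    { intros y Hy. rewrite E, Cmod_mult, Cmod_pow, Hy. apply Rmult_le_compat_l; [apply pow_le; lra|].
      left. apply Hgd. replace (y - 0)%C with y by ring. lra. }
    destruct (Hu (c / 2) ltac:(lra)) as [N1 HN1].
    destruct (lim_infinite_nearby z (2 / c)) as [N2 [s3 [Hs3 Hb3]]]; auto.
    { apply Rmult_le_pos; [lra|left; now apply Rinv_0_lt_compat]. }
    set (j := (N0 + N1 + N2)%nat).
    destruct (Hb3 z) as [_ Hzj]. { replace (z - z)%C with (RtoC 0) by ring. now rewrite Cmod_0. }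
    specialize (Hzj j ltac:(lia)). revert Hzj. apply Rle_not_lt.
    apply (max_modulus (F j) (x + 1) x (2 / c) z z).
    + replace (z - z)%C with (RtoC 0) by ring. rewrite Cmod_0. lra.
    + lra.
    + apply entire_ball, HF.
    + intros u Hu'. specialize (Hkc _ Hu').
      assert (Hvk := HN1 j (u - z)%C ltac:(lia) ltac:(lra)).
      pose proof (Cmod_tri_minus (k (u - z))%C (v j (u - z)%C)%C 0) as T.
      replace (k (u - z)%C - 0)%C with (k (u - z)%C) in T by ring.
      replace (v j (u - z)%C - 0)%C with (v j (u - z)%C) in T by ring.
      rewrite (Cmod_minus_sym (k (u - z)%C)%C) in T.
      unfold v in Hvk, T. replace (u - z + z)%C with u in * by ring.
      destruct (Hbig u) as [_ Hb2]; [lra|]. specialize (Hb2 j ltac:(lia)).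
      rewrite (Cmod_inv (F j u)) in T by (apply Cmod_pos_nz; lra).
      assert (Hinv : c / 2 <= / Cmod (F j u)) by lra.
      apply (Rmult_le_compat_r (Cmod (F j u))) in Hinv; [|lra]. rewrite Rinv_l in Hinv by lra.
      apply (Rmult_le_reg_r (c / 2)); [lra|]. replace (2 / c * (c / 2)) with 1 by (field; lra). lra.
Qed.

(** Connectedness of the segment, by a supremum: being infinite is a closed condition by
    [lim_finite_nearby] and an open one by [lim_infinite_open]. *)
Lemma lim_infinite_segment (a e : C) : (forall t, 0 <= t <= 1 -> ~ In (a + RtoC t * e)%C Q) ->
  lim a = None -> lim (a + e)%C = None.
Proof.
  intros HQ Ha. set (gam := fun t => (a + RtoC t * e)%C).
  assert (Hgc : forall t d, 0 < d -> exists h, 0 < h /\ forall t', Rabs (t' - t) < h -> Cmod (gam t' - gam t)%C < d).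
  { intros t d Hd. exists (d / (Cmod e + 1)). pose proof (Cmod_ge_0 e) as E0.
    split; [apply Rdiv_lt_0_compat; lra|]. intros t' Ht. unfold gam.
    replace (a + RtoC t' * e - (a + RtoC t * e))%C with (RtoC (t' - t) * e)%C by (rewrite RtoC_minus; ring).
    rewrite Cmod_mult, Cmod_R. apply (Rmult_lt_compat_r (Cmod e + 1)) in Ht; [|lra].
    replace (d / (Cmod e + 1) * (Cmod e + 1)) with d in Ht by (field; lra).
    pose proof (Rabs_pos (t' - t)). nra. }
  set (T := fun t => 0 <= t <= 1 /\ forall t', 0 <= t' <= t -> lim (gam t') = None).
  destruct (completeness T) as [tau [Hub Hlub]].
  - exists 1. intros t [Ht _]. lra.
  - exists 0. split; [lra|]. intros t' Ht'. replace t' with 0 by lra. unfold gam.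
    replace (a + RtoC 0 * e)%C with a by ring. exact Ha.
  - assert (T0 : 0 <= tau).
    { apply Hub. split; [lra|]. intros t' Ht'. replace t' with 0 by lra. unfold gam.
      replace (a + RtoC 0 * e)%C with a by ring. exact Ha. }
    assert (T1 : tau <= 1) by (apply Hlub; intros t [Ht _]; lra).
    assert (Hbelow : forall t, 0 <= t < tau -> lim (gam t) = None).
    { intros t Ht. apply NNPP. intros Hn. assert (tau <= t); [|lra]. apply Hlub.
      intros t1 [Ht1 H1]. apply Rnot_lt_le. intros L. apply Hn. apply H1. lra. }
    assert (Htau : lim (gam tau) = None).
    { destruct (lim (gam tau)) as [w|] eqn:Ew; auto. exfalso.
      destruct (lim_finite_nearby (gam tau) w (HQ tau ltac:(lra)) Ew) as [B [N [s [Hs Hn]]]].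
      destruct (Hgc tau s Hs) as [h [Hh Hgh]].
      destruct (Req_dec tau 0) as [E|E].
      - rewrite E in Ew. unfold gam in Ew. replace (a + RtoC 0 * e)%C with a in Ew by ring. congruence.
      - set (t := Rmax 0 (tau - h / 2)).
        assert (Ht : 0 <= t < tau) by (unfold t; split; [apply Rmax_l|apply Rmax_lub_lt; lra]).
        destruct (Hn (gam t)) as [Hnn _].
        + apply Hgh. rewrite Rabs_left by lra. pose proof (Rmax_r 0 (tau - h / 2)). fold t in H. lra.
        + apply Hnn. apply Hbelow; auto. }
    destruct (Req_dec tau 1) as [E|E].
    + rewrite E in Htau. unfold gam in Htau. replace (a + RtoC 1 * e)%C with (a + e)%C in Htau by ring. exact Htau.
    + exfalso. destruct (lim_infinite_open (gam tau) (HQ tau ltac:(lra)) Htau) as [s [Hs Hn]].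
      destruct (Hgc tau s Hs) as [h [Hh Hgh]].
      set (t1 := Rmin 1 (tau + h / 2)).
      assert (Ht1 : tau < t1 <= 1) by (unfold t1; split; [apply Rmin_glb_lt; lra|apply Rmin_l]).
      assert (t1 <= tau + h / 2) by apply Rmin_r.
      assert (t1 <= tau); [|lra]. apply Hub. split; [lra|]. intros t' Ht'.
      destruct (Rlt_le_dec t' tau) as [L|L]; [apply Hbelow; lra|].
      apply Hn, Hgh. rewrite Rabs_right; lra.
Qed.

(** The plane without finitely many points is connected: for a high enough apex, both segments of
    the path miss [Q]. *)
Lemma lim_infinite_everywhere (z1 z : C) : ~ In z1 Q -> lim z1 = None -> ~ In z Q -> lim z = None.
Proof.
  intros H1 L1 H2. destruct (Ceq_dec z z1) as [->|Hne]; auto.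
  assert (He : (z - z1)%C <> 0) by (now apply Cminus_neq_0).
  destruct (segments_avoid Q z1 (z - z1)%C 1 He ltac:(lra) H1) as [M1 HM1].
  destruct (segments_avoid Q z (z1 - z)%C (-1)) as [M2 HM2]; auto; [|lra|].
  { apply Cminus_neq_0. auto. }
  set (n := (M1 + M2)%nat). set (v := ((z - z1) * half_plus_i (1 * INR n))%C).
  assert (Lw : lim (z1 + v)%C = None).
  { apply lim_infinite_segment; auto. intros t Ht. apply (HM1 n ltac:(lia) t Ht). }
  set (v' := ((z1 - z) * half_plus_i (-1 * INR n))%C).
  assert (Ev : (z1 + v)%C = (z + v')%C).
  { unfold v, v'. destruct z, z1. apply Ceq; simpl; field. }
  replace z with (z1 + v + - v')%C by (rewrite Ev; ring).
  apply lim_infinite_segment; auto. intros t Ht. rewrite Ev.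
  replace (z + v' + RtoC t * - v')%C with (z + RtoC (1 - t) * v')%C by (rewrite RtoC_minus; ring).
  apply (HM2 n ltac:(lia)). lra.
Qed.

Lemma lim_finite_circle (r : R) : (forall z, Cmod (z - 0)%C = r -> ~ In z Q) ->
  (forall z, Cmod (z - 0)%C = r -> lim z <> None) ->
  exists B N, forall k z, (N <= k)%nat -> Cmod z = r -> Cmod (F k z) <= B.
Proof.
  intros HQ Hlim. apply NNPP. intros Hn.
  assert (Hs : forall j, exists p : nat * C, (j <= fst p)%nat /\ Cmod (snd p - 0)%C = r /\ INR j < Cmod (F (fst p) (snd p))).
  { intros j. apply NNPP. intros Hj. apply Hn. exists (INR j), j. intros k z Hk Hz.
    apply Rnot_lt_le. intros L. apply Hj. exists (k, z). cbn [fst snd].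
    replace (z - 0)%C with z by ring. auto. }
  set (p := fun j => proj1_sig (constructive_indefinite_description _ (Hs j))).
  assert (Hp : forall j, (j <= fst (p j))%nat /\ Cmod (snd (p j) - 0)%C = r /\ INR j < Cmod (F (fst (p j)) (snd (p j)))).
  { intros j. apply (proj2_sig (constructive_indefinite_description _ (Hs j))). }
  destruct (circle_compact 0 r (fun j => snd (p j))) as [phi [z [H1 [H2 H3]]]]; [apply Hp|].
  destruct (lim z) as [w|] eqn:Ew; [|exact (Hlim z H2 Ew)].
  destruct (lim_finite_nearby z w (HQ z H2) Ew) as [B [N [s [Hs' Hb]]]].
  destruct (H3 s Hs') as [N1 HN1].
  destruct (nfloor_ex (Rabs B)) as [n [_ Hn']]; [apply Rabs_pos|].
  set (j := (N + N1 + S n)%nat). specialize (HN1 j ltac:(lia)).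
  destruct (Hb _ HN1) as [_ Hb']. pose proof (incr_ge phi H1 j).
  destruct (Hp (phi j)) as [P1 [_ P3]]. specialize (Hb' (fst (p (phi j))) ltac:(lia)).
  assert (Hj : (S n <= phi j)%nat) by lia. apply le_INR in Hj. rewrite S_INR in Hj.
  pose proof (Rle_abs B). lra.
Qed.

Lemma lim_infinite_uniform (K : C -> Prop) (B : R) : (forall z, ~ In z Q -> lim z = None) -> 0 <= B ->
  compact_C K -> (forall z, K z -> ~ In z Q) ->
  exists N, forall k z, (N <= k)%nat -> K z -> B < Cmod (F k z).
Proof.
  intros Hinf HB HK HKQ.
  destruct (Hcvg K HK (fun z Hz => conj I (HKQ z Hz)) (chord_eps B) (chord_eps_pos B)) as [N HN].
  exists N. intros k z Hk Hz. apply chordal_none; auto. rewrite <- (Hinf z (HKQ z Hz)). auto.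
Qed.
End SphericalLimits.

(** * Zeros and the choice of scale *)

(** Induction along [a 0 + z P]: this tends to infinity if [P] does or is a nonzero constant, and is
    constant if [P = 0]. *)
Lemma poly_eval_growth (n : nat) : forall a,
  (forall z, poly_eval n a z = poly_eval n a 0) \/
  (forall B, exists r0, forall z, r0 <= Cmod z -> B <= Cmod (poly_eval n a z)).
Proof.
  induction n as [|n IH]; intros a.
  - left. intros z. unfold poly_eval. simpl. ring.
  - destruct (IH (fun k => a (S k))) as [Hc|Hg].
    + set (c := poly_eval n (fun k => a (S k)) 0) in *. destruct (Ceq_dec c 0) as [E|E].
      * left. intros z. rewrite !poly_eval_S, !Hc, E. ring.
      * right. intros B. apply Cmod_gt_0 in E. exists ((Rabs B + Cmod (a O)) / Cmod c). intros z Hz.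
        rewrite poly_eval_S, Hc. apply (Rmult_le_compat_r (Cmod c)) in Hz; [|lra].
        replace ((Rabs B + Cmod (a O)) / Cmod c * Cmod c) with (Rabs B + Cmod (a O)) in Hz by (field; lra).
        rewrite <- Cmod_mult in Hz. pose proof (Rle_abs B).
        pose proof (Cmod_le_sub (a O + z * c) (a O)) as T1.
        pose proof (Cmod_tri_minus (a O + z * c) 0 (a O)) as T2.
        replace (a O + z * c - a O)%C with (z * c)%C in T2 by ring.
        replace (a O + z * c - 0)%C with (a O + z * c)%C in T2 by ring.
        replace (0 - a O)%C with (- a O)%C in T2 by ring. rewrite Cmod_opp in T2. lra.
    + right. intros B. destruct (Hg (Rabs B + Cmod (a O))) as [r0 Hr0].
      exists (Rmax r0 1). intros z Hz. pose proof (Rmax_l r0 1). pose proof (Rmax_r r0 1).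
      specialize (Hr0 z ltac:(lra)). rewrite poly_eval_S.
      set (P := poly_eval n (fun k => a (S k)) z) in *.
      pose proof (Cmod_tri_minus (a O + z * P) 0 (a O)) as T2.
      replace (a O + z * P - a O)%C with (z * P)%C in T2 by ring.
      replace (a O + z * P - 0)%C with (a O + z * P)%C in T2 by ring.
      replace (0 - a O)%C with (- a O)%C in T2 by ring. rewrite Cmod_opp, Cmod_mult in T2.
      pose proof (Rle_abs B). pose proof (Cmod_ge_0 (a O)). pose proof (Rabs_pos B). nra.
Qed.

Lemma list_Cmod_bound (l : list C) : exists A, 0 <= A /\ forall a, In a l -> Cmod a <= A.
Proof.
  induction l as [|b l [A [HA H]]].
  - exists 0. split; [lra|]. intros a [].
  - exists (A + Cmod b). pose proof (Cmod_ge_0 b). split; [lra|].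
    intros a [<-|Ha]; [lra|]. specialize (H a Ha). lra.
Qed.

Lemma lprod_bound2 (l : list C) (A : R) (z : C) : (forall a, In a l -> Cmod a <= A) -> A <= Cmod z ->
  Cmod (lprod l z) <= 2 ^ length l * Cmod z ^ length l.
Proof.
  intros H Hz. rewrite <- Rpow_mult_distr. apply lprod_le. intros a Ha. specialize (H a Ha).
  pose proof (Cmod_sub_le z a). lra.
Qed.

Section Zeros.
Variable f : C -> C.
Hypothesis Hf : entire' f.
Hypothesis Hnp : ~ polynomial_fun f.
Hypothesis Hcirc : forall B, exists r, B < r /\ forall z, Cmod z = r -> 1 <= Cmod (f z).

Lemma not_poly_eval (n : nat) (a : nat -> C) : ~ forall z, f z = poly_eval n a z.
Proof. intros H. apply Hnp. exists n, a. exact H. Qed.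

Lemma not_bounded_quotient (l : list C) (g : C -> C) (b : C) :
  (forall z, f z = (lprod l z * g z)%C) -> (forall z, g z = b) -> False.
Proof.
  intros E Hb. destruct (list_Cmod_bound l) as [A [HA HlA]].
  destruct (growth_poly (length l) f (Cmod b * 2 ^ length l)) as [a Ha]; auto.
  - apply Rmult_le_pos; [apply Cmod_ge_0|apply pow_le; lra].
  - intros B. exists (Rabs B + A + 1). pose proof (Rle_abs B). pose proof (Rabs_pos B). split; [lra|].
    intros z Hz. rewrite E, Hb, Cmod_mult.
    pose proof (lprod_bound2 l A z HlA ltac:(lra)) as L. rewrite Hz in L. pose proof (Cmod_ge_0 b).
    replace (Cmod b * 2 ^ length l * (Rabs B + A + 1) ^ length l) with
      ((2 ^ length l * (Rabs B + A + 1) ^ length l) * Cmod b) by ring.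
    apply Rmult_le_compat_r; auto.
  - exact (not_poly_eval _ _ Ha).
Qed.

(* A zero-free quotient would have a polynomial reciprocal. *)
Lemma quotient_has_zero (l : list C) (g : C -> C) : entire' g -> (forall z, f z = (lprod l z * g z)%C) ->
  exists a, g a = 0.
Proof.
  intros Hg E. apply NNPP. intros Hn.
  assert (Hg0 : forall z, g z <> 0) by (intros z Hz; apply Hn; now exists z).
  destruct (list_Cmod_bound l) as [A [HA HlA]].
  destruct (growth_poly (length l) (fun z => / g z)%C (2 ^ length l)) as [a Ha].
  - intros z. apply hol_inv; auto.
  - apply pow_le; lra.
  - intros B. destruct (Hcirc (Rmax B A)) as [r [Hr H1]]. exists r.
    pose proof (Rmax_l B A). pose proof (Rmax_r B A). split; [lra|]. intros z Hz.
    specialize (H1 z Hz). rewrite E, Cmod_mult in H1. rewrite Cmod_inv by auto.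
    pose proof (lprod_bound2 l A z HlA ltac:(lra)) as L. rewrite Hz in L.
    assert (0 < Cmod (g z)) by (apply Cmod_gt_0; auto).
    apply (Rmult_le_reg_r (Cmod (g z))); auto. rewrite Rinv_l by lra. nra.
  - destruct (poly_eval_growth (length l) a) as [Hc|Hgr].
    + apply (not_bounded_quotient l g (/ poly_eval (length l) a 0)%C E). intros z.
      rewrite <- (Hc z), <- Ha. field. auto.
    + destruct (growth_poly 0 g 1 Hg ltac:(lra)) as [b Hb].
      * intros B. destruct (Hgr 1) as [r0 Hr0]. exists (Rabs B + Rabs r0 + 1).
        pose proof (Rle_abs B). pose proof (Rabs_pos B). pose proof (Rle_abs r0). pose proof (Rabs_pos r0).
        split; [lra|]. intros z Hz. specialize (Hr0 z ltac:(lra)). rewrite <- Ha, Cmod_inv in Hr0 by auto.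
        simpl. assert (0 < Cmod (g z)) by (apply Cmod_gt_0; auto).
        apply (Rmult_le_compat_r (Cmod (g z))) in Hr0; [|lra]. rewrite Rinv_l in Hr0 by lra. lra.
      * apply (not_bounded_quotient l g (b O) E). intros z. rewrite Hb. unfold poly_eval. simpl. ring.
Qed.

Lemma zero_lists (d : nat) : exists l g, length l = d /\ entire' g /\ forall z, f z = (lprod l z * g z)%C.
Proof.
  induction d as [|d [l [g [Hl [Hg E]]]]].
  - exists nil, f. repeat split; auto. intros z. simpl. ring.
  - destruct (quotient_has_zero l g Hg E) as [a Ha]. destruct (factor_entire g a Hg Ha) as [k [Hk Ek]].
    exists (a :: l), k. split; [simpl; lia|]. split; auto. intros z. rewrite E, Ek. simpl. ring.
Qed.

Lemma lprod_zero (l : list C) (a : C) : In a l -> lprod l a = 0.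
Proof.
  induction l as [|b l IH]; [intros []|]. intros [->|H]; simpl.
  - replace (a - a)%C with (RtoC 0) by ring. ring.
  - rewrite IH by auto. ring.
Qed.

Lemma f_not_zero : ~ forall z, f z = 0.
Proof.
  intros H. apply (not_poly_eval 0 (fun _ => RtoC 0)). intros z. rewrite H. unfold poly_eval. simpl. ring.
Qed.

(** Any number of zeros can be divided out by [zero_lists]; if they all stayed in one disc,
    [many_zeros] would force [f = 0]. *)
Lemma large_zeros (r0 : R) : exists a, r0 < Cmod a /\ f a = 0.
Proof.
  apply NNPP. intros Hn. apply f_not_zero. intros z.
  apply (many_zeros f (Cmod z + 2 * Rabs r0 + 1) (Rabs r0)); auto; try apply Rabs_pos; [|lra].
  intros m. destruct (zero_lists m) as [l [g [Hl [Hg E]]]]. exists l, g. split; auto. split; auto.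
  intros a Ha. apply Rnot_lt_le. intros L. apply Hn. exists a. pose proof (Rle_abs r0). split; [lra|].
  rewrite E, lprod_zero by auto. ring.
Qed.

(** Zeros in the disc are divided out until none is left; if this never ended, [many_zeros] would
    apply. *)
Lemma zeros_in_disc (r : R) (h : C -> C) : entire' h -> ~ (forall z, h z = 0) ->
  exists l g, entire' g /\ (forall z, h z = (lprod l z * g z)%C) /\ (forall a, In a l -> Cmod a <= r) /\
    forall z, Cmod z <= r -> g z <> 0.
Proof.
  intros Hh Hnz. apply NNPP. intros Hn. apply Hnz. intros z.
  apply (many_zeros h (Cmod z + 2 * Rabs r + 1) (Rabs r)); auto; try apply Rabs_pos; [|lra].
  assert (H : forall m, exists l g, length l = m /\ (forall a, In a l -> Cmod a <= r) /\ entire' g /\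
    forall z, h z = (lprod l z * g z)%C).
  { induction m as [|m [l [g [Hl [Ha [Hg E]]]]]].
    - exists nil, h. split; auto. split; [intros a []|]. split; auto. intros w. simpl. ring.
    - assert (Hz : exists a, Cmod a <= r /\ g a = 0).
      { apply NNPP. intros Hn'. apply Hn. exists l, g. split; auto. split; auto. split; auto.
        intros w Hw E0. apply Hn'. now exists w. }
      destruct Hz as [a [Har Hga]]. destruct (factor_entire g a Hg Hga) as [k [Hk Ek]].
      exists (a :: l), k. split; [simpl; lia|]. split; [intros b [<-|Hb]; auto|]. split; auto.
      intros w. rewrite E, Ek. simpl. ring. }
  intros m. destruct (H m) as [l [g [Hl [Ha [Hg E]]]]]. exists l, g. split; auto. split; auto.
  intros a Hin. specialize (Ha a Hin). pose proof (Rle_abs r). lra.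
Qed.
End Zeros.

Section Rescaling.
Variable f : C -> C.
Hypothesis Hf : entire' f.
Hypothesis Hnp : ~ polynomial_fun f.
Hypothesis Hqn : quasi_normal (rescaled f) (fun _ : C => True).

Lemma rescaled_entire (n : {n : nat | (1 <= n)%nat}) : entire' (rescaled f n).
Proof.
  intros z. unfold rescaled. apply hol_div; [|apply hol_const|].
  - apply (hol_comp f); auto. apply hol_mult; [apply hol_const|apply hol_id].
  - destruct n as [n Hn]. simpl. apply Cmod_pos_nz. apply le_INR in Hn. simpl in Hn.
    rewrite Cmod_R, Rabs_right; lra.
Qed.

Lemma rescaled_Cmod (n : {n : nat | (1 <= n)%nat}) (z : C) :
  Cmod (f (RtoC (INR (proj1_sig n)) * z)%C)%C = Cmod (rescaled f n z) * INR (proj1_sig n).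
Proof.
  destruct n as [n Hn]. unfold rescaled. simpl. apply le_INR in Hn. simpl in Hn.
  assert (Nn : RtoC (INR n) <> 0) by (apply Cmod_pos_nz; rewrite Cmod_R, Rabs_right; lra).
  rewrite Cmod_div, Cmod_R, Rabs_right by (auto; lra). field. lra.
Qed.

(** The condition [k <= m k] drives the indices to infinity, so that finite limits on a circle would
    bound [f] linearly on arbitrarily large circles. A single infinite limit then spreads to the
    complement of [Q], and compactness makes the divergence uniform. *)
Lemma qn_infinite (m : nat -> {n : nat | (1 <= n)%nat}) : (forall k, (k <= proj1_sig (m k))%nat) ->
  exists (Q : list C) (phi : nat -> nat), (forall k, (phi k < phi (S k))%nat) /\
    forall (K : C -> Prop) (B : R), 0 <= B -> compact_C K -> (forall z, K z -> ~ In z Q) ->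
      exists N, forall k z, (N <= k)%nat -> K z -> B < Cmod (rescaled f (m (phi k)) z).
Proof.
  intros Hm. destruct (Hqn m) as [Q [phi [lim [Hphi Hc]]]]. exists Q, phi. split; auto.
  set (F := fun k => rescaled f (m (phi k))). assert (HF : forall k, entire' (F k)) by (intros; apply rescaled_entire).
  assert (Hinf : exists z1, ~ In z1 Q /\ lim z1 = None).
  { apply NNPP. intros Hn. destruct (circle_avoid Q (RtoC 0 :: nil) 0 1 ltac:(lra)) as [r [Hr Hq]].
    assert (HQr : forall z, Cmod (z - 0)%C = r -> ~ In z Q).
    { intros z Hz Hin. apply (Hq z Hin 0); auto. now left. }
    destruct (lim_finite_circle F Q lim HF Hc r HQr) as [B [N HB]].
    { intros z Hz E. apply Hn. exists z. auto. }
    assert (HB0 : 0 <= B).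
    { eapply Rle_trans; [apply Cmod_ge_0|]. apply (HB N (RtoC r)); auto. rewrite Cmod_R, Rabs_right; lra. }
    destruct (growth_poly 1 f (B / r) Hf) as [a Ha].
    - apply Rmult_le_pos; auto. left. apply Rinv_0_lt_compat. lra.
    - intros X. destruct (nfloor_ex (Rabs X / r)) as [x0 [_ Hx0]].
      { apply Rmult_le_pos; [apply Rabs_pos|]. left. apply Rinv_0_lt_compat. lra. }
      set (k := (N + S x0)%nat). pose proof (incr_ge phi Hphi k). pose proof (Hm (phi k)) as Hmk.
      set (n := proj1_sig (m (phi k))) in *.
      assert (Hn' : INR x0 + 1 <= INR n) by (rewrite <- S_INR; apply le_INR; lia).
      pose proof (pos_INR x0).
      exists (r * INR n). split.
      + apply (Rmult_lt_compat_r r) in Hx0; [|lra].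
        replace (Rabs X / r * r) with (Rabs X) in Hx0 by (field; lra). pose proof (Rle_abs X). nra.
      + intros z Hz. assert (Nn : RtoC (INR n) <> 0) by (apply Cmod_pos_nz; rewrite Cmod_R, Rabs_right; lra).
        replace z with (RtoC (INR n) * (z / RtoC (INR n)))%C by (field; auto).
        unfold n at 1. rewrite rescaled_Cmod. fold n.
        assert (Hz' : Cmod (z / RtoC (INR n))%C = r).
        { rewrite Cmod_div, Cmod_R, Rabs_right, Hz by (auto; lra). field. lra. }
        specialize (HB k _ ltac:(lia) Hz'). unfold F in HB.
        replace (B / r * (r * INR n) ^ 1) with (B * INR n) by (field; lra).
        apply Rmult_le_compat_r; [lra|]. exact HB.
    - exact (Hnp (ex_intro _ 1%nat (ex_intro _ a Ha))). }
  destruct Hinf as [z1 [Hz1 L1]].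
  intros K B HB HK HKQ. apply (lim_infinite_uniform F Q lim Hc K B); auto.
  intros z Hz. apply (lim_infinite_everywhere F Q lim HF Hc z1 z); auto.
Qed.

(** A first use of quasi-normality, along all integers. It gives the hypothesis [Hcirc] of the
    section on zeros; the large zeros found there supply the indices of the second use, in
    [good_scale]. *)
Lemma big_circles : forall B, exists r, B < r /\ forall z, Cmod z = r -> 1 <= Cmod (f z).
Proof.
  intros X.
  destruct (qn_infinite (fun k => exist _ (S k) (le_n_S 0 k (Nat.le_0_l k)))) as [Q [phi [Hphi H]]].
  { intros k. simpl. lia. }
  destruct (circle_avoid Q (RtoC 0 :: nil) 0 1 ltac:(lra)) as [r [Hr Hq]].
  destruct (H (fun z => Cmod (z - 0)%C = r) 1 ltac:(lra) (circle_compact 0 r)) as [N HN].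
  { intros z Hz Hin. apply (Hq z Hin 0); auto. now left. }
  destruct (nfloor_ex (Rabs X / r)) as [x0 [_ Hx0]].
  { apply Rmult_le_pos; [apply Rabs_pos|]. left. apply Rinv_0_lt_compat. lra. }
  set (k := (N + S x0)%nat). pose proof (incr_ge phi Hphi k).
  set (n := S (phi k)). assert (Hn' : INR x0 + 1 <= INR n) by (rewrite <- S_INR; apply le_INR; lia).
  pose proof (pos_INR x0).
  exists (r * INR n). split.
  - apply (Rmult_lt_compat_r r) in Hx0; [|lra].
    replace (Rabs X / r * r) with (Rabs X) in Hx0 by (field; lra). pose proof (Rle_abs X). nra.
  - intros z Hz. assert (Nn : RtoC (INR n) <> 0) by (apply Cmod_pos_nz; rewrite Cmod_R, Rabs_right; lra).
    replace z with (RtoC (INR n) * (z / RtoC (INR n)))%C by (field; auto).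
    set (nn := exist (fun n => (1 <= n)%nat) n (le_n_S 0 (phi k) (Nat.le_0_l (phi k)))).
    change (INR n) with (INR (proj1_sig nn)) at 1. rewrite rescaled_Cmod. simpl proj1_sig.
    assert (Hz' : Cmod (z / RtoC (INR n) - 0)%C = r).
    { replace (z / RtoC (INR n) - 0)%C with (z / RtoC (INR n))%C by ring.
      rewrite Cmod_div, Cmod_R, Rabs_right, Hz by (auto; lra). field. lra. }
    specialize (HN k _ ltac:(lia) Hz').
    apply Rle_trans with (1 * INR n); [lra|]. apply Rmult_le_compat_r; [lra|]. left. exact HN.
Qed.

(* The rescaling factors follow the moduli of zeros, which keeps a zero at distance about 1 from the cluster at the origin. *)
Lemma good_scale (A : R) (d : nat) : 1 <= A -> exists (c : C) (r : R) (l : list C) (g : C -> C),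
  0 < r /\ c <> 0 /\ 30 * A * r <= Cmod c /\
  (forall z, Cmod z = r -> 10 * A * Cmod c <= Cmod (f z)) /\
  (forall z, Cmod (z - c)%C = r -> 10 * A * Cmod c <= Cmod (f z)) /\
  (exists a, Cmod (a - c)%C < r /\ f a = 0) /\
  entire' g /\ (forall z, f z = (lprod l z * g z)%C) /\ (d <= length l)%nat /\
  (forall a, In a l -> Cmod a < r) /\ forall z, Cmod z <= r -> g z <> 0.
Proof.
  intros HA.
  assert (Hs : forall k : nat, exists p : C * nat, f (fst p) = 0 /\ (S k <= snd p)%nat /\
    INR (snd p) <= Cmod (fst p) < INR (snd p) + 1).
  { intros k. destruct (large_zeros f Hf Hnp big_circles (INR (S k))) as [a [Ha Hfa]].
    destruct (nfloor_ex (Cmod a)) as [n [Hn1 Hn2]]; [apply Cmod_ge_0|].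
    exists (a, n). cbn [fst snd]. split; auto. split; auto.
    assert (Hlt : INR (S k) < INR (S n)) by (rewrite (S_INR n); lra). apply INR_lt in Hlt. lia. }
  set (p := fun k => proj1_sig (constructive_indefinite_description _ (Hs k))).
  assert (Hp : forall k, f (fst (p k)) = 0 /\ (S k <= snd (p k))%nat /\
    INR (snd (p k)) <= Cmod (fst (p k)) < INR (snd (p k)) + 1).
  { intros k. apply (proj2_sig (constructive_indefinite_description _ (Hs k))). }
  assert (Hp1 : forall k, (1 <= snd (p k))%nat) by (intros k; destruct (Hp k) as [_ [H _]]; lia).
  assert (HpR : forall k, 1 <= INR (snd (p k))) by (intros k; apply (le_INR 1), Hp1).
  set (m := fun k => exist (fun n => (1 <= n)%nat) (snd (p k)) (Hp1 k)).
  destruct (qn_infinite m) as [Q [phi [Hphi HQ]]].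
  { intros k. simpl. destruct (Hp k) as [_ [H _]]. lia. }
  (* Zeros divided by the integer part of their modulus lie in [1 <= |b| <= 2], so they accumulate
     at a point [cs] away from 0. *)
  set (b := fun k => (fst (p k) / RtoC (INR (snd (p k))))%C).
  assert (Nn : forall k, RtoC (INR (snd (p k))) <> 0).
  { intros k. specialize (HpR k). apply Cmod_pos_nz. rewrite Cmod_R, Rabs_right; lra. }
  assert (Hb : forall k, 1 <= Cmod (b k) <= 2).
  { intros k. destruct (Hp k) as [_ [_ H]]. specialize (HpR k). unfold b.
    rewrite Cmod_div, Cmod_R, Rabs_right by (auto; lra).
    split; apply (Rmult_le_reg_r (INR (snd (p k)))); try lra;
    replace (Cmod (fst (p k)) / INR (snd (p k)) * INR (snd (p k))) with (Cmod (fst (p k))) by (field; lra); lra. }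
  destruct (BW_C (fun k => b (phi k)) 2) as [psi [cs [Hpsi Hlim]]]; [intros k; apply Hb|].
  assert (Hcs : 1 <= Cmod cs <= 2).
  { split; (replace cs with (cs - 0)%C by ring).
    - apply (seq_lim_Cmod_ge (fun k => b (phi (psi k)))); [exact Hlim|].
      intros k. replace (b (phi (psi k)) - 0)%C with (b (phi (psi k))) by ring. apply Hb.
    - apply (seq_lim_Cmod_le (fun k => b (phi (psi k)))); [exact Hlim|].
      intros k. replace (b (phi (psi k)) - 0)%C with (b (phi (psi k))) by ring. apply Hb. }
  destruct (circle_avoid Q (RtoC 0 :: cs :: nil) 0 (/ (30 * A))) as [eta [Heta Hav]].
  { apply Rinv_0_lt_compat. lra. }
  assert (HetaA : 30 * A * eta <= 1).
  { destruct Heta as [_ H]. apply (Rmult_lt_compat_l (30 * A)) in H; [|lra]. rewrite Rinv_r in H by lra. lra. }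
  (* The bound [20 A] on the rescaled circles becomes [10 A |c|] at scale [n], since [c = n cs] and
     [|cs| <= 2]. *)
  destruct (HQ (fun z => Cmod (z - 0)%C = eta) (20 * A) ltac:(lra) (circle_compact 0 eta)) as [N0 HN0].
  { intros z Hz Hin. apply (Hav z Hin 0); auto. now left. }
  destruct (HQ (fun z => Cmod (z - cs)%C = eta) (20 * A) ltac:(lra) (circle_compact cs eta)) as [N1 HN1].
  { intros z Hz Hin. apply (Hav z Hin cs); auto. right; now left. }
  (* These [d] zeros are fixed before the scale; the inequality [X / eta < n] brings them all into
     the disc of radius [eta n]. *)
  destruct (zero_lists f Hf Hnp big_circles d) as [ld [gd [Hld [Hgd Ed]]]].
  destruct (list_Cmod_bound ld) as [X [HX HlX]].
  destruct (nfloor_ex (X / eta)) as [x0 [_ Hx0]].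
  { apply Rmult_le_pos; auto. left. apply Rinv_0_lt_compat. lra. }
  destruct (Hlim eta ltac:(lra)) as [N2 HN2].
  set (j := (N0 + N1 + N2 + x0)%nat). set (k := phi (psi j)). set (n := snd (p k)).
  pose proof (incr_ge psi Hpsi j) as Hj1. pose proof (incr_ge phi Hphi (psi j)) as Hj2.
  assert (Hnx : INR x0 + 1 <= INR n).
  { rewrite <- S_INR. apply le_INR. unfold n. destruct (Hp k) as [_ [H _]]. unfold k, j in *. lia. }
  assert (Hn1 : 1 <= INR n) by apply HpR.
  assert (NnC : RtoC (INR n) <> 0) by apply Nn.
  specialize (HN2 j ltac:(unfold j; lia)). fold k in HN2.
  assert (Hcirc : forall q, Cmod q <= 2 -> (forall z, Cmod (z - q)%C = eta -> 20 * A < Cmod (rescaled f (m k) z)) ->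
    forall z, Cmod (z - RtoC (INR n) * q)%C = eta * INR n -> 20 * A * INR n <= Cmod (f z)).
  { intros q _ Hq z Hz. replace z with (RtoC (INR n) * (z / RtoC (INR n)))%C by (field; auto).
    change n with (proj1_sig (m k)) at 2. rewrite rescaled_Cmod. simpl proj1_sig. fold n.
    assert (Hz' : Cmod (z / RtoC (INR n) - q)%C = eta).
    { replace (z / RtoC (INR n) - q)%C with ((z - RtoC (INR n) * q) / RtoC (INR n))%C by (field; auto).
      rewrite Cmod_div, Cmod_R, Rabs_right, Hz by (auto; lra). field. lra. }
    specialize (Hq _ Hz'). apply Rmult_le_compat_r; lra. }
  assert (C0 := Hcirc 0 ltac:(rewrite Cmod_0; lra) (fun z Hz => HN0 (psi j) z ltac:(unfold j in *; lia) Hz)).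
  assert (C1 := Hcirc cs ltac:(lra) (fun z Hz => HN1 (psi j) z ltac:(unfold j in *; lia) Hz)).
  assert (C0' : forall z, Cmod z = eta * INR n -> 20 * A * INR n <= Cmod (f z)).
  { intros z Hz. apply C0. replace (z - RtoC (INR n) * 0)%C with z by ring. exact Hz. }
  set (c := (RtoC (INR n) * cs)%C).
  assert (Hcm : Cmod c = INR n * Cmod cs).
  { unfold c. rewrite Cmod_mult, Cmod_R, Rabs_right; lra. }
  assert (Hr : 0 < eta * INR n) by (apply Rmult_lt_0_compat; lra).
  assert (Hc20 : 10 * A * Cmod c <= 20 * A * INR n) by (rewrite Hcm; pose proof (Rmult_le_compat_l (10 * A * INR n) (Cmod cs) 2 ltac:(apply Rmult_le_pos; lra) ltac:(lra)); lra).
  assert (Hgnz : ~ forall z, gd z = 0).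
  { intros H. apply (f_not_zero f Hnp). intros z. rewrite Ed, H. ring. }
  (* The remaining zeros in the disc are divided out as well, so that the cofactor has winding
     number 0 on the circle. *)
  destruct (zeros_in_disc (eta * INR n) gd Hgd Hgnz) as [l' [g [Hg [Eg [Hl' Hgnz']]]]].
  assert (Ef : forall z, f z = (lprod (ld ++ l') z * g z)%C).
  { intros z. rewrite Ed, Eg, lprod_app. ring. }
  exists c, (eta * INR n), (ld ++ l'), g. split; [exact Hr|]. split.
  { apply Cmod_pos_nz. rewrite Hcm. apply Rmult_lt_0_compat; lra. }
  split. { rewrite Hcm, <- Rmult_assoc, (Rmult_comm (INR n)). apply Rmult_le_compat_r; lra. }
  split. { intros z Hz. specialize (C0' z Hz). lra. }
  split. { intros z Hz. specialize (C1 z Hz). lra. }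
  split.
  { exists (fst (p k)). split; [|apply Hp].
    replace (fst (p k) - c)%C with (RtoC (INR n) * (b k - cs))%C by (unfold b, c; fold n; field; auto).
    rewrite Cmod_mult, Cmod_R, Rabs_right by lra. rewrite Rmult_comm. apply Rmult_lt_compat_r; lra. }
  split; [exact Hg|]. split; [exact Ef|]. split; [rewrite length_app; lia|]. split; [|exact Hgnz'].
  intros a Ha. apply in_app_or in Ha. destruct Ha as [Ha|Ha].
  - eapply Rle_lt_trans; [apply HlX; auto|].
    apply (Rmult_lt_compat_l eta) in Hx0; [|lra].
    replace (eta * (X / eta)) with X in Hx0 by (field; lra). nra.
  - destruct (Hl' a Ha) as [L|E]; auto. exfalso. specialize (C0' a E).
    rewrite Ef, lprod_zero in C0' by (apply in_or_app; now right).
    rewrite Cmult_0_l, Cmod_0 in C0'. nra.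
Qed.
End Rescaling.

(** * Lifts of the argument *)

(** The winding number is read off a continuous argument on all of [R] that gains [2 PI d] per
    period. This avoids fixing a cut on the circle before [disc_pieces] chooses one. *)
Definition haslift (u : R -> C) (d : nat) : Prop := exists phi : R -> R,
  (forall t, continuity_pt phi t) /\ (forall t, u t = (RtoC (Cmod (u t)) * cis (phi t))%C) /\
  forall t, phi (t + 2 * PI) = phi t + 2 * PI * INR d.

Lemma haslift_ext (u v : R -> C) (d : nat) : (forall t, u t = v t) -> haslift u d -> haslift v d.
Proof. intros H [p [H1 [H2 H3]]]. exists p. repeat split; auto. intros t. now rewrite <- H. Qed.

Lemma haslift_mult (u v : R -> C) (d e : nat) : haslift u d -> haslift v e ->
  haslift (fun t => u t * v t)%C (d + e).
Proof.
  intros [p [H1 [H2 H3]]] [q [K1 [K2 K3]]]. exists (fun t => p t + q t). split; [|split].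
  - intros t. apply continuity_pt_plus; auto.
  - intros t. rewrite Cmod_mult, RtoC_mult, cis_plus. rewrite H2 at 1. rewrite K2 at 1. ring.
  - intros t. rewrite H3, K3, plus_INR. ring.
Qed.

Lemma haslift_const (c : C) : haslift (fun _ => c) 0.
Proof.
  destruct (Ceq_dec c 0) as [->|Hc].
  - exists (fun _ => 0). split; [|split].
    + intros t. apply continuity_pt_const. intros ? ?; reflexivity.
    + intros t. rewrite Cmod_0. ring.
    + intros t. simpl. ring.
  - destruct (Cpolar c Hc) as [s Hs]. exists (fun _ => s). split; [|split]; auto.
    + intros t. apply continuity_pt_const. intros ? ?; reflexivity.
    + intros t. simpl. ring.
Qed.

Lemma cis_period (t : R) : cis (t + 2 * PI) = cis t.
Proof.
  unfold cis. replace (t + 2 * PI) with (t + 2 * INR 1 * PI) by (simpl; ring).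
  now rewrite cos_period, sin_period.
Qed.

Lemma haslift_pos (u : R -> C) : (forall t, rcont u t) -> (forall t, u (t + 2 * PI) = u t) ->
  (forall t, 0 < Re (u t)) -> haslift u 0.
Proof.
  intros Hc Hp Hr. exists (fun t => atan (Im (u t) / Re (u t))). split; [|split].
  - intros t. apply (continuity_pt_comp (fun t => Im (u t) / Re (u t)) atan).
    + apply continuity_pt_div.
      * apply continuity_pt_filterlim. now apply rcont_Im.
      * apply continuity_pt_filterlim. now apply rcont_Re.
      * specialize (Hr t). lra.
    + apply derivable_continuous_pt. eexists. apply derivable_pt_lim_atan.
  - intros t. specialize (Hr t). set (x := Re (u t)) in *. set (y := Im (u t)) in *.
    unfold cis. rewrite cos_atan, sin_atan.
    assert (E : Cmod (u t) = x * sqrt (1 + (y / x)²)).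
    { rewrite <- (sqrt_Rsqr x) at 1 by lra. rewrite <- sqrt_mult_alt by apply Rle_0_sqr.
      unfold Cmod. f_equal. fold (Re (u t)) (Im (u t)). fold x y. unfold Rsqr. field. lra. }
    rewrite E. assert (0 < sqrt (1 + (y / x)²)).
    { apply sqrt_lt_R0. pose proof (Rle_0_sqr (y / x)). lra. }
    apply Ceq; simpl; fold x y; field; lra.
  - intros t. rewrite Hp. simpl. ring.
Qed.

(** Write [z - a = z (1 - a / z)]: for [|z| = r] the second factor lies in the right half-plane, so
    all of the winding comes from [z]. *)
Lemma haslift_linear (a : C) (r : R) : Cmod a < r -> haslift (fun t => RtoC r * cis t - a)%C 1.
Proof.
  intros Ha. pose proof (Cmod_ge_0 a) as Ha0.
  assert (H1 : haslift (fun t => RtoC r * cis t)%C 1).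
  { exists (fun t => t). split; [|split].
    - intros t. apply derivable_continuous_pt. apply derivable_pt_id.
    - intros t. now rewrite Cmod_rcis by lra.
    - intros t. simpl. ring. }
  assert (H2 : haslift (fun t => 1 - a / (RtoC r * cis t))%C 0).
  { assert (Hn : forall t, (RtoC r * cis t)%C <> 0).
    { intros t. apply Cmod_pos_nz. rewrite Cmod_rcis; lra. }
    apply haslift_pos.
    - intros t. apply (rcont_comp (fun w => 1 - a / (RtoC r * w))%C cis); [apply cis_rcont|].
      apply ccont_minus; [apply ccont_const|]. apply ccont_div; [apply ccont_const| |apply Hn].
      apply ccont_mult; [apply ccont_const|apply ccont_id].
    - intros t. now rewrite cis_period.
    - intros t. assert (Hq : Cmod (a / (RtoC r * cis t))%C < 1).
      { rewrite Cmod_div, Cmod_rcis by (auto; lra).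
        apply (Rmult_lt_reg_r r); [lra|]. replace (Cmod a / r * r) with (Cmod a) by (field; lra). lra. }
      pose proof (re_le_Cmod (a / (RtoC r * cis t))) as Hre.
      set (q := (a / (RtoC r * cis t))%C) in *.
      change (Re (1 - q)%C) with (1 - Re q). pose proof (Rle_abs (Re q)). lra. }
  apply (haslift_ext (fun t => RtoC r * cis t * (1 - a / (RtoC r * cis t)))%C).
  - intros t.
    assert (Z : cis t <> 0) by (apply Cmod_pos_nz; rewrite Cmod_cis; lra).
    assert (X : RtoC r <> 0) by (apply Cmod_pos_nz; rewrite Cmod_R, Rabs_right; lra).
    field. auto.
  - exact (haslift_mult _ _ 1 0 H1 H2).
Qed.

Lemma haslift_lprod (l : list C) (r : R) : (forall a, In a l -> Cmod a < r) ->
  haslift (fun t => lprod l (RtoC r * cis t)%C) (length l).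
Proof.
  induction l as [|a l IH]; intros H; simpl.
  - apply haslift_const.
  - apply (haslift_mult _ _ 1 (length l)).
    + apply haslift_linear. apply H. now left.
    + apply IH. intros b Hb. apply H. now right.
Qed.

(* Continuous deformation of the circle to its centre. *)
Lemma haslift_nonvanishing (k : C -> C) (r : R) : 0 < r -> (forall z, ccont k z) ->
  (forall z, Cmod z <= r -> k z <> 0) -> haslift (fun t => k (RtoC r * cis t)%C) 0.
Proof.
  intros Hr Hk Hnz.
  destruct (compact_argmin (fun z => Cmod (z - 0)%C <= r) k 0 (disc_compact 0 r)) as [p [Hp Hmin]].
  { replace (0 - 0)%C with (RtoC 0) by ring. rewrite Cmod_0. lra. }
  { auto. }
  set (c := Cmod (k p)). assert (Hc : 0 < c).
  { apply Cmod_gt_0, Hnz. now replace (p - 0)%C with p in Hp by ring. }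
  assert (Hge : forall z, Cmod z <= r -> c <= Cmod (k z)).
  { intros z Hz. apply Hmin. now replace (z - 0)%C with z by ring. }
  destruct (unif_ccont (fun z => Cmod (z - 0)%C <= r) k (disc_compact 0 r)) with (eps := c)
    as [d [Hd U]]; auto.
  destruct (inv_S_small (d / r)) as [N0 HN0]. { apply Rdiv_lt_0_compat; auto. }
  set (N := INR (S N0)). assert (HN : 0 < N) by (apply lt_0_INR; lia).
  assert (HrN : r / N < d).
  { specialize (HN0 N0 (le_n _)). fold N in HN0. apply (Rmult_lt_compat_l r) in HN0; auto.
    replace (r * (d / r)) with d in HN0 by (field; lra). exact HN0. }
  (* The radii grow in steps shorter than [d], so the quotient of the values on consecutive circles
     is within 1 of 1, in the right half-plane. *)
  set (s := fun j : nat => r * (INR j / N)).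
  assert (Hs : forall j, (j <= S N0)%nat -> 0 <= s j <= r).
  { intros j Hj. apply le_INR in Hj. fold N in Hj. pose proof (pos_INR j).
    assert (E : INR j / N * N = INR j) by (field; lra). unfold s.
    assert (0 <= INR j / N) by (apply Rmult_le_pos; [lra|left; now apply Rinv_0_lt_compat]).
    assert (INR j / N <= 1) by (apply (Rmult_le_reg_r N); lra). nra. }
  assert (Hrc : forall j t, rcont (fun t => k (RtoC (s j) * cis t)%C) t).
  { intros j t. apply (rcont_comp (fun w => k (RtoC (s j) * w)%C) cis); [apply cis_rcont|].
    apply ccont_comp; [|apply Hk]. apply ccont_mult; [apply ccont_const|apply ccont_id]. }
  assert (Hall : forall j, (j <= S N0)%nat -> haslift (fun t => k (RtoC (s j) * cis t)%C) 0).
  { induction j as [|j IH]; intros Hj.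
    - apply (haslift_ext (fun _ => k 0)); [|apply haslift_const].
      intros t. f_equal. unfold s. simpl. unfold Rdiv. rewrite Rmult_0_l, Rmult_0_r. ring.
    - assert (Hz : forall t, Cmod (RtoC (s j) * cis t)%C <= r).
      { intros t. rewrite Cmod_rcis; apply Hs; lia. }
      assert (Hkn : forall t, k (RtoC (s j) * cis t)%C <> 0) by (intros t; apply Hnz, Hz).
      apply (haslift_ext (fun t => k (RtoC (s j) * cis t) *
        (k (RtoC (s (S j)) * cis t) / k (RtoC (s j) * cis t)))%C).
      + intros t. field. auto.
      + apply (haslift_mult _ _ 0 0); [apply IH; lia|]. apply haslift_pos.
        * intros t eps He.
          assert (c1 : ccont (fun w => k (RtoC (s (S j)) * w) / k (RtoC (s j) * w))%C (cis t)).
          { apply ccont_div; [| |apply Hkn].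
            - apply (ccont_comp k (fun w => RtoC (s (S j)) * w)%C); [|apply Hk].
              apply ccont_mult; [apply ccont_const|apply ccont_id].
            - apply (ccont_comp k (fun w => RtoC (s j) * w)%C); [|apply Hk].
              apply ccont_mult; [apply ccont_const|apply ccont_id]. }
          exact (rcont_comp _ cis t (cis_rcont t) c1 eps He).
        * intros t. now rewrite cis_period.
        * intros t. set (A := k (RtoC (s (S j)) * cis t)%C). set (B := k (RtoC (s j) * cis t)%C).
          assert (HB : B <> 0) by apply Hkn. apply Cmod_gt_0 in HB as HBp.
          assert (HAB : Cmod (A - B)%C < c).
          { apply U.
            - replace (RtoC (s j) * cis t - 0)%C with (RtoC (s j) * cis t)%C by ring. apply Hz.
            - replace (RtoC (s (S j)) * cis t - RtoC (s j) * cis t)%C with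
                (RtoC (s (S j) - s j) * cis t)%C by (rewrite RtoC_minus; ring).
              replace (s (S j) - s j) with (r / N) by (unfold s; rewrite S_INR; field; lra).
              rewrite Cmod_rcis; auto. left. now apply Rdiv_lt_0_compat. }
          assert (Hq : Cmod (A / B - 1) < 1).
          { replace (A / B - 1)%C with ((A - B) / B)%C by (field; auto). rewrite Cmod_div by auto.
            apply (Rmult_lt_reg_r (Cmod B)); auto.
            replace (Cmod (A - B) / Cmod B * Cmod B) with (Cmod (A - B)) by (field; lra).
            specialize (Hge (RtoC (s j) * cis t)%C (Hz t)). fold B in Hge. lra. }
          pose proof (re_le_Cmod (A / B - 1)) as Hre.
          set (q := (A / B)%C) in *. change (Re (q - 1)%C) with (Re q - 1) in Hre.
          assert (Rabs (Re q - 1) < 1) by lra. apply Rabs_def2 in H. lra. }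
  apply (haslift_ext (fun t => k (RtoC (s (S N0)) * cis t)%C)); [|apply Hall; lia].
  intros t. do 3 f_equal. unfold s. fold N. field. lra.
Qed.

(** * Crossings of lattice paths *)

Open Scope Z_scope. Open Scope bool_scope.

Fixpoint zsum (f : nat -> Z) (n : nat) : Z :=
  match n with O => 0 | S k => zsum f k + f k end.

Lemma zsum_ext (f g : nat -> Z) (n : nat) :
  (forall k, (k < n)%nat -> f k = g k) -> zsum f n = zsum g n.
Proof.
  induction n as [|n IH]; intros H; simpl; auto. rewrite IH, (H n); auto.
Qed.

Lemma zsum_0 (f : nat -> Z) (n : nat) : (forall k, (k < n)%nat -> f k = 0) -> zsum f n = 0.
Proof.
  induction n as [|n IH]; intros H; simpl; auto. rewrite IH, (H n); auto.
Qed.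

Lemma zsum_telescope (f E : nat -> Z) (n : nat) :
  (forall k, (k < n)%nat -> f k = E (S k) - E k) -> zsum f n = E n - E O.
Proof.
  induction n as [|n IH]; intros H; simpl; [lia|]. rewrite IH, (H n); auto. lia.
Qed.

(** [h] and [v] are values on the horizontal and vertical edges of a grid, [q] the boundary sums of
    unit squares; inner edges cancel. It serves both for crossing paths and for crossings counted
    with colours. *)
Lemma discrete_stokes (h v q : nat -> nat -> Z) (a b : nat) :
  (forall s t, (s < a)%nat -> (t < b)%nat -> h s t + v (S s) t - h s (S t) - v s t = q s t) ->
  zsum (fun s => h s O) a + zsum (fun t => v a t) b - zsum (fun s => h s b) a
    - zsum (fun t => v O t) b = zsum (fun s => zsum (fun t => q s t) b) a.
Proof.
  induction a as [|a IH]; intros H; simpl; [lia|].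
  assert (Hcol : h a O + zsum (fun t => v (S a) t) b - h a b - zsum (fun t => v a t) b
    = zsum (fun t => q a t) b).
  { assert (Hs : forall t, (t < b)%nat -> h a t + v (S a) t - h a (S t) - v a t = q a t)
      by (intros; apply H; lia).
    clear H IH. induction b as [|b IHb]; simpl; [lia|].
    rewrite <- IHb by (intros; apply Hs; lia). specialize (Hs b (Nat.lt_succ_diag_r b)). lia. }
  assert (Hs : forall s t, (s < a)%nat -> (t < b)%nat ->
    h s t + v (S s) t - h s (S t) - v s t = q s t) by (intros; apply H; lia).
  specialize (IH Hs). lia.
Qed.

Definition vtx : Set := (Z * Z)%type.

(* Edges of the triangular lattice obtained by cutting each unit square along its main diagonal. *)
Definition adj (p q : vtx) : Prop :=
  -1 <= fst q - fst p <= 1 /\ -1 <= snd q - snd p <= 1 /\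
  -1 <= (fst q - fst p) - (snd q - snd p) <= 1.

Lemma adj_sym (p q : vtx) : adj p q -> adj q p.
Proof. unfold adj. lia. Qed.

Lemma vtx_eq (p q : vtx) : fst p = fst q -> snd p = snd q -> p = q.
Proof. destruct p, q; simpl; intros; subst; auto. Qed.

(* Signed crossings of the positive horizontal axis; their sum along a closed lattice curve avoiding the origin is its winding number. *)
Definition kap (x y x' y' : Z) : Z :=
  if (y =? -1) && (y' =? 0) && (0 <? x') then 1
  else if (y =? 0) && (y' =? -1) && (0 <? x) then -1 else 0.

Ltac if_lia := repeat (match goal with |- context [if ?b then _ else _] =>
  let E := fresh in destruct b eqn:E end); lia.

Lemma kap_upper (x y x' y' : Z) : 0 <= y -> 0 <= y' -> kap x y x' y' = 0.
Proof. unfold kap. intros. if_lia. Qed.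

Lemma kap_neg (x y x' y' : Z) : y < 0 -> y' < 0 -> kap x y x' y' = 0.
Proof. unfold kap. intros. if_lia. Qed.

Lemma kap_lower (x y x' y' : Z) : y <= 0 -> y' <= 0 -> (x <> 0 \/ y <> 0) ->
  (x' <> 0 \/ y' <> 0) -> -1 <= x' - x <= 1 -> -1 <= y' - y <= 1 ->
  kap x y x' y' = (if (y' =? 0) && (0 <? x') then 1 else 0) - (if (y =? 0) && (0 <? x) then 1 else 0).
Proof. unfold kap. intros. if_lia. Qed.

(** Two steps of the triangular lattice span a parallelogram of area at most 1, which contains no
    lattice point besides its vertices. If these miss the origin, the boundary does not wind around
    it. With both diagonals as edges, the steps [(1, 1)] and [(1, -1)] would violate this. *)
Lemma kap_square (x y dx dy ex ey : Z) :
  -1 <= dx <= 1 -> -1 <= dy <= 1 -> -1 <= dx - dy <= 1 ->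
  -1 <= ex <= 1 -> -1 <= ey <= 1 -> -1 <= ex - ey <= 1 ->
  (x <> 0 \/ y <> 0) -> (x + dx <> 0 \/ y + dy <> 0) ->
  (x + ex <> 0 \/ y + ey <> 0) -> (x + dx + ex <> 0 \/ y + dy + ey <> 0) ->
  kap x y (x + dx) (y + dy) + kap (x + dx) (y + dy) (x + dx + ex) (y + dy + ey)
  - kap (x + ex) (y + ey) (x + dx + ex) (y + dy + ey) - kap x y (x + ex) (y + ey) = 0.
Proof.
  intros H1 H2 H3 H4 H5 H6 N1 N2 N3 N4.
  destruct (Z_lt_le_dec y (-2)) as [L|L]. { rewrite !kap_neg by lia. lia. }
  destruct (Z_lt_le_dec 1 y) as [L'|L']. { rewrite !kap_upper by lia. lia. }
  assert (Hdx : dx = -1 \/ dx = 0 \/ dx = 1) by lia.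
  assert (Hdy : dy = -1 \/ dy = 0 \/ dy = 1) by lia.
  assert (Hex : ex = -1 \/ ex = 0 \/ ex = 1) by lia.
  assert (Hey : ey = -1 \/ ey = 0 \/ ey = 1) by lia.
  assert (Hy : y = -2 \/ y = -1 \/ y = 0 \/ y = 1) by lia. clear H1 H2 H4 H5 L L'.
  destruct Hdx as [->|[->| ->]], Hdy as [->|[->| ->]]; try (exfalso; lia);
  destruct Hex as [->|[->| ->]], Hey as [->|[->| ->]]; try (exfalso; lia);
  destruct Hy as [->|[->|[->| ->]]]; unfold kap; simpl; if_lia.
Qed.

(** If the paths did not meet, [X s - Y t] would map the parameter rectangle to the lattice without
    the origin, and its boundary would have winding number 0. Two of its sides stay in the upper
    half-plane and contribute nothing; on the other two the count telescopes, and the order of the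
    end points makes it -1. *)
Lemma crossing (X Y : nat -> vtx) (a b : nat) :
  (forall s, (s < a)%nat -> adj (X s) (X (S s))) ->
  (forall t, (t < b)%nat -> adj (Y t) (Y (S t))) ->
  (forall s t, (s <= a)%nat -> (t <= b)%nat -> X s <> Y t) ->
  (forall s, 0 <= snd (X s)) -> (forall t, 0 <= snd (Y t)) ->
  snd (X O) = 0 -> snd (X a) = 0 -> snd (Y O) = 0 -> snd (Y b) = 0 ->
  fst (X O) < fst (Y O) -> fst (Y O) < fst (X a) -> fst (X a) < fst (Y b) -> False.
Proof.
  intros HX HY Hne PX PY X0 Xa Y0 Yb L1 L2 L3.
  set (hx := fun s t => fst (X s) - fst (Y t)). set (hy := fun s t => snd (X s) - snd (Y t)).
  assert (Hnz : forall s t, (s <= a)%nat -> (t <= b)%nat -> hx s t <> 0 \/ hy s t <> 0).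
  { intros s t Hs Ht. destruct (Z.eq_dec (hx s t) 0) as [E|]; auto.
    destruct (Z.eq_dec (hy s t) 0) as [E'|]; auto. exfalso. apply (Hne s t); auto.
    apply vtx_eq; unfold hx, hy in *; lia. }
  assert (H := discrete_stokes
    (fun s t => kap (hx s t) (hy s t) (hx (S s) t) (hy (S s) t))
    (fun s t => kap (hx s t) (hy s t) (hx s (S t)) (hy s (S t))) (fun _ _ => 0) a b).
  cbv beta in H. rewrite (zsum_0 (fun s => zsum _ b)) in H by (intros; now apply zsum_0).
  rewrite (zsum_0 (fun s => kap (hx s O) _ _ _)) in H.
  2:{ intros s Hs. apply kap_upper; unfold hy; specialize (PX s) as P1; specialize (PX (S s)); lia. }
  rewrite (zsum_0 (fun s => kap (hx s b) _ _ _)) in H.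
  2:{ intros s Hs. apply kap_upper; unfold hy; specialize (PX s) as P1; specialize (PX (S s)); lia. }
  assert (Hv : forall s, (s <= a)%nat -> snd (X s) = 0 ->
    zsum (fun t => kap (hx s t) (hy s t) (hx s (S t)) (hy s (S t))) b =
    (if (hy s b =? 0) && (0 <? hx s b) then 1 else 0) -
    (if (hy s O =? 0) && (0 <? hx s O) then 1 else 0)).
  { intros s Hs Es. apply (zsum_telescope _ (fun t => if (hy s t =? 0) && (0 <? hx s t) then 1 else 0)).
    intros t Ht. specialize (HY t Ht). unfold adj in HY.
    apply kap_lower; try (apply Hnz; lia); unfold hx, hy;
      specialize (PY t) as P1; specialize (PY (S t)) as P2; lia. }
  rewrite !Hv in H by (auto; lia).
  assert (Hz : 0 + ((if (hy a b =? 0) && (0 <? hx a b) then 1 else 0) -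
    (if (hy a O =? 0) && (0 <? hx a O) then 1 else 0)) - 0 -
    ((if (hy O b =? 0) && (0 <? hx O b) then 1 else 0) -
    (if (hy O O =? 0) && (0 <? hx O O) then 1 else 0)) = 0).
  { apply H. intros s t Hs Ht. specialize (HX s Hs). specialize (HY t Ht). unfold adj in HX, HY.
    assert (K := kap_square (hx s t) (hy s t) (fst (X (S s)) - fst (X s)) (snd (X (S s)) - snd (X s))
      (fst (Y t) - fst (Y (S t))) (snd (Y t) - snd (Y (S t)))).
    replace (hx s t + (fst (X (S s)) - fst (X s))) with (hx (S s) t) in K by (unfold hx; lia).
    replace (hy s t + (snd (X (S s)) - snd (X s))) with (hy (S s) t) in K by (unfold hy; lia).
    replace (hx s t + (fst (Y t) - fst (Y (S t)))) with (hx s (S t)) in K by (unfold hx; lia).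
    replace (hy s t + (snd (Y t) - snd (Y (S t)))) with (hy s (S t)) in K by (unfold hy; lia).
    replace (hx (S s) t + (fst (Y t) - fst (Y (S t)))) with (hx (S s) (S t)) in K by (unfold hx; lia).
    replace (hy (S s) t + (snd (Y t) - snd (Y (S t)))) with (hy (S s) (S t)) in K by (unfold hy; lia).
    apply K; try lia; apply Hnz; lia. }
  unfold hx, hy in Hz. revert Hz.
  rewrite X0, Xa, Y0, Yb. rewrite Z.sub_diag. simpl.
  repeat (match goal with |- context [if ?b then _ else _] =>
    let E := fresh in destruct b eqn:E end); lia.
Qed.

Open Scope R_scope.

(** * Counting classes in non-crossing sequences *)

Section DavenportSchinzel.
Variable A : Type.
Variable E : A -> A -> Prop.
Hypothesis Esym : forall a b, E a b -> E b a.
Hypothesis Etrans : forall a b c, E a b -> E b c -> E a c.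

Definition nocross (l : list A) : Prop := forall l1 a l2 b l3 c l4 e l5,
  l = l1 ++ a :: l2 ++ b :: l3 ++ c :: l4 ++ e :: l5 -> E a c -> E b e -> E a b.

Definition stutterfree (l : list A) : Prop := forall l1 a b l2,
  l = l1 ++ a :: b :: l2 -> ~ E a b.

Lemma nocross_infix (p l q : list A) : nocross (p ++ l ++ q) -> nocross l.
Proof.
  intros H l1 a l2 b l3 c l4 e l5 ->. apply (H (p ++ l1) a l2 b l3 c l4 e (l5 ++ q)).
  repeat (rewrite <- app_assoc || rewrite <- app_comm_cons). reflexivity.
Qed.

Lemma stutterfree_infix (p l q : list A) : stutterfree (p ++ l ++ q) -> stutterfree l.
Proof.
  intros H l1 a b l2 ->. apply (H (p ++ l1) a b (l2 ++ q)).
  repeat (rewrite <- app_assoc || rewrite <- app_comm_cons). reflexivity.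
Qed.

Lemma first_equivalent (a : A) (t : list A) : (exists b, In b t /\ E a b) ->
  exists s b u, t = s ++ b :: u /\ E a b /\ forall x, In x s -> ~ E a x.
Proof.
  induction t as [|x t IH]; intros [b [Hb HE]]; [destruct Hb|].
  destruct (classic (E a x)) as [Hx|Hx].
  - exists nil, x, t. split; [reflexivity|]. split; [exact Hx|]. intros y [].
  - destruct IH as [s [b' [u [-> [H1 H2]]]]].
    { exists b. split; auto. destruct Hb as [->|]; auto. contradiction. }
    exists (x :: s), b', u. split; [reflexivity|]. split; [exact H1|]. intros y [<-|Hy]; auto.
Qed.

(* The symbols are the [E]-classes, and [l] is a Davenport--Schinzel sequence of order 2. *)
Lemma davenport_schinzel (k : nat) : forall l, (length l <= k)%nat -> l <> nil ->
  nocross l -> stutterfree l ->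
  exists l', incl l' l /\ ForallOrdPairs (fun a b => ~ E a b) l' /\
    (length l + 1 <= 2 * length l')%nat.
Proof.
  induction k as [|k IH]; intros l Hk Hn Hc Hs.
  { destruct l; [tauto|simpl in Hk; lia]. }
  destruct l as [|a t]; [tauto|]. simpl in Hk.
  destruct (classic (exists b, In b t /\ E a b)) as [Hex|Hex].
  - destruct (first_equivalent a t Hex) as [s [b [u [-> [Hab Has]]]]].
    assert (Hsn : s <> nil).
    { intros ->. exact (Hs nil a b u eq_refl Hab). }
    rewrite length_app in Hk. simpl in Hk.
    destruct (IH s) as [l1 [I1 [F1 L1]]]; auto; [lia| | |].
    { apply (nocross_infix (a :: nil) s (b :: u)). exact Hc. }
    { apply (stutterfree_infix (a :: nil) s (b :: u)). exact Hs. }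
    destruct (IH (b :: u)) as [l2 [I2 [F2 L2]]]; [simpl; lia|discriminate| | |].
    { apply (nocross_infix (a :: s) (b :: u) nil). rewrite app_nil_r. exact Hc. }
    { apply (stutterfree_infix (a :: s) (b :: u) nil). rewrite app_nil_r. exact Hs. }
    exists (l1 ++ l2). split; [|split].
    + intros x Hx. apply in_app_or in Hx. right. apply in_or_app.
      destruct Hx; [left|right]; auto.
    (* A class met between two occurrences of the class of [a] cannot recur later without crossing
       it, so both lists of representatives can be joined. The class of [a] is already represented
       in [b :: u]. *)
    + assert (Hx : forall x y, In x l1 -> In y l2 -> ~ E x y).
      { intros x y Hx Hy Hxy. apply I1 in Hx. apply I2 in Hy.
        destruct Hy as [<-|Hy].
        - apply (Has x Hx). eapply Etrans; [exact Hab|apply Esym; auto].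
        - apply (Has x Hx).
          apply in_split in Hx. destruct Hx as [s1 [s2 ->]].
          apply in_split in Hy. destruct Hy as [u1 [u2 ->]].
          apply (Hc nil a s1 x s2 b u1 y u2); auto.
          simpl. now rewrite <- app_assoc. }
      clear L1 I1. induction l1 as [|x l1 IHl]; simpl; auto.
      inversion F1; subst. constructor.
      * apply Forall_app. split; auto. apply Forall_forall. intros y Hy. apply Hx; auto. now left.
      * apply IHl; auto. intros; apply Hx; auto. now right.
    + rewrite length_app. simpl length in *. rewrite length_app. simpl. lia.
  - destruct t as [|b t].
    { exists (a :: nil). split; [apply incl_refl|]. split; [repeat constructor|simpl; lia]. }
    destruct (IH (b :: t)) as [l2 [I2 [F2 L2]]]; [simpl in *; lia|discriminate| | |].
    { apply (nocross_infix (a :: nil) (b :: t) nil). rewrite app_nil_r. exact Hc. }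
    { apply (stutterfree_infix (a :: nil) (b :: t) nil). rewrite app_nil_r. exact Hs. }
    exists (a :: l2). split; [|split].
    + apply incl_cons; [now left|]. now apply incl_tl.
    + constructor; auto. apply Forall_forall. intros x Hx Hax. apply Hex. exists x. auto.
    + simpl in *. lia.
Qed.
End DavenportSchinzel.

(** * Chains and finite counting *)

Notation rtc := (clos_refl_trans_1n _).

Lemma rtc_trans {A} (S : A -> A -> Prop) (a b c : A) : rtc S a b -> rtc S b c -> rtc S a c.
Proof. induction 1; auto. intros. econstructor; eauto. Qed.

Lemma rtc_one {A} (S : A -> A -> Prop) (a b : A) : S a b -> rtc S a b.
Proof. intros. econstructor; [eauto|constructor]. Qed.

Lemma rtc_sym {A} (S : A -> A -> Prop) : (forall a b, S a b -> S b a) ->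
  forall a b, rtc S a b -> rtc S b a.
Proof.
  intros Hs a b H. induction H; [constructor|].
  eapply rtc_trans; [eassumption|]. apply rtc_one; auto.
Qed.

Lemma rtc_impl {A} (S T : A -> A -> Prop) : (forall a b, S a b -> T a b) ->
  forall a b, rtc S a b -> rtc T a b.
Proof. intros H a b Hab. induction Hab; [constructor|econstructor; eauto]. Qed.

(** The sequence rests at [b] after its end, so that bounds on its entries hold for all indices, as
    [crossing] demands. *)
Lemma rtc_seq {A} (S : A -> A -> Prop) (a b : A) : rtc S a b ->
  exists X n, X O = a /\ X n = b /\ (forall k, (k < n)%nat -> S (X k) (X (Datatypes.S k))) /\
    (forall k, (n <= k)%nat -> X k = b).
Proof.
  induction 1 as [a|a b c H1 H2 [X [n [X0 [Xn [HX Hc]]]]]].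
  - exists (fun _ => a), O. repeat split; auto; lia.
  - exists (fun k => match k with O => a | Datatypes.S j => X j end), (Datatypes.S n).
    repeat split; auto.
    + intros [|k] Hk; [now rewrite X0|]. apply HX. lia.
    + intros [|k] Hk; [lia|]. apply Hc; lia.
Qed.

Lemma rtc_prefix {A} (S : A -> A -> Prop) (X : nat -> A) (n : nat) :
  (forall k, (k < n)%nat -> S (X k) (X (Datatypes.S k))) ->
  forall k, (k <= n)%nat -> rtc S (X O) (X k).
Proof.
  intros H k. induction k as [|k IH]; intros Hk; [constructor|].
  eapply rtc_trans; [apply IH; lia|]. apply rtc_one, H; lia.
Qed.

Lemma rtc_exit {A} (S : A -> A -> Prop) (P : A -> Prop) (a b : A) : rtc S a b -> P a -> ~ P b ->
  exists p q, S p q /\ P p /\ ~ P q.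
Proof.
  induction 1 as [a|a b c H1 H2 IH]; intros Ha Hb; [tauto|].
  destruct (classic (P b)) as [Hp|Hp]; auto. exists a, b; auto.
Qed.

Lemma filter_length_lt {A} (f g : A -> bool) (l : list A) (e : A) :
  (forall x, In x l -> f x = true -> g x = true) -> In e l -> g e = true -> f e = false ->
  (length (filter f l) < length (filter g l))%nat.
Proof.
  assert (Hle : forall l, (forall x, In x l -> f x = true -> g x = true) ->
    (length (filter f l) <= length (filter g l))%nat).
  { induction l0 as [|x l0 IH]; intros H; simpl; auto.
    specialize (IH (fun y Hy => H y (or_intror Hy))). specialize (H x (or_introl eq_refl)).
    destruct (f x), (g x); simpl; (lia || (exfalso; specialize (H eq_refl); discriminate)). }
  induction l as [|x l IH]; intros H He Hg Hf; [destruct He|]. simpl.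
  destruct He as [->|He].
  - rewrite Hf, Hg. simpl. specialize (Hle l (fun y Hy => H y (or_intror Hy))). lia.
  - specialize (IH (fun y Hy => H y (or_intror Hy)) He Hg Hf).
    specialize (H x (or_introl eq_refl)).
    destruct (f x), (g x); simpl; (lia || (exfalso; specialize (H eq_refl); discriminate)).
Qed.

Lemma nat_min_exists (P : nat -> Prop) : (exists n, P n) ->
  exists n, P n /\ forall m, P m -> (n <= m)%nat.
Proof.
  intros H. destruct (dec_inh_nat_subset_has_unique_least_element P (fun n => classic (P n)) H) as [n [Hn _]].
  now exists n.
Qed.

(** * Two-colourings of a grid *)

Section GridColouring.
Variables (n m : nat) (G : vtx -> C).

(** The box samples the upper half-plane, a model of the disc cut open at one boundary point: the
    bottom row is the circle, where [G] is large, and on the other three sides [G] is close to its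
    value at the cut. *)
Definition inbox (p : vtx) : Prop :=
  (0 <= fst p <= Z.of_nat n /\ 0 <= snd p <= Z.of_nat m)%Z.

Hypothesis Gosc : forall p q, inbox p -> inbox q -> adj p q -> Cmod (G p - G q)%C <= 1 / 100.
Hypothesis Gside : forall p, inbox p -> (fst p = 0 \/ fst p = Z.of_nat n \/ snd p = Z.of_nat m)%Z ->
  0 < Im (G p).
Hypothesis Gbot : forall p, inbox p -> (snd p = 0)%Z -> 9 <= Cmod (G p).

Definition core (t : C) (p : vtx) : Prop := Cmod (G p - t)%C < 1 / 10.

(* [true] marks the vertices on the left of the line [Re = 1/2]. Recolouring a vertex amounts to reflecting its value in that line. *)
Definition admissible (c : vtx -> bool) : Prop :=
  (forall p, inbox p -> core 0 p -> c p = true) /\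
  (forall p, inbox p -> core 1 p -> c p = false) /\
  (forall p q, inbox p -> inbox q -> adj p q -> c p <> c q -> Rabs (Re (G p) - 1 / 2) <= 1 / 100).

Definition col0 (p : vtx) : bool := if Rlt_dec (Re (G p)) (1 / 2) then true else false.

Lemma osc_re (p q : vtx) : inbox p -> inbox q -> adj p q -> Rabs (Re (G p) - Re (G q)) <= 1 / 100.
Proof.
  intros. eapply Rle_trans; [|apply (Gosc p q); auto].
  eapply Rle_trans; [|apply re_le_Cmod]. right. reflexivity.
Qed.
Lemma osc_im (p q : vtx) : inbox p -> inbox q -> adj p q -> Rabs (Im (G p) - Im (G q)) <= 1 / 100.
Proof.
  intros. eapply Rle_trans; [|apply (Gosc p q); auto].
  eapply Rle_trans; [|apply im_le_Cmod]. right. reflexivity.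
Qed.

Lemma core_re (t : R) (p : vtx) : core (RtoC t) p -> Rabs (Re (G p) - t) < 1 / 10.
Proof.
  intros H. eapply Rle_lt_trans; [|exact H].
  eapply Rle_trans; [|apply re_le_Cmod]. right. reflexivity.
Qed.

Lemma col0_admissible : admissible col0.
Proof.
  unfold col0. repeat split.
  - intros p _ H. apply core_re in H. apply Rabs_def2 in H. destruct (Rlt_dec _ _); auto; lra.
  - intros p _ H. apply core_re in H. apply Rabs_def2 in H. destruct (Rlt_dec _ _); auto; lra.
  - intros p q Hp Hq Ha Hne. pose proof (osc_re p q Hp Hq Ha) as O.
    apply Rabs_le_between in O. apply Rabs_le.
    destruct (Rlt_dec (Re (G p)) (1 / 2)), (Rlt_dec (Re (G q)) (1 / 2)); try (exfalso; apply Hne; reflexivity); lra.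
Qed.

Definition stepc (c : vtx -> bool) (p q : vtx) : Prop := inbox p /\ inbox q /\ adj p q /\ c p = c q.

Lemma stepc_sym c p q : stepc c p q -> stepc c q p.
Proof. intros [H1 [H2 [H3 H4]]]. repeat split; auto; try apply H1; try apply H2; apply adj_sym in H3; apply H3. Qed.

Lemma rtc_stepc_col c p q : rtc (stepc c) p q -> c p = c q.
Proof. induction 1 as [|a b d [_ [_ [_ H]]] _ IH]; congruence. Qed.

Definition boxlist : list vtx :=
  list_prod (map Z.of_nat (seq 0 (S n))) (map Z.of_nat (seq 0 (S m))).

Lemma boxlist_spec (p : vtx) : inbox p -> In p boxlist.
Proof.
  destruct p as [a b]. unfold inbox. cbn [fst snd]. intros [Ha Hb]. unfold boxlist. apply in_prod.
  - apply in_map_iff. exists (Z.to_nat a). split; [lia|]. apply in_seq. lia.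
  - apply in_map_iff. exists (Z.to_nat b). split; [lia|]. apply in_seq. lia.
Qed.

Definition bichrom (c : vtx -> bool) (e : vtx * vtx) : bool :=
  if excluded_middle_informative (inbox (fst e) /\ inbox (snd e) /\ adj (fst e) (snd e) /\
    c (fst e) <> c (snd e)) then true else false.

Definition nbichrom (c : vtx -> bool) : nat :=
  length (filter (bichrom c) (list_prod boxlist boxlist)).

(** A minimizer replaces an induction that would recolour one component after the other. *)
Lemma min_colouring : exists c, admissible c /\
  forall c', admissible c' -> (nbichrom c <= nbichrom c')%nat.
Proof.
  destruct (nat_min_exists (fun k => exists c, admissible c /\ nbichrom c = k)) as [k [[c [Hc Hk]] Hmin]].
  { exists (nbichrom col0), col0. split; auto. apply col0_admissible. }
  exists c. split; auto. intros c' Hc'. rewrite Hk. apply Hmin. now exists c'.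
Qed.

Definition flip (c : vtx -> bool) (v p : vtx) : bool :=
  if excluded_middle_informative (rtc (stepc c) v p) then negb (c p) else c p.

(* Flipping a component without core vertices would remove bichromatic edges. *)
Lemma min_comp_core (c : vtx -> bool) (v w : vtx) : admissible c ->
  (forall c', admissible c' -> (nbichrom c <= nbichrom c')%nat) -> inbox v ->
  rtc (fun p q => inbox p /\ inbox q /\ adj p q) v w -> c v <> c w ->
  exists u, inbox u /\ rtc (stepc c) v u /\ (core 0 u \/ core 1 u).
Proof.
  intros Ha Hmin Hv Hvw Hcw. apply NNPP. intros Hno.
  assert (Hfl : forall p q, inbox p -> inbox q -> adj p q -> flip c v p <> flip c v q -> c p <> c q).
  { intros p q Hp Hq Hpq Hne Heq. unfold flip in Hne.
    destruct (excluded_middle_informative (rtc (stepc c) v p)) as [Kp|Kp],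
      (excluded_middle_informative (rtc (stepc c) v q)) as [Kq|Kq]; try congruence.
    - apply Kq. eapply rtc_trans; [exact Kp|]. apply rtc_one. unfold stepc; auto.
    - apply Kp. eapply rtc_trans; [exact Kq|]. apply rtc_one, stepc_sym. unfold stepc; auto. }
  assert (Ha' : admissible (flip c v)).
  { destruct Ha as [A1 [A2 A3]]. split; [|split].
    - intros p Hp Hcp. unfold flip. destruct (excluded_middle_informative _) as [K|K]; auto.
      exfalso. apply Hno. exists p; auto.
    - intros p Hp Hcp. unfold flip. destruct (excluded_middle_informative _) as [K|K]; auto.
      exfalso. apply Hno. exists p; auto.
    - intros p q Hp Hq Hpq Hne. apply (A3 p q); auto. }
  specialize (Hmin _ Ha').
  (* On the way to [w] some edge leaves the component. It is bichromatic, and the flip makes it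
     monochromatic, while by [Hfl] no new bichromatic edge arises. *)
  destruct (rtc_exit _ (fun p => rtc (stepc c) v p) v w Hvw) as [p [q [[Hp [Hq Hpq]] [Kp Kq]]]].
  { constructor. }
  { intros K. apply Hcw. now apply rtc_stepc_col. }
  assert (Hcpq : c p <> c q).
  { intros E. apply Kq. eapply rtc_trans; [exact Kp|]. apply rtc_one. unfold stepc; auto. }
  apply Nat.le_ngt in Hmin. apply Hmin. unfold nbichrom.
  apply (filter_length_lt _ _ _ (p, q)).
  - intros [a b] _. unfold bichrom. simpl.
    destruct (excluded_middle_informative _) as [[K1 [K2 [K3 K4]]]|]; [|discriminate]. intros _.
    destruct (excluded_middle_informative _) as [|K]; auto. exfalso. apply K. auto.
  - apply in_prod; now apply boxlist_spec.
  - unfold bichrom. simpl. destruct (excluded_middle_informative _) as [|K]; auto.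
    exfalso. apply K; auto.
  - unfold bichrom. simpl.
    destruct (excluded_middle_informative _) as [[K1 [K2 [K3 K4]]]|]; auto. exfalso. apply K4.
    unfold flip.
    destruct (excluded_middle_informative (rtc (stepc c) v p)) as [|Z1]; [|contradiction].
    destruct (excluded_middle_informative (rtc (stepc c) v q)) as [|Z2]; [contradiction|].
    destruct (c p), (c q); simpl; congruence.
Qed.

Definition sgn (p : vtx) : Z := if Rlt_dec (Im (G p)) 0 then 0%Z else 1%Z.

(* Signed crossings of the negative real axis by the values reflected according to [c]. *)
Definition kp (c : vtx -> bool) (p q : vtx) : Z :=
  if c p then (if Rlt_dec (1 / 2) (Rabs (Re (G p) - 1 / 2)) then (sgn p - sgn q)%Z else 0%Z) else 0%Z.

Lemma kp_sgn c p q : sgn p = sgn q -> kp c p q = 0%Z.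
Proof. unfold kp. intros ->. destruct (c p); auto. destruct (Rlt_dec _ _); lia. Qed.

Definition ksq (c : vtx -> bool) (s t : Z) : Z :=
  (kp c (s, t) (s + 1, t) + kp c (s + 1, t) (s + 1, t + 1)
   - kp c (s, t + 1) (s + 1, t + 1) - kp c (s, t) (s, t + 1))%Z.

(** If [sgn] is constant on the square, nothing is counted, so the values may be taken near the real
    axis. Between 0 and 1 nothing is counted either; near 0 or 1 the corners are core vertices,
    whose colour is prescribed; farther out the square is monochromatic and its sum telescopes to 0
    for each colouring. *)
Lemma ksq_indep (c : vtx -> bool) (s t : Z) : admissible c ->
  (0 <= s < Z.of_nat n)%Z -> (0 <= t < Z.of_nat m)%Z -> ksq c s t = ksq col0 s t.
Proof.
  intros Hc Hs Ht.
  set (p := (s, t)%Z : vtx). set (q := (s + 1, t)%Z : vtx). set (r := (s + 1, t + 1)%Z : vtx).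
  set (w := (s, t + 1)%Z : vtx).
  assert (Bp : inbox p) by (unfold inbox; simpl; lia).
  assert (Bq : inbox q) by (unfold inbox; simpl; lia).
  assert (Br : inbox r) by (unfold inbox; simpl; lia).
  assert (Bw : inbox w) by (unfold inbox; simpl; lia).
  assert (Apq : adj p q) by (unfold adj; simpl; lia).
  assert (Apr : adj p r) by (unfold adj; simpl; lia).
  assert (Apw : adj p w) by (unfold adj; simpl; lia).
  pose proof (osc_re p q Bp Bq Apq) as R1. pose proof (osc_re p r Bp Br Apr) as R2.
  pose proof (osc_re p w Bp Bw Apw) as R3.
  pose proof (osc_im p q Bp Bq Apq) as I1. pose proof (osc_im p r Bp Br Apr) as I2.
  pose proof (osc_im p w Bp Bw Apw) as I3.
  apply Rabs_le_between in R1, R2, R3, I1, I2, I3.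
  destruct (classic (sgn p = sgn q /\ sgn p = sgn r /\ sgn p = sgn w)) as [[S1 [S2 S3]]|Hns].
  { unfold ksq. fold p q r w. rewrite !kp_sgn by congruence. reflexivity. }
  assert (Hy : Rabs (Im (G p)) <= 1 / 100).
  { apply Rnot_lt_le. intros L. apply Hns. unfold sgn.
    unfold Rabs in L. destruct (Rcase_abs (Im (G p)));
    repeat (destruct (Rlt_dec _ _)); try lra; auto. }
  apply Rabs_le_between in Hy.
  assert (Hcore : forall tt v, Rabs (Re (G v) - tt) <= 4 / 100 -> Rabs (Im (G v)) <= 2 / 100 ->
    core (RtoC tt) v).
  { intros tt v H1 H2. unfold core. eapply Rle_lt_trans; [apply Cmod_le_re_im|].
    change (Re (G v - RtoC tt)%C) with (Re (G v) - tt).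
    change (Im (G v - RtoC tt)%C) with (Im (G v) - 0). rewrite Rminus_0_r. lra. }
  assert (Hsame : (forall v, (v = p \/ v = q \/ v = r \/ v = w) -> c v = col0 v) ->
    ksq c s t = ksq col0 s t).
  { intros H. unfold ksq, kp. fold p q r w. rewrite !H by auto. reflexivity. }
  destruct Hc as [A1 [A2 A3]]. destruct col0_admissible as [B1 [B2 B3]].
  (* With oscillation [1/100], the thresholds [46/100] and [54/100] keep all corners on one side of
     [1/2]; what lies between them is within [4/100] of 0 or 1. *)
  assert (Cx : Rabs (Re (G p) - 1 / 2) <= 46 / 100 \/ 54 / 100 <= Rabs (Re (G p) - 1 / 2) \/
    Rabs (Re (G p)) <= 3 / 100 + 1/100 \/ Rabs (Re (G p) - 1) <= 3 / 100 + 1/100).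
  { unfold Rabs. repeat (destruct (Rcase_abs _)); lra. }
  assert (Hfar : 2 / 100 <= Rabs (Re (G p) - 1 / 2) -> forall cc, admissible cc ->
     cc q = cc p /\ cc r = cc p /\ cc w = cc p).
  { intros Hx cc [C1 [C2 C3]]. repeat split; apply NNPP; intros Hne.
    - specialize (C3 p q Bp Bq Apq (not_eq_sym Hne)). lra.
    - specialize (C3 p r Bp Br Apr (not_eq_sym Hne)). lra.
    - specialize (C3 p w Bp Bw Apw (not_eq_sym Hne)). lra. }
  destruct Cx as [Cx|[Cx|[Cx|Cx]]].
  - apply Rabs_le_between in Cx.
    assert (Z0 : forall cc v v', v = p \/ v = q \/ v = r \/ v = w -> kp cc v v' = 0%Z).
    { intros cc v v' Hv. unfold kp. destruct (cc v); auto.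
      destruct (Rlt_dec _ _) as [L|]; auto. exfalso. revert L. apply Rle_not_lt. apply Rabs_le.
      destruct Hv as [->|[->|[->| ->]]]; lra. }
    unfold ksq. fold p q r w. rewrite !Z0 by auto. reflexivity.
  - assert (Z0 : forall cc, admissible cc -> ksq cc s t = 0%Z).
    { intros cc Hcc. destruct (Hfar ltac:(lra) cc Hcc) as [E1 [E2 E3]].
      assert (Hall : forall v, v = p \/ v = q \/ v = r \/ v = w -> 1 / 2 < Rabs (Re (G v) - 1 / 2)).
      { intros v Hv. unfold Rabs in *. destruct (Rcase_abs (Re (G p) - 1 / 2));
        destruct Hv as [->|[->|[->| ->]]]; destruct (Rcase_abs _); lra. }
      unfold ksq, kp. fold p q r w. rewrite E1, E3. destruct (cc p); [|reflexivity].
      destruct (Rlt_dec (1 / 2) (Rabs (Re (G p) - 1 / 2))) as [|K]; [|destruct K; auto].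
      destruct (Rlt_dec (1 / 2) (Rabs (Re (G q) - 1 / 2))) as [|K]; [|destruct K; auto].
      destruct (Rlt_dec (1 / 2) (Rabs (Re (G w) - 1 / 2))) as [|K]; [|destruct K; auto].
      lia. }
    rewrite (Z0 c), (Z0 col0); auto. { split; auto. } { split; auto. }
  - apply Rabs_le_between in Cx. apply Hsame.
    assert (Hr : forall v, v = p \/ v = q \/ v = r \/ v = w -> inbox v /\ core 0 v).
    { intros v Hv. split; [destruct Hv as [->|[->|[->| ->]]]; auto|].
      unfold core. eapply Rle_lt_trans; [apply Cmod_le_re_im|].
      change (Re (G v - 0)%C) with (Re (G v) - 0). change (Im (G v - 0)%C) with (Im (G v) - 0).
      rewrite !Rminus_0_r.
      assert (Rabs (Re (G v)) <= 5 / 100) by (apply Rabs_le; destruct Hv as [->|[->|[->| ->]]]; lra).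
      assert (Rabs (Im (G v)) <= 2 / 100) by (apply Rabs_le; destruct Hv as [->|[->|[->| ->]]]; lra).
      lra. }
    intros v Hv. destruct (Hr v Hv). now rewrite A1, B1.
  - apply Rabs_le_between in Cx. apply Hsame.
    assert (Hr : forall v, v = p \/ v = q \/ v = r \/ v = w -> inbox v /\ core 1 v).
    { intros v Hv. split; [destruct Hv as [->|[->|[->| ->]]]; auto|].
      unfold core. eapply Rle_lt_trans; [apply Cmod_le_re_im|].
      change (Re (G v - 1)%C) with (Re (G v) - 1). change (Im (G v - 1)%C) with (Im (G v) - 0).
      rewrite !Rminus_0_r.
      assert (Rabs (Re (G v) - 1) <= 5 / 100) by (apply Rabs_le; destruct Hv as [->|[->|[->| ->]]]; lra).
      assert (Rabs (Im (G v)) <= 2 / 100) by (apply Rabs_le; destruct Hv as [->|[->|[->| ->]]]; lra).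
      lra. }
    intros v Hv. destruct (Hr v Hv). now rewrite A2, B2.
Qed.

Definition bsum (c : vtx -> bool) (k : nat) : Z :=
  zsum (fun k => kp c (Z.of_nat k, 0%Z) (Z.of_nat k + 1, 0)%Z) k.

(** On the other three sides [Im G > 0], so they contribute nothing, and the bottom sum is the total
    over all unit squares. *)
Lemma bsum_indep (c : vtx -> bool) : admissible c -> bsum c n = bsum col0 n.
Proof.
  intros Hc.
  assert (Hst : forall cc, bsum cc n = zsum (fun s => zsum (fun t => ksq cc (Z.of_nat s) (Z.of_nat t)) m) n).
  { intros cc.
    assert (H := discrete_stokes
      (fun s t => kp cc (Z.of_nat s, Z.of_nat t) (Z.of_nat s + 1, Z.of_nat t)%Z)
      (fun s t => kp cc (Z.of_nat s, Z.of_nat t) (Z.of_nat s, Z.of_nat t + 1)%Z)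
      (fun s t => ksq cc (Z.of_nat s) (Z.of_nat t)) n m).
    cbv beta in H.
    assert (Hs1 : forall p, inbox p -> (fst p = 0 \/ fst p = Z.of_nat n \/ snd p = Z.of_nat m)%Z -> sgn p = 1%Z).
    { intros p Hp Hq. specialize (Gside p Hp Hq). unfold sgn. destruct (Rlt_dec _ _); auto; lra. }
    rewrite (zsum_0 (fun t => kp cc (Z.of_nat n, Z.of_nat t) _)) in H.
    2:{ intros k Hk. apply kp_sgn. rewrite !Hs1; auto; unfold inbox; simpl; lia. }
    rewrite (zsum_0 (fun s => kp cc (Z.of_nat s, Z.of_nat m) _)) in H.
    2:{ intros k Hk. apply kp_sgn. rewrite !Hs1; auto; unfold inbox; simpl; lia. }
    rewrite (zsum_0 (fun t => kp cc (Z.of_nat 0, Z.of_nat t) _)) in H.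
    2:{ intros k Hk. apply kp_sgn. rewrite !Hs1; auto; unfold inbox; simpl; lia. }
    unfold bsum. rewrite <- H; [simpl; lia|].
    intros s t Hs Ht. rewrite !Nat2Z.inj_succ. unfold Z.succ, ksq. lia. }
  rewrite !Hst. apply zsum_ext. intros s Hs. apply zsum_ext. intros t Ht.
  apply ksq_indep; auto; lia.
Qed.

Definition bot (k : nat) : vtx := (Z.of_nat k, 0%Z).

(** One position for each monochromatic run of the bottom row, from right to left since
    [bottom_runs] prepends. *)
Fixpoint alternating (c : vtx -> bool) (l : list nat) : Prop :=
  match l with
  | nil => True
  | a :: t => match t with
    | nil => True
    | b :: _ => (b < a)%nat /\ c (bot a) <> c (bot b)
    end /\ alternating c t
  end.

Definition ntrue (c : vtx -> bool) (l : list nat) : nat := length (filter (fun k => c (bot k)) l).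

Lemma sgn_01 p : (0 <= sgn p <= 1)%Z.
Proof. unfold sgn. destruct (Rlt_dec _ _); lia. Qed.

(** Values on the bottom row are large, so [sgn] changes only where [|Re - 1/2| > 1/2], which is
    where [kp] counts. Within a run of colour [true] the count telescopes to a difference of two
    values of [sgn], at most 1; at a change of colour the value is near [Re = 1/2] and [kp] is 0.
    The subtracted term keeps track of the unfinished run. *)
Lemma bottom_runs (c : vtx -> bool) : admissible c -> forall i, (i <= n)%nat ->
  exists a l, (a <= i)%nat /\ alternating c (a :: l) /\ c (bot a) = c (bot i) /\
    (bsum c i <= Z.of_nat (ntrue c (a :: l)) - (if c (bot i) then sgn (bot i) else 0))%Z.
Proof.
  intros Hc. induction i as [|i IH]; intros Hi.
  - exists O, nil. pose proof (sgn_01 (bot O)).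
    split; [lia|]. split; [simpl; auto|]. split; [reflexivity|].
    unfold ntrue, bsum. cbn [filter zsum]. destruct (c (bot 0)); cbn [length]; lia.
  - destruct (IH ltac:(lia)) as [a [l [Ha [Hl [Hca Hb]]]]].
    assert (Bi : inbox (bot i)) by (unfold inbox, bot; cbn [fst snd]; lia).
    assert (Bi' : inbox (bot (S i))) by (unfold inbox, bot; cbn [fst snd]; lia).
    assert (Ad : adj (bot i) (bot (S i))) by (unfold adj, bot; cbn [fst snd]; lia).
    assert (Hbs : bsum c (S i) = (bsum c i + kp c (bot i) (bot (S i)))%Z).
    { unfold bsum. cbn [zsum]. do 2 f_equal. unfold bot. f_equal. lia. }
    pose proof (sgn_01 (bot i)). pose proof (sgn_01 (bot (S i))).
    destruct (Bool.bool_dec (c (bot i)) (c (bot (S i)))) as [E|E].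
    + exists a, l. split; [lia|]. split; [exact Hl|]. split; [congruence|].
      rewrite Hbs. rewrite <- E. unfold kp. destruct (c (bot i)) eqn:Ec; [|lia].
      destruct (Rlt_dec _ _) as [|L]; [lia|].
      assert (Hs : sgn (bot i) = sgn (bot (S i))); [|lia].
      pose proof (osc_im _ _ Bi Bi' Ad) as O. apply Rabs_le_between in O.
      pose proof (Gbot _ Bi eq_refl) as B. pose proof (Cmod_le_re_im (G (bot i))) as B'.
      apply Rnot_lt_le in L. apply Rabs_le_between in L.
      assert (Rabs (Re (G (bot i))) <= 1) by (apply Rabs_le; lra).
      unfold sgn. unfold Rabs in B' at 2. destruct (Rcase_abs (Im _));
      repeat destruct (Rlt_dec _ _); try lra; auto.
    + assert (Hk : kp c (bot i) (bot (S i)) = 0%Z).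
      { destruct Hc as [_ [_ A3]]. specialize (A3 _ _ Bi Bi' Ad E).
        unfold kp. destruct (c (bot i)); auto. destruct (Rlt_dec _ _) as [L|]; auto. lra. }
      exists (S i), (a :: l). split; [lia|]. split; [|split; [reflexivity|]].
      * change (((a < S i)%nat /\ c (bot (S i)) <> c (bot a)) /\ alternating c (a :: l)).
        split; [split; [lia|congruence]|exact Hl].
      * rewrite Hbs, Hk. unfold ntrue in *. simpl filter in *. rewrite Hca in *.
        destruct (c (bot i)) eqn:E1, (c (bot (S i))) eqn:E2; try congruence; simpl length in *; lia.
Qed.

Lemma ntrue_length (c : vtx -> bool) (l : list nat) : alternating c l ->
  (2 * ntrue c l <= length l + match l with a :: _ => (if c (bot a) then 1 else 0) | nil => 0 end)%nat.
Proof.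
  unfold ntrue. induction l as [|a l IH]; intros H; simpl; auto.
  destruct l as [|b l].
  - simpl. destruct (c (bot a)); simpl; lia.
  - destruct H as [[_ H1] H2]. specialize (IH H2). simpl in *.
    destruct (c (bot a)), (c (bot b)); simpl in *; try congruence; lia.
Qed.

End GridColouring.

Lemma ForallOrdPairs_map {A B} (R : A -> A -> Prop) (S : B -> B -> Prop) (f : A -> B) (l : list A) :
  ForallOrdPairs R l -> (forall a b, In a l -> In b l -> R a b -> S (f a) (f b)) ->
  ForallOrdPairs S (map f l).
Proof.
  induction 1 as [|a l Ha Hl IH]; intros H; simpl; constructor.
  - apply Forall_forall. intros y Hy. apply in_map_iff in Hy. destruct Hy as [x [<- Hx]].
    apply H; [now left|now right|]. rewrite Forall_forall in Ha. auto.
  - apply IH. intros; apply H; auto; now right.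
Qed.

Lemma ForallOrdPairs_filter {A} (R : A -> A -> Prop) (f : A -> bool) (l : list A) :
  ForallOrdPairs R l -> ForallOrdPairs R (filter f l).
Proof.
  induction 1 as [|a l Ha Hl IH]; simpl; [constructor|].
  destruct (f a); auto. constructor; auto.
  apply Forall_forall. intros y Hy. apply filter_In in Hy. rewrite Forall_forall in Ha. apply Ha. tauto.
Qed.

Lemma ForallOrdPairs_impl {A} (R S : A -> A -> Prop) (l : list A) : ForallOrdPairs R l ->
  (forall a b, In a l -> In b l -> R a b -> S a b) -> ForallOrdPairs S l.
Proof. intros H HS. rewrite <- (map_id l). eapply ForallOrdPairs_map; eauto. Qed.

Lemma filter_negb_length {A} (f : A -> bool) (l : list A) :
  (length (filter f l) + length (filter (fun x => negb (f x)) l) = length l)%nat.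
Proof. induction l as [|a l IH]; simpl; auto. destruct (f a); simpl; lia. Qed.

Lemma alternating_app c l1 l2 : alternating c (l1 ++ l2) -> alternating c l2.
Proof.
  induction l1 as [|a l1 IH]; simpl; auto. intros [_ H]. auto.
Qed.

Lemma alternating_lt c a l : alternating c (a :: l) -> forall x, In x l -> (x < a)%nat.
Proof.
  revert a. induction l as [|b l IH]; intros a H x Hx; [destruct Hx|].
  destruct H as [[H1 _] H2]. destruct Hx as [<-|Hx]; auto. specialize (IH b H2 x Hx). lia.
Qed.

(** The radius [1/5] leaves room above [1/10] for rounding to vertices, and is below the distance
    from 0 or 1 to the line [Re = 1/2], so that such a step never changes colour. *)
Definition stepU (n m : nat) (G : vtx -> C) (t : C) (p q : vtx) : Prop :=
  inbox n m p /\ inbox n m q /\ adj p q /\ Cmod (G p - t)%C <= 1 / 5 /\ Cmod (G q - t)%C <= 1 / 5.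

Lemma bottom_path (n m : nat) (a b : nat) : (a <= n)%nat -> (b <= n)%nat ->
  rtc (fun p q => inbox n m p /\ inbox n m q /\ adj p q) (bot a) (bot b).
Proof.
  assert (Hup : forall k a, (a + k <= n)%nat ->
    rtc (fun p q => inbox n m p /\ inbox n m q /\ adj p q) (bot a) (bot (a + k))).
  { induction k as [|k IH]; intros a0 H.
    - rewrite Nat.add_0_r. constructor.
    - eapply rtc_trans; [apply (IH a0); lia|]. apply rtc_one.
      unfold inbox, adj, bot; cbn [fst snd]. lia. }
  intros Ha Hb. destruct (le_ge_dec a b) as [L|L].
  - replace b with (a + (b - a))%nat by lia. apply Hup. lia.
  - apply rtc_sym.
    + intros p q [H1 [H2 H3]]. repeat split; try apply H1; try apply H2; apply adj_sym in H3; apply H3.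
    + replace a with (b + (a - b))%nat by lia. apply Hup. lia.
Qed.

(** Winding [d] forces [d] runs of colour [true], hence at least [2 d - 1] alternating runs. By
    [crossing] and [davenport_schinzel] they meet at least [d] different components; each contains a
    core vertex, whose colour determines its [t], and one colour has at least half of them. *)
Lemma grid_pieces (n m : nat) (G : vtx -> C) (d : nat) :
  (forall p q, inbox n m p -> inbox n m q -> adj p q -> Cmod (G p - G q)%C <= 1 / 100) ->
  (forall p, inbox n m p -> (fst p = 0 \/ fst p = Z.of_nat n \/ snd p = Z.of_nat m)%Z ->
    0 < Im (G p)) ->
  (forall p, inbox n m p -> (snd p = 0)%Z -> 9 <= Cmod (G p)) ->
  (2 <= d)%nat -> (Z.of_nat d <= bsum G (col0 G) n)%Z ->
  exists (t : C) (vs : list vtx), (t = 0 \/ t = 1) /\ (d <= 2 * length vs)%nat /\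
    (forall v, In v vs -> inbox n m v /\ core G t v) /\
    ForallOrdPairs (fun v w => ~ rtc (stepU n m G t) v w) vs.
Proof.
  intros Gosc Gside Gbot Hd Hsum.
  destruct (min_colouring n m G Gosc) as [c [Hc Hmin]].
  destruct (bottom_runs n m G Gosc Gbot c Hc n (le_n n)) as [a0 [l0 [Ha0 [Halt [_ Hb]]]]].
  rewrite (bsum_indep n m G Gosc Gside c Hc) in Hb.
  set (l := a0 :: l0) in *.
  assert (Hcnt : (d <= ntrue c l)%nat).
  { pose proof (sgn_01 G (bot n)). destruct (c (bot n)); lia. }
  assert (Hlen := ntrue_length c l Halt).
  assert (Hlen' : (2 * d <= length l + 1)%nat).
  { unfold l in *. destruct (c (bot a0)); lia. }
  assert (Hln : forall a, In a l -> (a <= n)%nat).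
  { intros a [<-|Ha]; auto. apply (alternating_lt c a0 l0 Halt) in Ha. lia. }
  assert (Hbox : forall a, In a l -> inbox n m (bot a)).
  { intros a Ha. specialize (Hln a Ha). unfold inbox, bot; cbn [fst snd]. lia. }
  set (E := fun a b => rtc (stepc n m c) (bot a) (bot b)).
  assert (Esym : forall p q, rtc (stepc n m c) p q -> rtc (stepc n m c) q p).
  { apply rtc_sym. apply stepc_sym. }
  destruct (davenport_schinzel nat E (fun a b => Esym _ _)
    (fun a b d => rtc_trans _ _ _ _) (length l) l (le_n _)) as [l' [Hincl [HF HL]]].
  { discriminate. }
  { intros l1 a l2 b l3 k l4 e l5 El Hac Hbe.
    apply NNPP. intros Hab.
    assert (Alt1 : alternating c (a :: l2 ++ b :: l3 ++ k :: l4 ++ e :: l5))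
      by (apply (alternating_app c l1); rewrite <- El; auto).
    assert (Lab : (b < a)%nat).
    { apply (alternating_lt _ _ _ Alt1). apply in_or_app. right. now left. }
    assert (Alt2 : alternating c (b :: l3 ++ k :: l4 ++ e :: l5))
      by (apply (alternating_app c (a :: l2)); auto).
    assert (Lbk : (k < b)%nat).
    { apply (alternating_lt _ _ _ Alt2). apply in_or_app. right. now left. }
    assert (Alt3 : alternating c (k :: l4 ++ e :: l5))
      by (apply (alternating_app c (b :: l3)); auto).
    assert (Lke : (e < k)%nat).
    { apply (alternating_lt _ _ _ Alt3). apply in_or_app. right. now left. }
    assert (Ina : In a l) by (rewrite El; apply in_or_app; right; now left).
    assert (Inb : In b l).
    { rewrite El. apply in_or_app; right; right. apply in_or_app; right; now left. }
    (* Positions decrease along [l], so the chains are reversed: [X] goes from [e] to [b] and [Y]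
       from [k] to [a], with [e < k < b < a]. A common vertex would connect [a] and [b]. *)
    apply Esym in Hac. apply Esym in Hbe.
    destruct (rtc_seq _ _ _ Hbe) as [X [nx [X0 [Xn [HX HXc]]]]].
    destruct (rtc_seq _ _ _ Hac) as [Y [ny [Y0 [Yn [HY HYc]]]]].
    assert (PX : forall s, (0 <= snd (X s))%Z).
    { intros s. destruct (le_lt_dec nx s) as [L|L].
      - rewrite HXc by auto. simpl. lia.
      - destruct (HX s L) as [H _]. apply H. }
    assert (PY : forall s, (0 <= snd (Y s))%Z).
    { intros s. destruct (le_lt_dec ny s) as [L|L].
      - rewrite HYc by auto. simpl. lia.
      - destruct (HY s L) as [H _]. apply H. }
    apply (crossing X Y nx ny).
    - intros s Hs. apply (HX s Hs).
    - intros s Hs. apply (HY s Hs).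
    - intros s t Hs Ht Heq. apply Hab. unfold E.
      assert (R1 := rtc_prefix _ X nx HX s Hs). assert (R2 := rtc_prefix _ Y ny HY t Ht).
      rewrite X0 in R1. rewrite Y0, <- Heq in R2.
      eapply rtc_trans; [apply Esym; exact Hac|].
      eapply rtc_trans; [exact R2|]. eapply rtc_trans; [apply Esym; exact R1|]. exact Hbe.
    - exact PX.
    - exact PY.
    - now rewrite X0.
    - now rewrite Xn.
    - now rewrite Y0.
    - now rewrite Yn.
    - rewrite X0, Y0. simpl. lia.
    - rewrite Y0, Xn. simpl. lia.
    - rewrite Xn, Yn. simpl. lia. }
  { intros l1 a b l2 El Hab. assert (Alt : alternating c (a :: b :: l2)).
    { apply (alternating_app c l1). rewrite <- El. exact Halt. }
    destruct Alt as [[_ Hne] _]. apply Hne. now apply rtc_stepc_col in Hab. }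
  (* Since [d >= 2], there are at least three runs, so both colours occur and [min_comp_core]
     applies. *)
  assert (Hother : forall a, In a l -> exists b, In b l /\ c (bot a) <> c (bot b)).
  { unfold l in *. destruct l0 as [|b0 l0]; [simpl in Hlen'; lia|].
    destruct Halt as [[_ Hne] _]. intros a _.
    destruct (Bool.bool_dec (c (bot a)) (c (bot a0))) as [Eq|Eq].
    - exists b0. split; [right; now left|]. congruence.
    - exists a0. split; [now left|auto]. }
  assert (Hcore : forall a, exists u, In a l ->
    inbox n m u /\ rtc (stepc n m c) (bot a) u /\ (core G 0 u \/ core G 1 u)).
  { intros a. destruct (classic (In a l)) as [Ha|Ha]; [|exists (bot a); tauto].
    destruct (Hother a Ha) as [b [Hbl Hab]].
    destruct (min_comp_core n m G c (bot a) (bot b) Hc Hmin (Hbox a Ha)) as [u Hu]; auto.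
    { apply bottom_path; auto. }
    exists u. auto. }
  set (u := fun a => proj1_sig (constructive_indefinite_description _ (Hcore a))).
  assert (Hu : forall a, In a l ->
    inbox n m (u a) /\ rtc (stepc n m c) (bot a) (u a) /\ (core G 0 (u a) \/ core G 1 (u a))).
  { intros a. apply (proj2_sig (constructive_indefinite_description _ (Hcore a))). }
  assert (HF' : ForallOrdPairs (fun v w => ~ rtc (stepc n m c) v w) (map u l')).
  { eapply ForallOrdPairs_map; [exact HF|]. intros a b Ha Hb' Hne Huv. apply Hne. unfold E.
    eapply rtc_trans; [apply (Hu a); auto|]. eapply rtc_trans; [exact Huv|].
    apply Esym. apply (Hu b); auto. }
  assert (Hux : forall v, In v (map u l') -> inbox n m v /\ (core G 0 v \/ core G 1 v)).
  { intros v Hv. apply in_map_iff in Hv. destruct Hv as [a [<- Ha]].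
    destruct (Hu a (Hincl a Ha)) as [H1 [_ H2]]. auto. }
  assert (Hsplit := filter_negb_length c (map u l')). rewrite length_map in Hsplit.
  assert (Hstep : forall (t : R), t = 0 \/ t = 1 -> forall p q, stepU n m G (RtoC t) p q -> stepc n m c p q).
  { intros t Ht p q [Hp [Hq [Hpq [Gp Gq]]]]. split; [auto|]. split; [auto|]. split; [auto|].
    apply NNPP. intros Hne. destruct Hc as [_ [_ A3]]. specialize (A3 p q Hp Hq Hpq Hne).
    pose proof (re_le_Cmod (G p - RtoC t)%C) as Hr.
    change (Re (G p - RtoC t)%C) with (Re (G p) - t) in Hr.
    assert (Hr' : Rabs (Re (G p) - t) <= 1 / 5) by lra.
    apply Rabs_le_between in Hr'. apply Rabs_le_between in A3. destruct Ht; lra. }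
  destruct Hc as [A1 [A2 A3]].
  destruct (le_lt_dec d (2 * length (filter c (map u l')))) as [L|L].
  - exists 0, (filter c (map u l')). split; [now left|]. split; [exact L|]. split.
    + intros v Hv. apply filter_In in Hv. destruct Hv as [Hv Hcv].
      destruct (Hux v Hv) as [H1 [H2|H2]]; auto. rewrite A2 in Hcv by auto. discriminate.
    + eapply ForallOrdPairs_impl; [apply ForallOrdPairs_filter; exact HF'|].
      intros v w _ _ Hne Hr. apply Hne. revert Hr. apply rtc_impl. apply Hstep; auto.
  - exists 1, (filter (fun x => negb (c x)) (map u l')). split; [now right|]. split; [lia|]. split.
    + intros v Hv. apply filter_In in Hv. destruct Hv as [Hv Hcv].
      destruct (Hux v Hv) as [H1 [H2|H2]]; auto. rewrite A1 in Hcv by auto. discriminate.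
    + eapply ForallOrdPairs_impl; [apply ForallOrdPairs_filter; exact HF'|].
      intros v w _ _ Hne Hr. apply Hne. revert Hr. apply rtc_impl. apply Hstep; auto.
Qed.

(** * Counting pieces in a disc *)

Lemma atan_lipschitz (a b : R) : Rabs (atan a - atan b) <= Rabs (a - b).
Proof.
  destruct (MVT_gen atan b a (fun x => / (1 + x ^ 2))) as [c [_ Hc]].
  - intros x _. apply is_derive_Reals. apply derivable_pt_lim_atan.
  - intros x _. apply derivable_continuous_pt. exists (/ (1 + x ^ 2)). apply derivable_pt_lim_atan.
  - rewrite Hc, Rabs_mult. pose proof (Rabs_pos (a - b)).
    assert (Rabs (/ (1 + c ^ 2)) <= 1); [|nra].
    assert (0 <= c ^ 2) by apply pow2_ge_0.
    rewrite Rabs_right by (apply Rle_ge; left; apply Rinv_0_lt_compat; lra).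
    rewrite <- Rinv_1. apply Rinv_le_contravar; lra.
Qed.

(** [cay zb] is the Cayley transform from the upper half-plane to the disc of radius [|zb|], with
    denominator [cayN], and sends infinity to [zb]. It unrolls the circle, cut at [zb], onto the
    real axis. *)
Definition cayN (z : C) : C := (1 - Ci * z)%C.
Definition cay (zb z : C) : C := (zb * (1 - 2 / cayN z))%C.

Lemma cayN_ge (z : C) : 0 <= Im z -> 1 + Im z <= Cmod (cayN z).
Proof.
  intros H. eapply Rle_trans; [|apply re_le_Cmod]. unfold cayN. simpl.
  unfold Im in *. rewrite Rabs_right; lra.
Qed.

Lemma cayN_ge_re (z : C) : Rabs (Re z) <= Cmod (cayN z).
Proof.
  eapply Rle_trans; [|apply im_le_Cmod]. unfold cayN. simpl.
  right. rewrite <- Rabs_Ropp. f_equal. unfold Re. ring.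
Qed.

Lemma cayN_nz (z : C) : 0 <= Im z -> cayN z <> 0.
Proof. intros H. apply Cmod_pos_nz. pose proof (cayN_ge z H). lra. Qed.

Lemma Cmod_sq_le (a b : C) : Re a * Re a + Im a * Im a <= Re b * Re b + Im b * Im b ->
  Cmod a <= Cmod b.
Proof.
  intros H. apply Rsqr_incr_0; try apply Cmod_ge_0.
  pose proof (Cmod2_alt a) as Ha. pose proof (Cmod2_alt b) as Hb. unfold Rsqr. simpl in *. lra.
Qed.

Lemma cay_bound (zb z : C) : 0 <= Im z -> Cmod (cay zb z) <= Cmod zb.
Proof.
  intros H. unfold cay. rewrite Cmod_mult.
  rewrite <- (Rmult_1_r (Cmod zb)) at 2. apply Rmult_le_compat_l; [apply Cmod_ge_0|].
  replace (1 - 2 / cayN z)%C with ((cayN z - 2) / cayN z)%C by (field; now apply cayN_nz).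
  rewrite Cmod_div by now apply cayN_nz. pose proof (cayN_ge z H).
  apply (Rmult_le_reg_r (Cmod (cayN z))); [lra|].
  replace (Cmod (cayN z - 2) / Cmod (cayN z) * Cmod (cayN z)) with (Cmod (cayN z - 2))
    by (field; lra).
  rewrite Rmult_1_l. apply Cmod_sq_le. unfold cayN. destruct z as [x y].
  unfold Im in *; simpl in *. nra.
Qed.

Lemma cay_dist (zb z w : C) : 0 <= Im z -> 0 <= Im w ->
  Cmod (cay zb z - cay zb w)%C <= 2 * Cmod zb * Cmod (z - w)%C.
Proof.
  intros Hz Hw. pose proof (cayN_ge z Hz). pose proof (cayN_ge w Hw).
  pose proof (cayN_nz z Hz). pose proof (cayN_nz w Hw).
  replace (cay zb z - cay zb w)%C with (2 * zb * (Ci * (w - z)) / (cayN z * cayN w))%C.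
  2:{ unfold cay. replace (Ci * (w - z))%C with (cayN z - cayN w)%C by (unfold cayN; ring).
      field; auto. }
  rewrite Cmod_div by (apply Cmult_neq_0; auto). rewrite !Cmod_mult, Cmod_Ci, Cmod_R.
  rewrite (Cmod_minus_sym w z), Rabs_right by lra.
  apply (Rmult_le_reg_r (Cmod (cayN z) * Cmod (cayN w))); [apply Rmult_lt_0_compat; lra|].
  replace (2 * Cmod zb * (1 * Cmod (z - w)) / (Cmod (cayN z) * Cmod (cayN w)) * (Cmod (cayN z) * Cmod (cayN w)))
    with (2 * Cmod zb * Cmod (z - w) * 1) by (field; lra).
  apply Rmult_le_compat_l; [|nra].
  pose proof (Cmod_ge_0 zb). pose proof (Cmod_ge_0 (z - w)%C). nra.
Qed.

Lemma cay_near (zb z : C) : 0 <= Im z -> Cmod (cay zb z - zb)%C * Cmod (cayN z) = 2 * Cmod zb.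
Proof.
  intros Hz. pose proof (cayN_ge z Hz). pose proof (cayN_nz z Hz).
  replace (cay zb z - zb)%C with (- (2 * zb / cayN z))%C by (unfold cay; field; auto).
  rewrite Cmod_opp, Cmod_div, Cmod_mult, Cmod_R, Rabs_right by (auto; lra). field. lra.
Qed.

(** The half-angle substitution: as [x] runs over the real line, the angle increases by a full turn
    from that of [zb]. *)
Lemma cay_real (zb : C) (x : R) : cay zb (RtoC x) = (zb * cis (PI + 2 * atan x))%C.
Proof.
  unfold cay. f_equal. assert (Hp : 0 < 1 + x * x) by nra.
  assert (Hs : sqrt (1 + x ^ 2) * sqrt (1 + x ^ 2) = 1 + x * x).
  { rewrite sqrt_sqrt; simpl; nra. }
  assert (Hsp : 0 < sqrt (1 + x ^ 2)) by (apply sqrt_lt_R0; simpl; nra).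
  unfold cis. rewrite cos_plus, sin_plus, cos_PI, sin_PI, cos_2a, sin_2a, cos_atan, sin_atan.
  unfold cayN, Cdiv.
  assert (E : (/ (1 - Ci * RtoC x))%C = (/ (1 + x * x), x / (1 + x * x))).
  { apply Ceq; unfold Cinv; simpl; field; nra. }
  rewrite E.
  replace (1 / sqrt (1 + x²)) with (/ sqrt (1 + x ^ 2)) by (unfold Rdiv, Rsqr; simpl; rewrite Rmult_1_r; ring).
  replace (x / sqrt (1 + x²)) with (x * / sqrt (1 + x ^ 2)) by (unfold Rdiv, Rsqr; simpl; rewrite Rmult_1_r; ring).
  assert (Hi : / sqrt (1 + x ^ 2) * / sqrt (1 + x ^ 2) = / (1 + x * x)).
  { rewrite <- Rinv_mult, Hs. reflexivity. }
  set (s := / sqrt (1 + x ^ 2)) in *. assert (Hii : / (1 + x * x) * (1 + x * x) = 1) by (field; lra).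
  rewrite <- Hi in *. clearbody s. unfold Rdiv. rewrite <- Hi.
  apply Ceq; simpl; nra.
Qed.

Definition icay (zb z : C) : C := (Ci * (2 * zb / (zb - z) - 1))%C.

Lemma cayN_icay (zb z : C) : cayN (icay zb z) = (2 * zb / (zb - z))%C.
Proof. unfold cayN, icay. set (q := (2 * zb / (zb - z))%C). destruct q. apply Ceq; simpl; ring. Qed.

Lemma icay_im (zb z : C) : z <> zb -> Cmod z <= Cmod zb -> 0 <= Im (icay zb z).
Proof.
  intros Hn Hz. assert (Hd : 0 < Cmod (zb - z)%C) by (apply Cmod_minus_pos; auto).
  replace (Im (icay zb z)) with (Re (2 * zb / (zb - z)) - 1).
  2:{ unfold icay. set (q := (2 * zb / (zb - z))%C). destruct q. simpl. ring. }
  assert (Hs : Re z * Re z + Im z * Im z <= Re zb * Re zb + Im zb * Im zb).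
  { pose proof (Cmod2_alt z) as Ha. pose proof (Cmod2_alt zb) as Hb. simpl in *.
    pose proof (Cmod_ge_0 z). nra. }
  assert (Hd2 : 0 < (Re zb - Re z) * (Re zb - Re z) + (Im zb - Im z) * (Im zb - Im z)).
  { pose proof (Cmod2_alt (zb - z)%C) as Ha. simpl in Ha. unfold Re, Im in *.
    assert (0 < Cmod (zb - z) * Cmod (zb - z)) by (apply Rmult_lt_0_compat; auto). nra. }
  assert (E : Re (2 * zb / (zb - z)) * ((Re zb - Re z) * (Re zb - Re z) + (Im zb - Im z) * (Im zb - Im z))
    = 2 * (Re zb * (Re zb - Re z) + Im zb * (Im zb - Im z))).
  { destruct zb, z. unfold Re, Im in *. simpl in *. field. nra. }
  nra.
Qed.

Lemma icay_cay (zb z : C) : zb <> 0 -> 0 <= Im z -> icay zb (cay zb z) = z.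
Proof.
  intros Hzb Hz. pose proof (cayN_nz z Hz) as Hn.
  unfold icay. replace (zb - cay zb z)%C with (2 * zb / cayN z)%C by (unfold cay; field; auto).
  replace (2 * zb / (2 * zb / cayN z))%C with (cayN z).
  - unfold cayN. destruct z. apply Ceq; simpl; ring.
  - field. auto.
Qed.

Lemma cay_icay (zb z : C) : zb <> 0 -> z <> zb -> cay zb (icay zb z) = z.
Proof.
  intros Hzb Hz. unfold cay. rewrite cayN_icay. field. split; auto. apply Cminus_neq_0; auto.
Qed.

Lemma icay_dist (zb z w : C) (del : R) : 0 < del -> del <= Cmod (z - zb)%C -> del <= Cmod (w - zb)%C ->
  Cmod (icay zb z - icay zb w)%C <= 2 * Cmod zb * Cmod (z - w)%C / (del * del).
Proof.
  intros Hd Hz Hw. rewrite Cmod_minus_sym in Hz, Hw.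
  assert (Nz : (zb - z)%C <> 0) by (apply Cmod_pos_nz; lra).
  assert (Nw : (zb - w)%C <> 0) by (apply Cmod_pos_nz; lra).
  replace (icay zb z - icay zb w)%C with (Ci * (2 * zb * (z - w)) / ((zb - z) * (zb - w)))%C
    by (unfold icay; field; auto).
  rewrite Cmod_div by (apply Cmult_neq_0; auto). rewrite !Cmod_mult, Cmod_Ci, Cmod_R.
  rewrite Rabs_right, Rmult_1_l by lra. apply Rmult_le_compat_l.
  - pose proof (Cmod_ge_0 zb). pose proof (Cmod_ge_0 (z - w)%C). nra.
  - apply Rinv_le_contravar; [nra|]. apply Rmult_le_compat; lra.
Qed.

(* Number of odd multiples of [PI] below [a], up to a constant. *)
Definition oddpi (a : R) : Z := (- Int_part ((PI - a) / (2 * PI)))%Z.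

Lemma oddpi_spec (a : R) : 0 < a - PI - 2 * PI * (IZR (oddpi a) - 1) <= 2 * PI.
Proof.
  unfold oddpi. rewrite opp_IZR. destruct (base_Int_part ((PI - a) / (2 * PI))) as [H1 H2].
  pose proof PI_RGT_0. set (k := IZR _) in *.
  assert (E : (PI - a) / (2 * PI) * (2 * PI) = PI - a) by (field; lra).
  set (x := (PI - a) / (2 * PI)) in *. nra.
Qed.

Lemma oddpi_unique (a : R) (k : Z) : 0 < a - PI - 2 * PI * (IZR k - 1) <= 2 * PI -> oddpi a = k.
Proof.
  intros H. pose proof (oddpi_spec a) as H'. pose proof PI_RGT_0.
  assert (A : IZR (oddpi a) < IZR k + 1) by nra. assert (B : IZR k < IZR (oddpi a) + 1) by nra.
  rewrite <- plus_IZR in A, B. apply lt_IZR in A, B. lia.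
Qed.

Lemma cos_sin_2kpi (a : R) (k : Z) : cos (a + 2 * PI * IZR k) = cos a /\ sin (a + 2 * PI * IZR k) = sin a.
Proof.
  destruct (Z_le_dec 0 k) as [L|L].
  - replace k with (Z.of_nat (Z.to_nat k)) by lia. rewrite <- INR_IZR_INZ.
    replace (2 * PI * INR (Z.to_nat k)) with (2 * INR (Z.to_nat k) * PI) by ring.
    now rewrite cos_period, sin_period.
  - set (k' := Z.to_nat (- k)).
    rewrite <- (cos_period (a + 2 * PI * IZR k) k'), <- (sin_period (a + 2 * PI * IZR k) k').
    replace (a + 2 * PI * IZR k + 2 * INR k' * PI) with a; auto.
    rewrite INR_IZR_INZ. unfold k'. rewrite Z2Nat.id by lia. rewrite opp_IZR. ring.
Qed.

(** Without full turns and a half turn, [al] lies in [(0, 2 PI]], and the negative axis sits at the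
    ends of this interval. The cases are whether [be] leaves it on the left, stays, or leaves it on
    the right; a step below [1/2] cannot reach the positive axis from the half-plane [cos a < 0]. *)
Lemma crossing_count (a b ra rb : R) : 0 < ra -> 0 < rb -> Rabs (b - a) < 1 / 2 ->
  (if Rlt_dec (ra * cos a) 0 then
    ((if Rlt_dec (ra * sin a) 0 then 0 else 1) - (if Rlt_dec (rb * sin b) 0 then 0 else 1))%Z
   else 0%Z) = (oddpi b - oddpi a)%Z.
Proof.
  intros Hra Hrb Hab. apply Rabs_def2 in Hab.
  pose proof PI_RGT_0 as Hpi. pose proof PI2_3_2 as Hpi2.
  set (M := oddpi a). pose proof (oddpi_spec a) as Ha. fold M in Ha.
  set (al := a - PI - 2 * PI * (IZR M - 1)) in *.
  set (be := b - PI - 2 * PI * (IZR M - 1)).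
  assert (Hbe : -1 / 2 < be - al < 1 / 2) by (unfold be, al; lra).
  assert (Ea : a = (al + PI) + 2 * PI * IZR (M - 1)) by (rewrite minus_IZR; unfold al; ring).
  assert (Eb : b = (be + PI) + 2 * PI * IZR (M - 1)) by (rewrite minus_IZR; unfold be; ring).
  assert (ca : cos a = - cos al) by (rewrite Ea, (proj1 (cos_sin_2kpi _ _)), neg_cos; ring).
  assert (sa : sin a = - sin al) by (rewrite Ea, (proj2 (cos_sin_2kpi _ _)), neg_sin; ring).
  assert (sb : sin b = - sin be) by (rewrite Eb, (proj2 (cos_sin_2kpi _ _)), neg_sin; ring).
  rewrite ca, sa, sb. clear ca sa sb.
  assert (Sg : forall r x, 0 < r -> x <= 0 -> (if Rlt_dec (r * - x) 0 then 0 else 1)%Z = 1%Z).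
  { clear. intros r x Hr Hx. destruct (Rlt_dec _ _); auto. nra. }
  assert (Sg' : forall r x, 0 < r -> 0 < x -> (if Rlt_dec (r * - x) 0 then 0 else 1)%Z = 0%Z).
  { clear. intros r x Hr Hx. destruct (Rlt_dec _ _); auto. nra. }
  assert (Sc : 0 < cos al -> ra * - cos al < 0) by (clear - Hra; intros; nra).
  assert (Sc' : ra * - cos al < 0 -> 0 < cos al) by (clear - Hra; intros; nra).
  assert (cneg : PI / 2 <= al <= 3 * (PI / 2) -> cos al <= 0) by (intros; apply cos_le_0; lra).
  assert (snp : PI <= al -> sin al <= 0) by (intros; apply sin_le_0; lra).
  destruct (Rle_lt_dec be 0) as [B0|B0].
  { assert (Ob : oddpi b = (M - 1)%Z).
    { apply oddpi_unique. rewrite minus_IZR. unfold be in *. lra. }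
    rewrite Ob. assert (0 < cos al) by (apply cos_gt_0; lra).
    assert (0 < sin al) by (apply sin_gt_0; lra).
    assert (sin be <= 0).
    { replace be with (- - be) by ring. rewrite sin_neg. assert (0 <= sin (- be)) by (apply sin_ge_0; lra). lra. }
    rewrite (Sg' ra), (Sg rb) by auto. destruct (Rlt_dec _ _) as [|L]; [lia|]. destruct L; auto. }
  destruct (Rle_lt_dec be (2 * PI)) as [B1|B1].
  { assert (Ob : oddpi b = M). { apply oddpi_unique. unfold be in *. lra. }
    rewrite Ob. destruct (Rlt_dec (ra * - cos al) 0) as [L|L]; [|lia].
    specialize (Sc' L).
    assert (al < PI / 2 \/ 3 * (PI / 2) < al).
    { destruct (Rlt_le_dec al (PI / 2)); auto. destruct (Rlt_le_dec (3 * (PI / 2)) al); auto.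
      exfalso. assert (cos al <= 0) by (apply cneg; lra). lra. }
    clear Sc.
    match goal with H : _ \/ _ |- _ => destruct H as [H0|H0] end.
    - rewrite (Sg' ra), (Sg' rb); auto; [lia| |]; apply sin_gt_0; lra.
    - rewrite (Sg ra), (Sg rb); auto; [lia| |apply snp; lra]. apply sin_le_0; lra. }
  assert (Ob : oddpi b = (M + 1)%Z).
  { apply oddpi_unique. rewrite plus_IZR. unfold be in *. lra. }
  rewrite Ob.
  assert (0 < cos al).
  { rewrite <- (cos_period al 0), <- cos_neg. simpl INR.
    replace (- (al + 2 * 0 * PI)) with ((2 * PI - al) - 2 * PI) by ring.
    rewrite <- (cos_period (2 * PI - al - 2 * PI) 1). simpl INR.
    replace (2 * PI - al - 2 * PI + 2 * 1 * PI) with (2 * PI - al) by ring.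
    apply cos_gt_0; lra. }
  assert (0 < sin be).
  { replace be with ((be - 2 * PI) + 2 * INR 1 * PI) by (simpl; ring). rewrite sin_period.
    apply sin_gt_0; lra. }
  rewrite (Sg ra), (Sg' rb) by (auto; apply snp; lra). destruct (Rlt_dec _ _) as [|L]; [lia|]. destruct L; auto.
Qed.

(** Chains of mesh [eps] stand in for connected components; the uniform mesh keeps inequivalent
    points at a definite distance, as entropy requires. *)
Definition stepD (g : C -> C) (r eps : R) (t p q : C) : Prop :=
  Cmod (p - q)%C < eps /\ Cmod p <= r /\ Cmod q <= r /\
  Cmod (g p - t)%C < 1 / 10 /\ Cmod (g q - t)%C < 1 / 10.

Lemma Int_part_IZR (k : Z) : Int_part (IZR k) = k.
Proof. symmetry. apply Int_part_spec. lra. Qed.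

Lemma Int_part_close (a b : R) : Rabs (a - b) < 1 ->
  (-1 <= Int_part a - Int_part b <= 1)%Z.
Proof.
  intros H. apply Rabs_def2 in H.
  destruct (base_Int_part a) as [A1 A2]. destruct (base_Int_part b) as [B1 B2].
  assert (H1 : IZR (Int_part a - Int_part b) < 2) by (rewrite minus_IZR; lra).
  assert (H2 : -2 < IZR (Int_part a - Int_part b)) by (rewrite minus_IZR; lra).
  apply lt_IZR in H1, H2. lia.
Qed.

Lemma exists_angle (phi : R -> R) (d : nat) (al : R) : (forall t, continuity_pt phi t) ->
  phi (2 * PI) = phi 0 + 2 * PI * INR d -> (1 <= d)%nat ->
  exists t K, phi t = al + 2 * PI * IZR K.
Proof.
  intros Hc Hp Hd. pose proof PI_RGT_0 as Hpi.
  set (x := (al - phi 0) / (2 * PI)). destruct (base_Int_part x) as [X1 X2].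
  set (K := (- Int_part x)%Z).
  assert (HK : IZR K = - IZR (Int_part x)) by (unfold K; apply opp_IZR).
  assert (Ex : x * (2 * PI) = al - phi 0) by (unfold x; field; lra).
  apply le_INR in Hd. simpl in Hd.
  destruct (IVT_cor (fun t => phi t - (al + 2 * PI * IZR K)) 0 (2 * PI)) as [t [_ Ht]].
  - intros t. apply continuity_pt_minus; auto. apply continuity_pt_const. intros ? ?. reflexivity.
  - lra.
  - rewrite Hp, HK.
    assert (0 <= phi 0 + 2 * PI * INR d - (al + 2 * PI * - IZR (Int_part x))) by nra.
    assert (phi 0 - (al + 2 * PI * - IZR (Int_part x)) <= 0) by nra. nra.
  - exists t, K. lra.
Qed.

Lemma atan_large (X : R) : 0 < X -> PI - 2 * atan X <= 2 / X.
Proof.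
  intros HX. pose proof (atan_inv X HX) as E.
  pose proof (atan_lipschitz (/ X) 0) as L. rewrite atan_0, !Rminus_0_r in L.
  rewrite (Rabs_right (/ X)) in L by (apply Rle_ge; left; now apply Rinv_0_lt_compat).
  pose proof (Rle_abs (atan (/ X))). unfold Rdiv. lra.
Qed.

(** For the original colouring no value is reflected: [Re < 1/2] and [|Re - 1/2| > 1/2] together say
    [Re < 0], so genuine crossings of the negative axis are counted. *)
Lemma kp_col0 (G : vtx -> C) (p q : vtx) : kp G (col0 G) p q =
  if Rlt_dec (Re (G p)) 0 then (sgn G p - sgn G q)%Z else 0%Z.
Proof.
  unfold kp, col0. destruct (Rlt_dec (Re (G p)) (1 / 2)), (Rlt_dec (Re (G p)) 0); try lra; auto;
  destruct (Rlt_dec (1 / 2) _) as [H|H]; auto; exfalso.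
  - apply H. rewrite Rabs_left; lra.
  - revert H. apply Rle_not_lt. apply Rabs_le. lra.
Qed.

Section DiscPieces.
Variables (g : C -> C) (r : R) (d : nat) (phi : R -> R).
Hypothesis Hr : 0 < r.
Hypothesis Hg : forall z, ccont g z.
Hypothesis Hbig : forall z, Cmod z = r -> 10 <= Cmod (g z).
Hypothesis Hlift : forall t, g (RtoC r * cis t)%C = (RtoC (Cmod (g (RtoC r * cis t)%C)%C) * cis (phi t))%C.
Hypothesis Hphi : forall t, continuity_pt phi t.
Hypothesis Hper : forall t, phi (t + 2 * PI) = phi t + 2 * PI * INR d.
Hypothesis Hd : (2 <= d)%nat.

Lemma disc_pieces : exists (eps : R) (t : C) (vs : list C), 0 < eps /\ (t = 0 \/ t = 1) /\ (d <= 2 * length vs)%nat /\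
  (forall v, In v vs -> Cmod v <= r /\ Cmod (g v - t)%C < 1 / 10) /\
  ForallOrdPairs (fun v w => ~ rtc (stepD g r eps t) v w) vs.
Proof.
  pose proof PI_RGT_0 as Hpi.
  (* Cutting the circle where the argument is [PI / 4] makes [Im] large and positive near [zb], as
     [Gside] demands on the three outer sides. *)
  destruct (exists_angle phi d (PI / 4)) as [tb [K HK]]; auto.
  { rewrite <- (Rplus_0_l (2 * PI)) at 1. apply Hper. }
  { lia. }
  set (zb := (RtoC r * cis tb)%C).
  assert (Hzb : Cmod zb = r) by (apply Cmod_rcis; lra).
  assert (Hzb0 : zb <> 0) by (apply Cmod_pos_nz; lra).
  assert (Hgb : 7 <= Re (g zb) /\ 7 <= Im (g zb)).
  { pose proof (Hbig zb Hzb) as B. unfold zb. rewrite Hlift. fold zb. rewrite HK.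
    unfold cis. destruct (cos_sin_2kpi (PI / 4) K) as [-> ->].
    rewrite cos_PI4, sin_PI4. simpl.
    assert (S2 : sqrt 2 * sqrt 2 = 2) by (apply sqrt_sqrt; lra).
    assert (S0 : 0 < sqrt 2) by (apply sqrt_lt_R0; lra).
    assert (S1 : 7 / 10 <= 1 / sqrt 2).
    { apply (Rmult_le_reg_r (sqrt 2)); auto. replace (1 / sqrt 2 * sqrt 2) with 1 by (field; lra). nra. }
    split; nra. }
  destruct (unif_ccont (fun z => Cmod (z - 0)%C <= r) g (disc_compact 0 r)) with (eps := 1 / 100)
    as [d1 [Hd1 U1]]; [auto|lra|].
  assert (U : forall z w, Cmod z <= r -> Cmod (w - z)%C < d1 -> Cmod (g w - g z)%C < 1 / 100).
  { intros z w Hz. apply U1. now replace (z - 0)%C with z by ring. }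
  destruct (Hg zb 1) as [d2 [Hd2 U2]]; [lra|].
  destruct (@Heine_cor2 phi tb (tb + 2 * PI) (fun x _ => Hphi x) (mkposreal (1 / 2) ltac:(lra)))
    as [[d3 Hd3] U3]. simpl in U3.
  (* This mesh makes [g] vary by less than [1/100] between neighbouring vertices, since [cay] has
     Lipschitz constant [2 r], and the argument by less than [1/2] along the bottom row. *)
  set (h := Rmin (d1 / (8 * r)) (d3 / 8)).
  assert (Hh : 0 < h) by (apply Rmin_pos; [apply Rdiv_lt_0_compat; lra|lra]).
  assert (Hh1 : h * (8 * r) <= d1).
  { replace d1 with (d1 / (8 * r) * (8 * r)) by (field; lra). apply Rmult_le_compat_r; [lra|apply Rmin_l]. }
  assert (Hh3 : h <= d3 / 8) by apply Rmin_r. clearbody h.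
  set (B := 2 * r / d2). assert (HB : 0 < B) by (apply Rdiv_lt_0_compat; lra).
  assert (HBd : B * d2 = 2 * r) by (unfold B; field; lra).
  destruct (nfloor_ex ((B + h + 4 / d3) / h)) as [N0 [_ HN0]].
  { apply Rmult_le_pos; [|left; now apply Rinv_0_lt_compat].
    assert (0 < 4 / d3) by (apply Rdiv_lt_0_compat; lra). lra. }
  (* [B] places the three outer sides within [d2] of [zb]; [4 / d3] brings the two ends of the
     bottom row within angle [d3] of the cut. *)
  set (N := S N0). assert (HN : B + h + 4 / d3 < h * INR N).
  { unfold N. rewrite S_INR. apply (Rmult_lt_compat_r h) in HN0; auto.
    replace ((B + h + 4 / d3) / h * h) with (B + h + 4 / d3) in HN0 by (field; lra). lra. }
  clearbody N. clear HN0.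
  assert (H4d : 0 < 4 / d3) by (apply Rdiv_lt_0_compat; lra).
  set (n := (N + N)%nat).
  set (zeta := fun v : vtx => (h * (IZR (fst v) - INR N), h * IZR (snd v)) : C).
  set (Zv := fun v : vtx => cay zb (zeta v)).
  set (G := fun v => g (Zv v)).
  assert (Him : forall v, inbox n N v -> 0 <= Im (zeta v)).
  { intros v [_ [Hv _]]. simpl. apply IZR_le in Hv. nra. }
  assert (HZr : forall v, inbox n N v -> Cmod (Zv v) <= r).
  { intros v Hv. rewrite <- Hzb. apply cay_bound. auto. }
  assert (Hclose : forall v z, inbox n N v -> 0 <= Im z -> Cmod (zeta v - z)%C <= 2 * h ->
    Cmod (G v - g (cay zb z))%C < 1 / 100).
  { intros v z Hv Hz Hvz. apply U.
    - rewrite <- Hzb. now apply cay_bound.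
    - eapply Rle_lt_trans; [apply cay_dist; auto|]. rewrite Hzb.
      apply Rle_lt_trans with (2 * r * (2 * h)); [apply Rmult_le_compat_l; lra|]. nra. }
  assert (Gosc : forall p q, inbox n N p -> inbox n N q -> adj p q -> Cmod (G p - G q)%C <= 1 / 100).
  { intros p q Hp Hq [A1 [A2 _]]. left. apply (Hclose p (zeta q)); auto.
    eapply Rle_trans; [apply Cmod_le_re_im|].
    change (Re (zeta p - zeta q)%C) with (h * (IZR (fst p) - INR N) - h * (IZR (fst q) - INR N)).
    change (Im (zeta p - zeta q)%C) with (h * IZR (snd p) - h * IZR (snd q)).
    assert (Hab : forall x y : Z, (-1 <= y - x <= 1)%Z -> Rabs (h * IZR x - h * IZR y) <= h).
    { intros x y [K1 K2]. apply IZR_le in K1, K2. rewrite minus_IZR in K1, K2.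
      apply Rabs_le. nra. }
    replace (h * (IZR (fst p) - INR N) - h * (IZR (fst q) - INR N)) with
      (h * IZR (fst p) - h * IZR (fst q)) by ring.
    pose proof (Hab _ _ A1). pose proof (Hab _ _ A2). lra. }
  assert (Hfar : forall z, 0 <= Im z -> B < Cmod (cayN z) -> Cmod (g (cay zb z) - g zb)%C < 1).
  { intros z Hz HBz. apply U2. pose proof (cay_near zb z Hz) as E. rewrite Hzb in E.
    pose proof (Cmod_ge_0 (cay zb z - zb)%C). nra. }
  assert (Gside : forall p, inbox n N p -> (fst p = 0 \/ fst p = Z.of_nat n \/ snd p = Z.of_nat N)%Z ->
    0 < Im (G p)).
  { intros p Hp Hs. assert (Hf : Cmod (G p - g zb)%C < 1).
    { apply Hfar; auto. destruct Hs as [E|[E|E]].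
      - eapply Rlt_le_trans; [|apply cayN_ge_re]. simpl. rewrite E.
        rewrite Rabs_left; lra.
      - eapply Rlt_le_trans; [|apply cayN_ge_re]. simpl. rewrite E, <- INR_IZR_INZ.
        unfold n. rewrite plus_INR. rewrite Rabs_right; lra.
      - eapply Rlt_le_trans; [|apply cayN_ge; auto]. simpl. rewrite E, <- INR_IZR_INZ. lra. }
    pose proof (im_le_Cmod (G p - g zb)%C) as Hi.
    change (Im (G p - g zb)%C) with (Im (G p) - Im (g zb)) in Hi.
    assert (Hi' : Rabs (Im (G p) - Im (g zb)) < 1) by lra. apply Rabs_def2 in Hi'. lra. }
  set (th := fun k : nat => tb + (PI + 2 * atan (h * (INR k - INR N)))).
  assert (Hbot : forall k, Zv (bot k) = (RtoC r * cis (th k))%C).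
  { intros k. unfold Zv, th. replace (zeta (bot k)) with (RtoC (h * (INR k - INR N))).
    - rewrite cay_real, (cis_plus tb). unfold zb. ring.
    - unfold zeta, bot, RtoC. simpl. rewrite <- INR_IZR_INZ. f_equal. ring. }
  assert (Gbot : forall p, inbox n N p -> (snd p = 0)%Z -> 9 <= Cmod (G p)).
  { intros [i j] [[Hi _] _] Hj. simpl in Hi, Hj. subst j.
    replace (i, 0%Z) with (bot (Z.to_nat i)) by (unfold bot; f_equal; lia).
    unfold G. rewrite Hbot. assert (10 <= Cmod (g (RtoC r * cis (th (Z.to_nat i)))%C)%C); [|lra].
    apply Hbig. apply Cmod_rcis; lra. }
  assert (Hth : forall k, tb <= th k <= tb + 2 * PI).
  { intros k. unfold th. pose proof (atan_bound (h * (INR k - INR N))). lra. }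
  assert (Hbs : bsum G (col0 G) n = (oddpi (phi (th n)) - oddpi (phi (th O)))%Z).
  { apply (zsum_telescope _ (fun k => oddpi (phi (th k)))). intros k Hk.
    replace (Z.of_nat k + 1, 0)%Z with (bot (S k)) by (unfold bot; f_equal; lia).
    fold (bot k). rewrite kp_col0. unfold sgn.
    assert (E : forall k, G (bot k) = (RtoC (Cmod (G (bot k))) * cis (phi (th k)))%C).
    { intros k0. unfold G. rewrite Hbot. apply Hlift. }
    assert (P : forall k, 0 < Cmod (G (bot k))).
    { intros k0. unfold G. rewrite Hbot. assert (10 <= Cmod (g (RtoC r * cis (th k0))%C)%C); [|lra].
      apply Hbig. apply Cmod_rcis; lra. }
    assert (Er : forall k, Re (G (bot k)) = Cmod (G (bot k)) * cos (phi (th k))).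
    { intros k0. rewrite E at 1. simpl. ring. }
    assert (Ei : forall k, Im (G (bot k)) = Cmod (G (bot k)) * sin (phi (th k))).
    { intros k0. rewrite E at 1. simpl. ring. }
    rewrite (Er k), (Ei k), (Ei (S k)). apply crossing_count; auto.
    apply U3; auto. unfold th.
    replace (tb + (PI + 2 * atan (h * (INR (S k) - INR N))) - (tb + (PI + 2 * atan (h * (INR k - INR N)))))
      with (2 * (atan (h * (INR (S k) - INR N)) - atan (h * (INR k - INR N)))) by ring.
    rewrite Rabs_mult, (Rabs_right 2) by lra.
    pose proof (atan_lipschitz (h * (INR (S k) - INR N)) (h * (INR k - INR N))) as L.
    replace (h * (INR (S k) - INR N) - h * (INR k - INR N)) with h in L by (rewrite S_INR; ring).
    rewrite (Rabs_right h) in L by lra. lra. }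
  assert (HXN : 0 < h * INR N) by lra.
  assert (Hat : PI - 2 * atan (h * INR N) < d3).
  { eapply Rle_lt_trans; [apply atan_large; auto|].
    apply (Rmult_lt_reg_r (h * INR N)); auto. replace (2 / (h * INR N) * (h * INR N)) with 2.
    - assert (4 / d3 * d3 = 4) by (field; lra). assert (4 / d3 < h * INR N) by lra. nra.
    - field. split; [|lra]. intros E. rewrite E in HXN. lra. }
  assert (Hat' : 0 <= PI - 2 * atan (h * INR N)) by (pose proof (atan_bound (h * INR N)); lra).
  assert (O0 : oddpi (phi (th O)) = K).
  { apply oddpi_unique.
    assert (H0 : Rabs (phi (th O) - phi tb) < 1 / 2).
    { apply U3; [apply Hth|lra|]. unfold th. simpl INR.
      replace (h * (0 - INR N)) with (- (h * INR N)) by ring. rewrite atan_opp.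
      rewrite Rabs_right; lra. }
    apply Rabs_def2 in H0. rewrite HK in H0. pose proof PI2_3_2. nra. }
  assert (On : oddpi (phi (th n)) = (K + Z.of_nat d)%Z).
  { apply oddpi_unique. rewrite plus_IZR, <- INR_IZR_INZ.
    assert (H0 : Rabs (phi (th n) - phi (tb + 2 * PI)) < 1 / 2).
    { apply U3; [apply Hth|lra|]. unfold th, n. rewrite plus_INR.
      replace (h * (INR N + INR N - INR N)) with (h * INR N) by ring.
      apply Rabs_def1; lra. }
    apply Rabs_def2 in H0. rewrite Hper, HK in H0. pose proof PI2_3_2. nra. }
  destruct (grid_pieces n N G d Gosc Gside Gbot Hd) as [t [vs [Ht [Hlen [Hvs HF]]]]].
  { rewrite Hbs, O0, On. lia. }
  (* Outside the [d2]-neighbourhood of [zb], [icay] has Lipschitz constant [2 r / d2^2], so steps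
     below [eps] become steps below [h]. *)
  set (eps := h * (d2 * d2) / (2 * r)).
  assert (Heps : 0 < eps).
  { apply Rdiv_lt_0_compat; [|lra]. repeat apply Rmult_lt_0_compat; auto. }
  exists eps, t, (map Zv vs). split; [auto|]. split; [auto|].
  split; [now rewrite length_map|]. split.
  { intros v Hv. apply in_map_iff in Hv. destruct Hv as [p [<- Hp]].
    destruct (Hvs p Hp) as [H1 H2]. split; auto. }
  assert (Ht1 : Cmod t <= 1) by (destruct Ht as [->| ->]; [rewrite Cmod_0; lra|rewrite Cmod_1; lra]).
  (* Rounding in the half-plane turns chains in the disc into chains in the grid and fixes grid
     vertices; so pieces separated in the grid are separated in the disc. *)
  set (rd := fun z : C => ((Int_part (Re (icay zb z) / h) + Z.of_nat N)%Z, Int_part (Im (icay zb z) / h)) : vtx).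
  assert (Hrd : forall z, Cmod z <= r -> Cmod (g z - t)%C < 1 / 10 ->
    z <> zb /\ d2 <= Cmod (z - zb)%C /\ inbox n N (rd z) /\ Cmod (G (rd z) - t)%C <= 12 / 100).
  { intros z Hz Hgt.
    assert (Hdz : d2 <= Cmod (z - zb)%C).
    { apply Rnot_lt_le. intros L. specialize (U2 z L).
      pose proof (Cmod_tri_minus (g zb) (g z) t) as T. rewrite (Cmod_minus_sym (g zb) (g z)) in T.
      pose proof (Cmod_le_sub (g zb) t). pose proof (Hbig zb Hzb). lra. }
    assert (Hnz : z <> zb).
    { intros ->. replace (zb - zb)%C with (RtoC 0) in Hdz by ring. rewrite Cmod_0 in Hdz. lra. }
    assert (Hi : 0 <= Im (icay zb z)) by (apply icay_im; auto; rewrite Hzb; auto).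
    assert (HNb : Cmod (cayN (icay zb z)) <= B).
    { rewrite cayN_icay, Cmod_div, Cmod_mult, Hzb, Cmod_R, Rabs_right by (try lra; apply Cminus_neq_0; auto).
      unfold B. apply Rmult_le_compat_l; [lra|]. apply Rinv_le_contravar; auto.
      now rewrite Cmod_minus_sym. }
    pose proof (cayN_ge_re (icay zb z)) as C1. pose proof (cayN_ge _ Hi) as C2.
    set (x := Re (icay zb z)) in *. set (y := Im (icay zb z)) in *.
    assert (Hx : - B <= x <= B) by (apply Rabs_le_between; lra).
    destruct (base_Int_part (x / h)) as [I1 I2]. destruct (base_Int_part (y / h)) as [J1 J2].
    assert (Ex : x / h * h = x) by (field; lra). assert (Ey : y / h * h = y) by (field; lra).
    assert (Hin : inbox n N (rd z)).
    { unfold inbox, rd. cbn [fst snd]. fold x y.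
      assert (A1 : -1 - INR N < IZR (Int_part (x / h))) by nra.
      assert (A2 : IZR (Int_part (x / h)) < INR N + 1) by nra.
      assert (A3 : -1 < IZR (Int_part (y / h))) by nra.
      assert (A4 : IZR (Int_part (y / h)) < INR N + 1) by nra.
      rewrite INR_IZR_INZ in A1, A2, A4.
      rewrite <- plus_IZR in A2, A4. rewrite <- minus_IZR in A1.
      apply lt_IZR in A1, A2, A3, A4. unfold n. lia. }
    repeat split; auto; try apply Hin.
    assert (Hc := Hclose (rd z) (icay zb z) Hin Hi). rewrite cay_icay in Hc by auto.
    assert (Hzd : Cmod (zeta (rd z) - icay zb z)%C <= 2 * h).
    { eapply Rle_trans; [apply Cmod_le_re_im|].
      change (Re (zeta (rd z) - icay zb z)%C) with (h * (IZR (Int_part (x / h) + Z.of_nat N) - INR N) - x).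
      change (Im (zeta (rd z) - icay zb z)%C) with (h * IZR (Int_part (y / h)) - y).
      rewrite plus_IZR, <- INR_IZR_INZ.
      assert (Rabs (h * (IZR (Int_part (x / h)) + INR N - INR N) - x) <= h) by (apply Rabs_le; nra).
      assert (Rabs (h * IZR (Int_part (y / h)) - y) <= h) by (apply Rabs_le; nra). lra. }
    specialize (Hc Hzd). pose proof (Cmod_tri_minus (G (rd z)) (g z) t). lra. }
  assert (Hstep : forall p q, stepD g r eps t p q -> rtc (stepU n N G t) (rd p) (rd q)).
  { intros p q [S1 [S2 [S3 [S4 S5]]]].
    destruct (Hrd p S2 S4) as [P1 [P2 [P3 P4]]]. destruct (Hrd q S3 S5) as [Q1 [Q2 [Q3 Q4]]].
    assert (Hdist : Cmod (icay zb p - icay zb q)%C < h).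
    { eapply Rle_lt_trans; [apply (icay_dist zb p q d2); auto|]. rewrite Hzb.
      apply (Rmult_lt_reg_r (d2 * d2)); [nra|].
      replace (2 * r * Cmod (p - q) / (d2 * d2) * (d2 * d2)) with (2 * r * Cmod (p - q)) by (field; lra).
      assert (E : eps * (2 * r) = h * (d2 * d2)) by (unfold eps; field; lra). nra. }
    assert (Hab : forall a b, Rabs (a - b) < h -> Rabs (a / h - b / h) < 1).
    { intros a b H. replace (a / h - b / h) with ((a - b) * / h) by (field; lra).
      rewrite Rabs_mult, (Rabs_right (/ h)) by (apply Rle_ge; left; now apply Rinv_0_lt_compat).
      apply (Rmult_lt_reg_r h); auto. rewrite Rmult_assoc, Rinv_l, Rmult_1_r by lra. lra. }
    pose proof (re_le_Cmod (icay zb p - icay zb q)%C) as Hre.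
    change (Re (icay zb p - icay zb q)%C) with (Re (icay zb p) - Re (icay zb q)) in Hre.
    pose proof (im_le_Cmod (icay zb p - icay zb q)%C) as Him'.
    change (Im (icay zb p - icay zb q)%C) with (Im (icay zb p) - Im (icay zb q)) in Him'.
    pose proof (Int_part_close _ _ (Hab _ _ (Rle_lt_trans _ _ _ Hre Hdist))) as I1.
    pose proof (Int_part_close _ _ (Hab _ _ (Rle_lt_trans _ _ _ Him' Hdist))) as I2.
    (* The rounded points may differ by [(1, -1)], which is no edge of the triangular lattice; the
       step is therefore made through a corner. *)
    set (mid := (fst (rd q), snd (rd p)) : vtx).
    assert (Hmid : inbox n N mid) by (unfold inbox, mid in *; simpl in *; lia).
    assert (Apm : adj (rd p) mid) by (unfold adj, mid, rd; cbn [fst snd]; lia).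
    assert (Amq : adj mid (rd q)) by (unfold adj, mid, rd; cbn [fst snd]; lia).
    assert (Hm : Cmod (G mid - t)%C <= 1 / 5).
    { pose proof (Gosc _ _ P3 Hmid Apm) as O. rewrite Cmod_minus_sym in O.
      pose proof (Cmod_tri_minus (G mid) (G (rd p)) t). lra. }
    apply (Relation_Operators.rt1n_trans _ _ _ mid).
    - split; [auto|]. split; [auto|]. split; [auto|]. split; lra.
    - apply rtc_one. split; [auto|]. split; [auto|]. split; [auto|]. split; lra. }
  assert (Hrr : forall p q, rtc (stepD g r eps t) p q -> rtc (stepU n N G t) (rd p) (rd q)).
  { intros p q Hpq. induction Hpq; [constructor|]. eapply rtc_trans; eauto. }
  assert (HrZ : forall v, inbox n N v -> rd (Zv v) = v).
  { intros v Hv. unfold rd, Zv. rewrite icay_cay by auto. unfold zeta. simpl.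
    replace (h * (IZR (fst v) - INR N) / h) with (IZR (fst v - Z.of_nat N))
      by (rewrite minus_IZR, <- INR_IZR_INZ; field; lra).
    replace (h * IZR (snd v) / h) with (IZR (snd v)) by (field; lra).
    rewrite !Int_part_IZR. destruct v; simpl. f_equal. lia. }
  eapply ForallOrdPairs_map; [exact HF|]. intros v w Hv Hw Hne Hvw. apply Hne.
  rewrite <- (HrZ v), <- (HrZ w) by (apply Hvs; auto). now apply Hrr.
Qed.
End DiscPieces.

(** * Realizing itineraries *)

Lemma entire_minus_const (f : C -> C) (c : C) : entire' f -> entire' (fun z => f z - c)%C.
Proof. intros Hf z. apply hol_minus; [auto|apply hol_const]. Qed.

Lemma closure_dist (O : C -> Prop) (a z : C) (r : R) : (forall w, O w -> Cmod (w - a)%C <= r) ->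
  closure O z -> Cmod (z - a)%C <= r.
Proof.
  intros H Hz. apply le_epsilon. intros eps He. destruct (Hz eps He) as [w [Hw Hd]].
  specialize (H w Hw). rewrite Cmod_minus_sym in Hd. pose proof (Cmod_tri_minus z w a). lra.
Qed.

Lemma closure_image (O O' : C -> Prop) (F : C -> C) (z : C) : ccont F z ->
  (forall w, O w -> O' (F w)) -> closure O z -> closure O' (F z).
Proof.
  intros HF H Hz eps He. destruct (HF eps He) as [d [Hd Hc]].
  destruct (Hz d Hd) as [w [Hw Hwz]]. exists (F w). auto.
Qed.

Section Itineraries.
Variables (f : C -> C) (delta : C) (r rho : R) (xs : nat -> C) (G : nat -> C -> Prop).

(* [orb (k+1) z] is the first coordinate of the [k]-th iterate of [(z, xs 0)]. *)
Fixpoint orb (k : nat) (z : C) : C :=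
  match k with
  | O => xs O
  | S j => match j with O => z | S i => (f (orb j z) - delta * orb i z)%C end
  end.

(** The value that [f] must take near [xs k] for an orbit coming from [xs (k - 1)] to arrive at
    [xs (k + 1)]. *)
Definition target (k : nat) : C := (xs (S k) + delta * xs (pred k))%C.

Hypothesis Hf : entire' f.
Hypothesis Hr : 0 < r.
Hypothesis Hrho : 3 * (1 + Cmod delta) * r <= rho.
Hypothesis G1 : forall k z, (1 <= k)%nat -> G k z -> Cmod (z - xs k)%C < r.
Hypothesis G2 : forall k, (1 <= k)%nat -> copen (G k).
Hypothesis G3 : forall k z, (1 <= k)%nat -> closure (G k) z -> ~ G k z -> rho <= Cmod (f z - target k)%C.
Hypothesis G4 : forall k, (1 <= k)%nat -> exists z, G k z /\ f z = target k.

Lemma orb_entire (k : nat) : entire' (orb k).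
Proof.
  enough (H : entire' (orb k) /\ entire' (orb (S k))) by apply H.
  induction k as [|k [IH1 IH2]].
  - split; intros z; [exact (hol_const _ z)|exact (hol_id z)].
  - split; auto. intros z. change (orb (S (S k))) with (fun z => f (orb (S k) z) - delta * orb k z)%C.
    apply hol_minus.
    + apply (hol_comp f); auto.
    + apply hol_mult; [apply hol_const|auto].
Qed.

Definition dom (k : nat) (z : C) : Prop := forall j, (1 <= j)%nat -> (j <= k)%nat -> G j (orb j z).

Lemma dom_open (k : nat) : copen (dom k).
Proof.
  induction k as [|k IH]; intros z Hz.
  - exists 1. split; [lra|]. intros w _ j Hj Hj'. lia.
  - destruct (IH z) as [s [Hs H1]]. { intros j Hj Hj'. apply Hz; lia. }
    destruct (G2 (S k) ltac:(lia) _ (Hz (S k) ltac:(lia) (le_n _))) as [e [He H2]].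
    destruct (hol_ccont _ _ (orb_entire (S k) z) e He) as [d [Hd H3]].
    exists (Rmin s d). split; [apply Rmin_pos; auto|]. intros w Hw j Hj Hj'.
    destruct (Nat.eq_dec j (S k)) as [->|Hne].
    + apply H2, H3. eapply Rlt_le_trans; [exact Hw|apply Rmin_r].
    + apply H1; [eapply Rlt_le_trans; [exact Hw|apply Rmin_l]|auto|lia].
Qed.

Lemma dom_closure (k j : nat) (z : C) : (1 <= j <= k)%nat -> closure (dom k) z ->
  closure (G j) (orb j z).
Proof.
  intros Hj. apply closure_image.
  - apply hol_ccont, orb_entire.
  - intros w Hw. apply Hw; lia.
Qed.

Lemma orb_near (k j : nat) (z : C) : (j <= k)%nat -> closure (dom k) z -> Cmod (orb j z - xs j)%C <= r.
Proof.
  intros Hj Hz. destruct j as [|j].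
  - simpl. replace (xs O - xs O)%C with (RtoC 0) by ring. rewrite Cmod_0. lra.
  - apply (closure_dist (G (S j))).
    + intros w Hw. left. apply G1; [lia|auto].
    + apply (dom_closure k); auto. lia.
Qed.

(** On the boundary of a region the next point of the orbit is thrown more than [r] away from the
    next centre, since [rho] exceeds [(1 + |delta|) r]. *)
Lemma orb_boundary (j : nat) (z : C) : (1 <= j)%nat -> closure (G j) (orb j z) -> ~ G j (orb j z) ->
  Cmod (orb (pred j) z - xs (pred j))%C <= r -> rho - Cmod delta * r <= Cmod (orb (S j) z - xs (S j))%C.
Proof.
  intros Hj Hc Hn Hp. destruct j as [|i]; [lia|].
  assert (H := G3 (S i) _ Hj Hc Hn). simpl pred in *.
  change (orb (S (S i)) z) with (f (orb (S i) z) - delta * orb i z)%C.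
  unfold target in H. simpl pred in H.
  set (A := f (orb (S i) z)) in *.
  replace (A - (xs (S (S i)) + delta * xs i))%C with
    ((A - delta * orb i z - xs (S (S i))) + delta * (orb i z - xs i))%C in H by ring.
  pose proof (Cmod_triangle (A - delta * orb i z - xs (S (S i)))%C (delta * (orb i z - xs i))%C) as T.
  rewrite Cmod_mult in T. pose proof (Cmod_ge_0 delta). nra.
Qed.

(** A boundary parameter of [dom (S k)] sits on the boundary of some region [G j]. For [j <= k] the
    next point would be outside its region, contradicting [orb_near]; so [j = S k], where
    [orb (S (S k))] is far from [y], and the minimum principle applies. *)
Lemma orb_onto (k : nat) : forall y, Cmod (y - xs (S k))%C <= r -> exists z, dom k z /\ orb (S k) z = y.
Proof.
  pose proof (Cmod_ge_0 delta) as Hd0.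
  induction k as [|k IH]; intros y Hy.
  - exists y. split; auto. intros j H1 H2. lia.
  - destruct (G4 (S k) ltac:(lia)) as [gk [Hg1 Hg2]].
    destruct (IH gk) as [z0 [Hz0 Ez0]]. { left. apply G1; [lia|auto]. }
    assert (Hdz0 : dom (S k) z0).
    { intros j H1 H2. destruct (Nat.eq_dec j (S k)) as [->|Hne]; [now rewrite Ez0|]. apply Hz0; lia. }
    (* At [z0] the value is within [(1 + |delta|) r] of [y]; on the boundary the distance is at
       least [rho - (1 + |delta|) r]. By [Hrho] the constant [2 (1 + |delta|) r] separates the
       two. *)
    destruct (min_principle (fun z => orb (S (S k)) z - y)%C (dom (S k)) (Cmod (xs 1%nat) + r)
      (2 * (1 + Cmod delta) * r) z0) as [z [Hz Ez]].
    + apply entire_minus_const, orb_entire.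
    + apply dom_open.
    + intros z Hz. specialize (Hz 1%nat (le_n _) ltac:(lia)). apply G1 in Hz; [|lia]. simpl in Hz.
      pose proof (Cmod_le_sub z (xs 1%nat)). lra.
    + intros z Hz Hnz.
      assert (Hj : exists j, (1 <= j <= S k)%nat /\ ~ G j (orb j z)).
      { apply NNPP. intros Hn. apply Hnz. intros j H1 H2. apply NNPP. intros Hgj. apply Hn. exists j. auto. }
      destruct Hj as [j [Hj1 Hj2]].
      assert (B := orb_boundary j z ltac:(lia) (dom_closure (S k) j z Hj1 Hz) Hj2
        (orb_near (S k) (pred j) z ltac:(lia) Hz)).
      destruct (Nat.eq_dec j (S k)) as [->|Hne].
      * pose proof (Cmod_tri_minus (orb (S (S k)) z) y (xs (S (S k)))). lra.
      * assert (N := orb_near (S k) (S j) z ltac:(lia) Hz). exfalso. nra.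
    + exact Hdz0.
    + change (orb (S (S k)) z0) with (f (orb (S k) z0) - delta * orb k z0)%C.
      rewrite Ez0, Hg2. unfold target. simpl pred.
      replace (xs (S (S k)) + delta * xs k - delta * orb k z0 - y)%C with
        (- (delta * (orb k z0 - xs k)) - (y - xs (S (S k))))%C by ring.
      eapply Rle_lt_trans; [apply Cmod_sub_le|]. rewrite Cmod_opp, Cmod_mult.
      assert (N := orb_near (S k) k z0 ltac:(lia) (closure_incl _ _ Hdz0)). nra.
    + exists z. split; auto. now apply Cminus_eq_0.
Qed.

(** A limit of parameters with longer and longer finite itineraries. The limit only stays in the
    closures, so the regions must later be separated together with their closures. *)
Lemma orb_itinerary : exists z, forall j, (1 <= j)%nat -> closure (G j) (orb j z).
Proof.
  assert (Hs : forall k, exists z, dom k z).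
  { intros k. destruct (orb_onto k (xs (S k))) as [z [Hz _]].
    - replace (xs (S k) - xs (S k))%C with (RtoC 0) by ring. rewrite Cmod_0. lra.
    - now exists z. }
  set (u := fun k => proj1_sig (constructive_indefinite_description _ (Hs (S k)))).
  assert (Hu : forall k, dom (S k) (u k)).
  { intros k. apply (proj2_sig (constructive_indefinite_description _ (Hs (S k)))). }
  destruct (BW_C u (Cmod (xs 1%nat) + r)) as [phi [z [Hphi Hlim]]].
  { intros k. specialize (Hu k 1%nat (le_n _) ltac:(lia)). apply G1 in Hu; [|lia]. simpl in Hu.
    pose proof (Cmod_le_sub (u k) (xs 1%nat)). lra. }
  exists z. intros j Hj eps He.
  destruct (hol_ccont _ _ (orb_entire j z) eps He) as [d [Hd Hc]].
  destruct (Hlim d Hd) as [N HN]. set (k := (N + j)%nat).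
  exists (orb j (u (phi k))). split.
  - apply Hu; auto. pose proof (incr_ge phi Hphi k). lia.
  - apply Hc, HN. lia.
Qed.

Lemma orb_iter (z : C) (k : nat) :
  Nat.iter k (henon f delta) (z, xs O) = (orb (S k) z, orb k z).
Proof.
  induction k as [|k IH]; [reflexivity|].
  change (Nat.iter (S k) (henon f delta) (z, xs O)) with (henon f delta (Nat.iter k (henon f delta) (z, xs O))).
  rewrite IH. reflexivity.
Qed.
End Itineraries.

Ltac Zify.zify_post_hook ::= Z.to_euclidean_division_equations.

Lemma mod3_succ_pred (k : nat) : (1 <= k)%nat ->
  (k mod 3 = 1 /\ S k mod 3 = 2 /\ pred k mod 3 = 0 \/
   k mod 3 = 2 /\ S k mod 3 = 0 /\ pred k mod 3 = 1 \/
   k mod 3 = 0 /\ S k mod 3 = 1 /\ pred k mod 3 = 2)%nat.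
Proof.
  intros H. assert (A : (k mod 3 = 1 \/ k mod 3 = 2 \/ k mod 3 = 0)%nat) by lia.
  destruct A as [A|[A|A]]; [left|right; left|right; right]; (split; [exact A|]); split; lia.
Qed.

Lemma div3 (j : nat) : ((3 * j + 1) mod 3 = 1 /\ (3 * j + 1) / 3 = j)%nat.
Proof. split; lia. Qed.

Ltac Zify.zify_post_hook ::= idtac.

Section Horseshoe.
Variables (f : C -> C) (delta c t : C) (r eps : R) (vs : list C).
Hypothesis Hf : entire' f.
Hypothesis Hr : 0 < r.
Hypothesis Hc : c <> 0.
Hypothesis Hrc : 30 * (1 + Cmod delta) * r <= Cmod c.
Hypothesis Hbig0 : forall z, Cmod z = r -> 10 * (1 + Cmod delta) * Cmod c <= Cmod (f z).
Hypothesis Hbig1 : forall z, Cmod (z - c)%C = r -> 10 * (1 + Cmod delta) * Cmod c <= Cmod (f z).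
Hypothesis Hz0 : exists a, Cmod a < r /\ f a = 0.
Hypothesis Hz1 : exists a, Cmod (a - c)%C < r /\ f a = 0.
Hypothesis Heps : 0 < eps.
Hypothesis Ht : t = 0 \/ t = 1.
Hypothesis Hvs : forall v, In v vs -> Cmod v <= r /\ Cmod (f v / c - t)%C < 1 / 10.

Definition piece (v z : C) : Prop := rtc (stepD (fun z => f z / c)%C r eps t) v z.

Lemma piece_sym (v w : C) : piece v w -> piece w v.
Proof.
  apply rtc_sym. intros p q [P1 [P2 [P3 [P4 P5]]]]. repeat split; auto. now rewrite Cmod_minus_sym.
Qed.

Lemma Hcp : 0 < Cmod c. Proof. now apply Cmod_gt_0. Qed.

Lemma Cmod_t : Cmod t <= 1.
Proof. destruct Ht as [->| ->]; [rewrite Cmod_0; lra|rewrite Cmod_1; lra]. Qed.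

Lemma piece_in (v z : C) : In v vs -> piece v z -> Cmod z <= r /\ Cmod (f z / c - t)%C < 1 / 10.
Proof.
  intros Hv H. apply Hvs in Hv. induction H as [|a b d [_ [_ [H1 [_ H2]]]] _ IH]; auto.
Qed.

Lemma normalized_big (z : C) : 10 * (1 + Cmod delta) * Cmod c <= Cmod (f z) -> 10 <= Cmod (f z / c).
Proof.
  intros H. pose proof Hcp. rewrite Cmod_div by auto. apply (Rmult_le_reg_r (Cmod c)); auto.
  replace (Cmod (f z) / Cmod c * Cmod c) with (Cmod (f z)) by (field; lra).
  pose proof (Cmod_ge_0 delta). nra.
Qed.

Lemma piece_inside (v z : C) : In v vs -> piece v z -> Cmod z < r.
Proof.
  intros Hv H. destruct (piece_in v z Hv H) as [[H1|H1] H2]; auto. exfalso.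
  assert (B := normalized_big z (Hbig0 z H1)). pose proof Cmod_t.
  pose proof (Cmod_le_sub (f z / c) t). lra.
Qed.

Lemma normalized_cont (z : C) : ccont (fun z => f z / c)%C z.
Proof. apply ccont_div; auto. { apply hol_ccont, Hf. } apply ccont_const. Qed.

Lemma piece_open (v : C) : In v vs -> copen (piece v).
Proof.
  intros Hv z Hz. destruct (piece_in v z Hv Hz) as [_ H2]. assert (H1 := piece_inside v z Hv Hz).
  destruct (normalized_cont z (1 / 10 - Cmod (f z / c - t)%C)) as [d [Hd Hcd]]; [lra|].
  exists (Rmin eps (Rmin d (r - Cmod z))). split; [repeat apply Rmin_pos; lra|].
  intros w Hw. assert (W1 := Rlt_le_trans _ _ _ Hw (Rmin_l _ _)).
  assert (W := Rlt_le_trans _ _ _ Hw (Rmin_r _ _)).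
  assert (W2 := Rlt_le_trans _ _ _ W (Rmin_l _ _)). assert (W3 := Rlt_le_trans _ _ _ W (Rmin_r _ _)).
  eapply rtc_trans; [exact Hz|]. apply rtc_one. specialize (Hcd w W2).
  split; [rewrite Cmod_minus_sym; exact W1|]. split; [lra|]. split.
  - pose proof (Cmod_le_sub w z). lra.
  - split; auto. pose proof (Cmod_tri_minus (f w / c) (f z / c) t). lra.
Qed.

(** A point of the closure with [|f / c - t| < 1/10] would be reached by one more step of a
    chain. *)
Lemma piece_boundary (v z : C) : In v vs -> closure (piece v) z -> ~ piece v z ->
  Cmod c / 10 <= Cmod (f z - c * t)%C.
Proof.
  intros Hv Hz Hn. pose proof Hcp as Hcp.
  assert (B : 1 / 10 <= Cmod (f z / c - t)%C).
  { apply Rnot_lt_le. intros L. apply Hn. destruct (Hz eps Heps) as [w [Hw Hd]].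
    destruct (piece_in v w Hv Hw) as [W1 W2].
    eapply rtc_trans; [exact Hw|]. apply rtc_one. repeat split; auto.
    replace z with (z - 0)%C by ring. apply (closure_dist (piece v)); auto.
    intros x Hx. replace (x - 0)%C with x by ring. now apply (piece_in v). }
  replace (f z - c * t)%C with (c * (f z / c - t))%C by (field; auto).
  rewrite Cmod_mult. nra.
Qed.

Lemma piece_solution (v : C) : In v vs -> exists z, piece v z /\ f z = (c * t)%C.
Proof.
  intros Hv. pose proof Hcp.
  destruct (min_principle (fun z => f z - c * t)%C (piece v) r (Cmod c / 10) v) as [z [Hz E]].
  - now apply entire_minus_const.
  - now apply piece_open.
  - intros z Hz. now apply (piece_in v).
  - intros z H1 H2. now apply (piece_boundary v).
  - constructor.
  - destruct (Hvs v Hv) as [_ H2].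
    replace (f v - c * t)%C with (c * (f v / c - t))%C by (field; auto). rewrite Cmod_mult. nra.
  - exists z. split; auto. now apply Cminus_eq_0.
Qed.

Lemma piece_sep (v w z z' : C) : In v vs -> In w vs -> ~ piece v w ->
  closure (piece v) z -> closure (piece w) z' -> eps / 3 <= Cmod (z - z')%C.
Proof.
  intros Hv Hw Hn Hz Hz'. apply Rnot_lt_le. intros L. apply Hn.
  destruct (Hz (eps / 3)) as [a [Ha Da]]; [lra|]. destruct (Hz' (eps / 3)) as [b [Hb Db]]; [lra|].
  destruct (piece_in v a Hv Ha) as [A1 A2]. destruct (piece_in w b Hw Hb) as [B1 B2].
  eapply rtc_trans; [exact Ha|]. apply (Relation_Operators.rt1n_trans _ _ _ b).
  - repeat split; auto.
    pose proof (Cmod_tri_minus a z b). pose proof (Cmod_tri_minus z z' b).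
    rewrite (Cmod_minus_sym z' b) in *. lra.
  - now apply piece_sym.
Qed.

(* The itinerary has period 3: a piece at times 1 mod 3, then the disc at [c t], because [f / c] is near [t] on the piece, then the disc at [0]. *)
Definition hcentre (k : nat) : C := if Nat.eq_dec (k mod 3) 2 then (c * t)%C else RtoC 0.
Definition hregion (s : nat -> nat) (k : nat) (z : C) : Prop :=
  if Nat.eq_dec (k mod 3) 1 then piece (nth (s (k / 3)%nat) vs 0) z
  else Cmod (z - hcentre k)%C < r.

Lemma open_disc (a : C) : copen (fun z => Cmod (z - a)%C < r).
Proof.
  intros z Hz. exists (r - Cmod (z - a)%C). split; [lra|]. intros w Hw.
  pose proof (Cmod_tri_minus w z a). lra.
Qed.

Lemma disc_boundary (a z : C) : closure (fun z => Cmod (z - a)%C < r) z -> ~ Cmod (z - a)%C < r ->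
  Cmod (z - a)%C = r.
Proof.
  intros H1 H2. apply Rle_antisym; [|lra]. apply (closure_dist (fun z => Cmod (z - a)%C < r)); auto.
  intros w Hw. lra.
Qed.

Lemma disc_solution (a tau : C) : (forall z, Cmod (z - a)%C = r -> 10 * (1 + Cmod delta) * Cmod c <= Cmod (f z)) ->
  (exists b, Cmod (b - a)%C < r /\ f b = 0) -> Cmod tau <= (1 + Cmod delta) * Cmod c ->
  exists z, Cmod (z - a)%C < r /\ f z = tau.
Proof.
  intros Hb [b [Hb1 Hb2]] Htau. pose proof Hcp. pose proof (Cmod_ge_0 delta).
  assert (P : 0 < (1 + Cmod delta) * Cmod c) by nra.
  (* The zero [b] is the inner point, with [|f b - tau| <= (1 + |delta|) |c|]; on the circle
     [10 (1 + |delta|) |c|] loses at most this much. *)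
  destruct (min_principle (fun z => f z - tau)%C (fun z => Cmod (z - a)%C < r) (Cmod a + r)
    (9 * (1 + Cmod delta) * Cmod c) b) as [z [Hz E]].
  - now apply entire_minus_const.
  - apply open_disc.
  - intros z Hz. pose proof (Cmod_le_sub z a). lra.
  - intros z H1 H2. specialize (Hb z (disc_boundary a z H1 H2)). pose proof (Cmod_le_sub (f z) tau). nra.
  - exact Hb1.
  - rewrite Hb2. replace (0 - tau)%C with (- tau)%C by ring. rewrite Cmod_opp. nra.
  - exists z. split; auto. now apply Cminus_eq_0.
Qed.

Lemma Cmod_ct : Cmod (c * t) <= Cmod c.
Proof. rewrite Cmod_mult. pose proof Cmod_t. pose proof Hcp. nra. Qed.

Lemma disc_data (k : nat) : (forall z, Cmod (z - hcentre k)%C = r -> 10 * (1 + Cmod delta) * Cmod c <= Cmod (f z)) /\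
  (exists b, Cmod (b - hcentre k)%C < r /\ f b = 0).
Proof.
  assert (Z0 : (forall z, Cmod (z - 0)%C = r -> 10 * (1 + Cmod delta) * Cmod c <= Cmod (f z)) /\
    (exists b, Cmod (b - 0)%C < r /\ f b = 0)).
  { split.
    - intros z. replace (z - 0)%C with z by ring. auto.
    - destruct Hz0 as [b Hb]. exists b. now replace (b - 0)%C with b by ring. }
  unfold hcentre. destruct (Nat.eq_dec (k mod 3) 2); auto.
  destruct Ht as [E|E]; rewrite E.
  - replace (c * 0)%C with (RtoC 0) by ring. auto.
  - replace (c * 1)%C with c by ring. auto.
Qed.

Lemma horseshoe_itinerary (s : nat -> nat) : (forall j, (s j < length vs)%nat) ->
  exists p : C * C, forall k,
    Cmod (fst (Nat.iter k (henon f delta) p)) <= Cmod c + r /\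
    Cmod (snd (Nat.iter k (henon f delta) p)) <= Cmod c + r /\
    closure (piece (nth (s k) vs 0)) (fst (Nat.iter (3 * k) (henon f delta) p)).
Proof.
  intros Hs. pose proof Hcp as Hcp. pose proof (Cmod_ge_0 delta) as Hd0.
  assert (Hin : forall j, In (nth (s j) vs 0) vs) by (intros; apply nth_In; auto).
  assert (x0 : forall k, (k mod 3 <> 2)%nat -> hcentre k = 0).
  { intros k Hk. unfold hcentre. destruct (Nat.eq_dec _ _); tauto. }
  assert (x2 : forall k, (k mod 3 = 2)%nat -> hcentre k = (c * t)%C).
  { intros k Hk. unfold hcentre. destruct (Nat.eq_dec _ _); tauto. }
  assert (G1 : forall k z, (1 <= k)%nat -> hregion s k z -> Cmod (z - hcentre k)%C < r).
  { intros k z Hk. unfold hregion. destruct (Nat.eq_dec (k mod 3) 1) as [E|E]; auto.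
    intros Hz. rewrite x0 by lia. replace (z - 0)%C with z by ring. eapply piece_inside; eauto. }
  assert (Htau : forall k, (1 <= k)%nat -> (k mod 3 <> 1)%nat ->
    Cmod (target delta hcentre k) <= (1 + Cmod delta) * Cmod c).
  { intros k Hk E. unfold target. pose proof Cmod_ct.
    destruct (mod3_succ_pred k Hk) as [[K _]|[[_ [K1 K2]]|[_ [K1 K2]]]]; [contradiction| |].
    - rewrite !x0 by lia. replace (0 + delta * 0)%C with (RtoC 0) by ring. rewrite Cmod_0. nra.
    - rewrite (x0 (S k)), (x2 (pred k)) by lia. rewrite Cplus_0_l, Cmod_mult. nra. }
  assert (Htt : forall k, (1 <= k)%nat -> (k mod 3 = 1)%nat -> target delta hcentre k = (c * t)%C).
  { intros k Hk E. unfold target.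
    destruct (mod3_succ_pred k Hk) as [[_ [K1 K2]]|[[K _]|[K _]]]; try lia.
    rewrite (x2 (S k)), (x0 (pred k)) by lia. ring. }
  (* [rho = |c| / 10] is the margin of [piece_boundary], and [Hrc] makes it at least
     [3 (1 + |delta|) r]. *)
  destruct (orb_itinerary f delta r (Cmod c / 10) hcentre (hregion s)) as [z Hz]; auto.
  - nra.
  - intros k Hk. unfold hregion. destruct (Nat.eq_dec (k mod 3) 1) as [E|E]; [now apply piece_open|].
    apply open_disc.
  - intros k z Hk H1 H2. unfold hregion in H1, H2. destruct (Nat.eq_dec (k mod 3) 1) as [E|E].
    + rewrite Htt by auto. eapply piece_boundary; eauto.
    + specialize (Htau k Hk E). destruct (disc_data k) as [B _].
      specialize (B z (disc_boundary _ z H1 H2)). pose proof (Cmod_le_sub (f z) (target delta hcentre k)). nra.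
  - intros k Hk. unfold hregion. destruct (Nat.eq_dec (k mod 3) 1) as [E|E].
    + rewrite Htt by auto. apply piece_solution. auto.
    + destruct (disc_data k) as [B1 B2]. apply disc_solution; auto.
  - exists (z, hcentre O).
    assert (Hx : forall k, Cmod (hcentre k) <= Cmod c).
    { intros k. unfold hcentre. destruct (Nat.eq_dec _ _); [apply Cmod_ct|rewrite Cmod_0; lra]. }
    assert (Hb : forall k, Cmod (orb f delta hcentre k z) <= Cmod c + r).
    { intros [|k].
      - simpl. specialize (Hx O). lra.
      - specialize (Hz (S k) ltac:(lia)).
        assert (D : Cmod (orb f delta hcentre (S k) z - hcentre (S k))%C <= r).
        { apply (closure_dist (hregion s (S k))); auto. intros w Hw. left. apply G1; [lia|auto]. }
        pose proof (Cmod_le_sub (orb f delta hcentre (S k) z) (hcentre (S k))). specialize (Hx (S k)). lra. }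
    intros k. rewrite !orb_iter. cbn [fst snd]. split; [auto|]. split; [auto|].
    specialize (Hz (S (3 * k)) ltac:(lia)). unfold hregion in Hz.
    (* The first coordinate of iterate [3 k] is the orbit at time [3 k + 1], a time of a piece. *)
    replace (S (3 * k)) with (3 * k + 1)%nat in * by lia.
    destruct (div3 k) as [D1 D2]. rewrite D1, D2 in Hz. exact Hz.
Qed.
End Horseshoe.

(** * Entropy *)

Fixpoint words {A} (l : list A) (n : nat) : list (list A) :=
  match n with O => nil :: nil | S k => flat_map (fun w => map (fun a => a :: w) l) (words l k) end.

Lemma words_In {A} (l : list A) (n : nat) (w : list A) : length w = n -> (forall a, In a w -> In a l) ->
  In w (words l n).
Proof.
  revert w. induction n as [|n IH]; intros [|a w] Hl Hin; simpl in *; try discriminate; auto.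
  apply in_flat_map. exists w. split; [apply IH; auto|]. apply in_map_iff. exists a. auto.
Qed.

Lemma words_spec {A} (l : list A) (n : nat) (w : list A) : In w (words l n) ->
  length w = n /\ forall a, In a w -> In a l.
Proof.
  revert w. induction n as [|n IH]; intros w H; simpl in H.
  - destruct H as [<-|[]]. split; auto. intros a [].
  - apply in_flat_map in H. destruct H as [v [Hv H]]. apply in_map_iff in H.
    destruct H as [a [<- Ha]]. destruct (IH v Hv) as [H1 H2]. split; [simpl; lia|].
    intros b [<-|Hb]; auto.
Qed.

Lemma words_length {A} (l : list A) (n : nat) : length (words l n) = (length l ^ n)%nat.
Proof.
  induction n as [|n IH]; simpl; auto.
  assert (H : forall L : list (list A), length (flat_map (fun w => map (fun a => a :: w) l) L) = (length l * length L)%nat).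
  { induction L as [|w L IHL]; simpl; [lia|]. rewrite length_app, length_map, IHL. lia. }
  rewrite H, IH. reflexivity.
Qed.

Lemma words_NoDup {A} (l : list A) (n : nat) : NoDup l -> NoDup (words l n).
Proof.
  intros Hl. induction n as [|n IH]; simpl; [repeat constructor; auto|].
  induction IH as [|w L Hw HL IHL]; simpl; [constructor|].
  apply NoDup_app; auto.
  - apply NoDup_map_NoDup_ForallPairs; auto. intros a b _ _ E. congruence.
  - intros v Hv Hv'. apply in_map_iff in Hv. destruct Hv as [a [<- Ha]].
    apply in_flat_map in Hv'. destruct Hv' as [w' [Hw' H]]. apply in_map_iff in H.
    destruct H as [b [E Hb]]. injection E as -> ->. contradiction.
Qed.

Lemma dist2_le (p q : C * C) : dist2 p q <= Cmod (fst p - fst q)%C + Cmod (snd p - snd q)%C.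
Proof.
  unfold dist2. set (a := Cmod (fst p - fst q)%C). set (b := Cmod (snd p - snd q)%C).
  assert (0 <= a) by apply Cmod_ge_0. assert (0 <= b) by apply Cmod_ge_0.
  rewrite <- (sqrt_pow2 (a + b)) by lra. apply sqrt_le_1_alt. nra.
Qed.

Lemma dist2_ge_fst (p q : C * C) : Cmod (fst p - fst q)%C <= dist2 p q.
Proof.
  unfold dist2. rewrite <- (sqrt_pow2 (Cmod (fst p - fst q)%C)) at 1 by apply Cmod_ge_0.
  apply sqrt_le_1_alt. pose proof (pow2_ge_0 (Cmod (snd p - snd q)%C)). lra.
Qed.

Definition cells (eta : R) (p : C * C) : list Z :=
  Int_part (Re (fst p) / eta) :: Int_part (Im (fst p) / eta) ::
  Int_part (Re (snd p) / eta) :: Int_part (Im (snd p) / eta) :: nil.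

Fixpoint code (g : C * C -> C * C) (eta : R) (n : nat) (p : C * C) : list Z :=
  match n with O => nil | S k => cells eta (Nat.iter k g p) ++ code g eta k p end.

Lemma code_length g eta n p : length (code g eta n p) = (4 * n)%nat.
Proof. induction n as [|n IH]; cbn [code]; auto. rewrite length_app, IH. simpl length. lia. Qed.

Lemma code_eq g eta n p q : code g eta n p = code g eta n q ->
  forall k, (k < n)%nat -> cells eta (Nat.iter k g p) = cells eta (Nat.iter k g q).
Proof.
  induction n as [|n IH]; intros H k Hk; [lia|]. cbn [code cells app] in H.
  injection H as E1 E2 E3 E4 E5.
  destruct (Nat.eq_dec k n) as [->|Hn]; [unfold cells; congruence|]. apply IH; auto. lia.
Qed.

Lemma Int_part_eq_close (eta a b : R) : 0 < eta -> Int_part (a / eta) = Int_part (b / eta) ->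
  Rabs (a - b) <= eta.
Proof.
  intros He E. destruct (base_Int_part (a / eta)) as [A1 A2]. destruct (base_Int_part (b / eta)) as [B1 B2].
  rewrite E in A1, A2. assert (Ea : a / eta * eta = a) by (field; lra).
  assert (Eb : b / eta * eta = b) by (field; lra). apply Rabs_le. nra.
Qed.

Lemma cells_close (eta : R) (p q : C * C) : 0 < eta -> cells eta p = cells eta q -> dist2 p q <= 4 * eta.
Proof.
  intros He E. injection E as E1 E2 E3 E4.
  apply (Int_part_eq_close _ _ _ He) in E1, E2, E3, E4.
  eapply Rle_trans; [apply dist2_le|].
  pose proof (Cmod_le_re_im (fst p - fst q)%C) as H1. pose proof (Cmod_le_re_im (snd p - snd q)%C) as H2.
  change (Re (fst p - fst q)%C) with (Re (fst p) - Re (fst q)) in H1.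
  change (Im (fst p - fst q)%C) with (Im (fst p) - Im (fst q)) in H1.
  change (Re (snd p - snd q)%C) with (Re (snd p) - Re (snd q)) in H2.
  change (Im (snd p - snd q)%C) with (Im (snd p) - Im (snd q)) in H2. lra.
Qed.

Lemma Int_part_range (eta B a : R) (K : nat) : 0 < eta -> B / eta + 1 < INR K -> Rabs a <= B ->
  In (Int_part (a / eta)) (map (fun k => (Z.of_nat k - Z.of_nat K)%Z) (seq 0 (2 * K + 1))).
Proof.
  intros He HK Ha. apply Rabs_le_between in Ha. destruct (base_Int_part (a / eta)) as [A1 A2].
  assert (Ea : a / eta * eta = a) by (field; lra). assert (Eb : B / eta * eta = B) by (field; lra).
  assert (H1 : - INR K < IZR (Int_part (a / eta))) by nra.
  assert (H2 : IZR (Int_part (a / eta)) < INR K) by nra.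
  rewrite INR_IZR_INZ in H1, H2. rewrite <- opp_IZR in H1. apply lt_IZR in H1, H2.
  apply in_map_iff. exists (Z.to_nat (Int_part (a / eta) + Z.of_nat K)). split; [lia|].
  apply in_seq. lia.
Qed.

(** [Ksep] applies [real] to a least upper bound and would be 0 if that were infinite, so lower
    bounds need finiteness. Separated points have different codes on a mesh of [eps / 4], and a
    bounded invariant set admits finitely many codes of a given length. *)
Lemma separated_bounded (g : C * C -> C * C) (X : C * C -> Prop) (B eps : R) (n : nat) : 0 < eps ->
  (forall p, X p -> Cmod (fst p) <= B /\ Cmod (snd p) <= B) -> (forall p, X p -> X (g p)) ->
  exists M, forall E, separated g X n eps E -> (length E <= M)%nat.
Proof.
  intros He HB Hg. set (eta := eps / 4). assert (Heta : 0 < eta) by (unfold eta; lra).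
  destruct (nfloor_ex (Rabs (B / eta) + 1)) as [K0 [_ HK0]]. { pose proof (Rabs_pos (B / eta)); lra. }
  set (K := S K0). assert (HK : B / eta + 1 < INR K).
  { unfold K. rewrite S_INR. pose proof (Rle_abs (B / eta)). lra. }
  set (A := map (fun k => (Z.of_nat k - Z.of_nat K)%Z) (seq 0 (2 * K + 1))).
  exists (length (words A (4 * n))). intros E [H1 [H2 H3]].
  rewrite <- (length_map (code g eta n) E). apply NoDup_incl_length.
  - apply NoDup_map_NoDup_ForallPairs; auto. intros p q Hp Hq Hpq. apply NNPP. intros Hne.
    destruct (H3 p q Hp Hq Hne) as [k [Hk Hd]].
    pose proof (cells_close eta _ _ Heta (code_eq _ _ _ _ _ Hpq k Hk)). unfold eta in *. lra.
  - intros w Hw. apply in_map_iff in Hw. destruct Hw as [p [<- Hp]].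
    apply words_In; [apply code_length|]. specialize (H2 p Hp). clear - HB Hg H2 HK Heta.
    assert (Hit : forall k, X (Nat.iter k g p)) by (induction k; simpl; auto).
    induction n as [|n IH]; intros a Ha; cbn [code] in Ha; [destruct Ha|].
    apply in_app_or in Ha. destruct Ha as [Ha|Ha]; auto.
    destruct (HB _ (Hit n)) as [B1 B2].
    destruct Ha as [<-|[<-|[<-|[<-|[]]]]]; apply (Int_part_range _ B); auto.
    + eapply Rle_trans; [apply re_le_Cmod|auto].
    + eapply Rle_trans; [apply im_le_Cmod|auto].
    + eapply Rle_trans; [apply re_le_Cmod|auto].
    + eapply Rle_trans; [apply im_le_Cmod|auto].
Qed.

Lemma Ksep_ge (g : C * C -> C * C) (X : C * C -> Prop) (B eps : R) (n : nat) (E : list (C * C)) : 0 < eps ->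
  (forall p, X p -> Cmod (fst p) <= B /\ Cmod (snd p) <= B) -> (forall p, X p -> X (g p)) ->
  separated g X n eps E -> INR (length E) <= Ksep g X n eps.
Proof.
  intros He HB Hg HE. destruct (separated_bounded g X B eps n He HB Hg) as [M HM].
  unfold Ksep. set (S := fun r => exists E0, separated g X n eps E0 /\ r = INR (length E0)).
  destruct (Lub_Rbar_correct S) as [Hub Hlub].
  assert (H1 : Rbar_le (INR (length E)) (Lub_Rbar S)) by (apply Hub; exists E; auto).
  assert (H2 : Rbar_le (Lub_Rbar S) (INR M)).
  { apply Hlub. intros r [E0 [HE0 ->]]. simpl. apply le_INR. auto. }
  destruct (Lub_Rbar S); simpl in *; tauto.
Qed.

Lemma ccont_seq_lim (F : C -> C) (u : nat -> C) (l : C) : ccont F l -> seq_lim u l ->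
  seq_lim (fun k => F (u k)) (F l).
Proof.
  intros HF Hu eps He. destruct (HF eps He) as [d [Hd H]]. destruct (Hu d Hd) as [N HN].
  exists N. auto.
Qed.

Lemma seq_lim_minus (u v : nat -> C) (a b : C) : seq_lim u a -> seq_lim v b ->
  seq_lim (fun k => u k - v k)%C (a - b)%C.
Proof.
  intros Hu Hv eps He. destruct (Hu (eps / 2)) as [N1 H1]; [lra|].
  destruct (Hv (eps / 2)) as [N2 H2]; [lra|]. exists (N1 + N2)%nat. intros k Hk.
  specialize (H1 k ltac:(lia)). specialize (H2 k ltac:(lia)).
  replace (u k - v k - (a - b))%C with ((u k - a) - (v k - b))%C by ring.
  eapply Rle_lt_trans; [apply Cmod_sub_le|]. lra.
Qed.

Lemma seq_lim_bound (u : nat -> C) (l : C) (M : R) : seq_lim u l -> (forall k, Cmod (u k) <= M) -> Cmod l <= M.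
Proof.
  intros Hu HM. replace l with (l - 0)%C by ring. apply (seq_lim_Cmod_le u); auto.
  intros k. replace (u k - 0)%C with (u k) by ring. auto.
Qed.

(** One compact invariant set holding all prescribed orbits; being defined by closed conditions on
    all iterates, it needs no closure of the horseshoe. *)
Definition bounded_orbits (f : C -> C) (delta : C) (B : R) (p : C * C) : Prop :=
  forall k, Cmod (fst (Nat.iter k (henon f delta) p)) <= B /\
    Cmod (snd (Nat.iter k (henon f delta) p)) <= B.

Lemma bounded_orbits_compact (f : C -> C) (delta : C) (B : R) : entire' f ->
  compact_C2 (bounded_orbits f delta B).
Proof.
  intros Hf u Hu.
  destruct (BW_C (fun k => fst (u k)) B) as [f1 [l1 [Hf1 L1]]]. { intros k. apply (Hu k O). }
  destruct (BW_C (fun k => snd (u (f1 k))) B) as [f2 [l2 [Hf2 L2]]]. { intros k. apply (Hu (f1 k) O). }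
  set (phi := fun k => f1 (f2 k)).
  assert (L1' : seq_lim (fun k => fst (u (phi k))) l1).
  { intros eps He. destruct (L1 eps He) as [N HN]. exists N. intros k Hk.
    apply HN. pose proof (incr_ge f2 Hf2 k). lia. }
  assert (L2' : seq_lim (fun k => snd (u (phi k))) l2) by exact L2.
  exists phi, (l1, l2). split; [intros k; exact (incr_mono f1 Hf1 _ _ (Hf2 k))|]. split.
  - assert (H : forall k, seq_lim (fun j => fst (Nat.iter k (henon f delta) (u (phi j)))) (fst (Nat.iter k (henon f delta) (l1, l2)))
      /\ seq_lim (fun j => snd (Nat.iter k (henon f delta) (u (phi j)))) (snd (Nat.iter k (henon f delta) (l1, l2)))).
    { induction k as [|k [I1 I2]]; [split; auto|]. split; [|exact I1]. simpl.
      apply seq_lim_minus.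
      - apply (ccont_seq_lim f); auto. apply hol_ccont, Hf.
      - apply (ccont_seq_lim (fun w => delta * w)%C); auto.
        apply ccont_mult; [apply ccont_const|apply ccont_id]. }
    intros k. destruct (H k) as [H1 H2]. split.
    + eapply seq_lim_bound; [exact H1|]. intros j. apply (Hu (phi j) k).
    + eapply seq_lim_bound; [exact H2|]. intros j. apply (Hu (phi j) k).
  - intros eps He. destruct (L1' (eps / 2)) as [N1 H1]; [lra|]. destruct (L2' (eps / 2)) as [N2 H2]; [lra|].
    exists (N1 + N2)%nat. intros k Hk. specialize (H1 k ltac:(lia)). specialize (H2 k ltac:(lia)).
    eapply Rle_lt_trans; [apply dist2_le|]. cbn [fst snd]. lra.
Qed.

Lemma bounded_orbits_invariant (f : C -> C) (delta : C) (B : R) (p : C * C) :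
  bounded_orbits f delta B p -> bounded_orbits f delta B (henon f delta p).
Proof.
  intros H k. rewrite Nat.iter_swap. apply (H (S k)).
Qed.

(** Words of length [n / 3] prescribe every third point; two words that differ in letter [k] give
    orbits at distance at least [e] at time [3 k < n]. Passing to [e / 2] makes the separation
    strict. *)
Lemma entropy_lower (f : C -> C) (delta : C) (B e : R) (L : nat) (W : nat -> C -> Prop) :
  entire' f -> 0 < e -> (2 <= L)%nat ->
  (forall i j z w, (i < L)%nat -> (j < L)%nat -> i <> j -> W i z -> W j w -> e <= Cmod (z - w)%C) ->
  (forall s : nat -> nat, (forall j, (s j < L)%nat) -> exists p, bounded_orbits f delta B p /\
     forall k, W (s k) (fst (Nat.iter (3 * k) (henon f delta) p))) ->
  Rbar_le (ln (INR L) / 5) (htop_C2 (henon f delta)).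
Proof.
  intros Hf He HL Hsep Hit. set (F := henon f delta). set (X := bounded_orbits f delta B).
  assert (HLn : 0 <= ln (INR L)).
  { rewrite <- ln_1. apply le_INR in HL. simpl in HL. apply ln_le; lra. }
  assert (HK : forall n, INR L ^ (n / 3) <= Ksep F X n (e / 2)).
  { intros n.
    assert (Hp : forall w : list nat, exists p, (forall a, In a w -> (a < L)%nat) -> X p /\
      forall k, (k < length w)%nat -> W (nth k w O) (fst (Nat.iter (3 * k) F p))).
    { intros w. destruct (classic (forall a, In a w -> (a < L)%nat)) as [Hw|Hw].
      - destruct (Hit (fun k => nth k w O)) as [p [P1 P2]].
        + intros j. destruct (le_lt_dec (length w) j) as [Lj|Lj].
          (* Past the end of the word, the default letter [0] is still a valid index. *)
          * rewrite nth_overflow by auto. lia.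
          * apply Hw, nth_In; auto.
        + exists p. intros _. split; auto.
      - exists (RtoC 0, RtoC 0). tauto. }
    set (pt := fun w => proj1_sig (constructive_indefinite_description _ (Hp w))).
    assert (Hpt : forall w, (forall a, In a w -> (a < L)%nat) -> X (pt w) /\
      forall k, (k < length w)%nat -> W (nth k w O) (fst (Nat.iter (3 * k) F (pt w)))).
    { intros w. apply (proj2_sig (constructive_indefinite_description _ (Hp w))). }
    set (ws := words (seq 0 L) (n / 3)).
    assert (Hws : forall w, In w ws -> length w = (n / 3)%nat /\ forall a, In a w -> (a < L)%nat).
    { intros w Hw. apply words_spec in Hw. destruct Hw as [H1 H2]. split; auto.
      intros a Ha. apply H2, in_seq in Ha. lia. }
    assert (Hd : forall w w', In w ws -> In w' ws -> w <> w' ->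
      exists k, (k < n)%nat /\ dist2 (Nat.iter k F (pt w)) (Nat.iter k F (pt w')) > e / 2).
    { intros w w' Hw Hw' Hne. destruct (Hws w Hw) as [L1 A1]. destruct (Hws w' Hw') as [L2 A2].
      assert (Hk : exists k, (k < n / 3)%nat /\ nth k w O <> nth k w' O).
      { apply NNPP. intros Hn. apply Hne. apply (nth_ext w w' O O); [congruence|].
        intros k Hk. apply NNPP. intros Hk'. apply Hn. exists k. split; auto. lia. }
      destruct Hk as [k [Hk Hne']]. exists (3 * k)%nat. split.
      - pose proof (Nat.div_mod_eq n 3). lia.
      - eapply Rlt_le_trans with e; [lra|]. eapply Rle_trans; [|apply dist2_ge_fst].
        apply (Hsep (nth k w O) (nth k w' O)); auto.
        + apply A1, nth_In. lia.
        + apply A2, nth_In. lia.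
        + apply Hpt; auto. lia.
        + apply Hpt; auto. lia. }
    replace (INR L ^ (n / 3)) with (INR (length (map pt ws))).
    2:{ unfold ws. rewrite length_map, words_length, length_seq. apply pow_INR. }
    apply (Ksep_ge F X B); try lra.
    - intros p Hp'. apply (Hp' O).
    - apply bounded_orbits_invariant.
    - assert (Hinj : forall w w', In w ws -> In w' ws -> pt w = pt w' -> w = w').
      { intros w w' Hw Hw' E. apply NNPP. intros Hne. destruct (Hd w w' Hw Hw' Hne) as [k [_ Hk]].
        rewrite E in Hk. revert Hk. apply Rle_not_gt. eapply Rle_trans; [apply dist2_le|].
        set (q := Nat.iter k F (pt w')). replace (fst q - fst q)%C with (RtoC 0) by ring.
        replace (snd q - snd q)%C with (RtoC 0) by ring. rewrite Cmod_0. lra. }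
      split; [|split].
      + apply NoDup_map_NoDup_ForallPairs; [intros w w' Hw Hw'; apply Hinj; auto|].
        apply words_NoDup, seq_NoDup.
      + intros p Hp'. apply in_map_iff in Hp'. destruct Hp' as [w [<- Hw]]. apply Hpt. now apply Hws.
      + intros p q Hp' Hq Hne. apply in_map_iff in Hp'. destruct Hp' as [w [<- Hw]].
        apply in_map_iff in Hq. destruct Hq as [w' [<- Hw']]. apply Hd; auto. congruence. }
  assert (H1 : Rbar_le (ln (INR L) / 5) (LimSup_seq (fun n => ln (Ksep F X n (e / 2)) / INR n))).
  { rewrite <- (LimSup_seq_const (ln (INR L) / 5)). apply LimSup_le. exists 3%nat. intros n Hn.
    assert (HLp : 0 < INR L) by (apply lt_0_INR; lia).
    assert (Hnp : 0 < INR n) by (apply lt_0_INR; lia).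
    apply (Rmult_le_reg_r (INR n)); auto.
    replace (ln (Ksep F X n (e / 2)) / INR n * INR n) with (ln (Ksep F X n (e / 2))) by (field; lra).
    apply Rle_trans with (ln (INR L ^ (n / 3))).
    - rewrite ln_pow by auto.
      (* The worst case of the integer division is [n = 5]; this is the origin of the factor
         [1/5]. *)
      assert (H5 : (n <= 5 * (n / 3))%nat).
      { pose proof (Nat.div_mod_eq n 3). pose proof (Nat.mod_upper_bound n 3). lia. }
      apply le_INR in H5. rewrite mult_INR in H5. simpl (INR 5) in H5. nra.
    - apply ln_le; [apply pow_lt; auto|apply HK]. }
  eapply Rbar_le_trans; [exact H1|].
  assert (H2 : Rbar_le (LimSup_seq (fun n => ln (Ksep F X n (e / 2)) / INR n)) (htop_compact F X)).
  { unfold htop_compact, Rbar_lub. destruct (Rbar_ex_lub _) as [l [Hub Hlub]]. simpl.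
    apply Hub. exists (e / 2). split; [lra|reflexivity]. }
  eapply Rbar_le_trans; [exact H2|].
  unfold htop_C2, Rbar_lub. destruct (Rbar_ex_lub _) as [l [Hub Hlub]]. simpl.
  apply Hub. exists X. split; [now apply bounded_orbits_compact|]. split; auto.
  apply bounded_orbits_invariant.
Qed.

Lemma ForallOrdPairs_nth {A : Type} (S : A -> A -> Prop) (l : list A) (x0 : A) (i j : nat) : ForallOrdPairs S l ->
  (i < j)%nat -> (j < length l)%nat -> S (nth i l x0) (nth j l x0).
Proof.
  intros H. revert i j. induction H as [|a l Ha _ IH]; simpl; intros i j Hij Hj; [lia|].
  destruct j as [|j]; [lia|]. destruct i as [|i].
  - rewrite Forall_forall in Ha. apply Ha, nth_In. lia.
  - apply IH; lia.
Qed.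

Lemma henon_entropy_ge (f : C -> C) (delta : C) (L : nat) : entire' f -> ~ polynomial_fun f ->
  quasi_normal (rescaled f) (fun _ : C => True) -> (2 <= L)%nat ->
  Rbar_le (ln (INR L) / 5) (htop_C2 (henon f delta)).
Proof.
  intros Hf Hnp Hqn HL. pose proof (Cmod_ge_0 delta) as Hdl.
  (* [disc_pieces] returns at least half as many pieces as there are zeros, so [2 L] zeros give [L]
     pieces. *)
  destruct (good_scale f Hf Hnp Hqn (1 + Cmod delta) (2 * L) ltac:(lra))
    as [c [r [l [g [Hr [Hc [Hrc [Hb0 [Hb1 [Hz1 [Hg [Ef [Hl [Hla Hg0]]]]]]]]]]]]]].
  assert (Hz0 : exists a, Cmod a < r /\ f a = 0).
  { destruct l as [|a l]; [simpl in Hl; lia|]. exists a. split; [apply Hla; now left|].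
    rewrite Ef, lprod_zero by now left. ring. }
  destruct (haslift_ext (fun s => (/ c * (lprod l (RtoC r * cis s) * g (RtoC r * cis s)))%C)
    (fun s => (f (RtoC r * cis s) / c)%C) (0 + (length l + 0))) as [phi [P1 [P2 P3]]].
  { intros s. rewrite <- Ef. unfold Cdiv. ring. }
  { apply (haslift_mult (fun _ => / c)%C); [apply haslift_const|].
    apply (haslift_mult (fun s => lprod l (RtoC r * cis s)%C)); [now apply haslift_lprod|].
    apply haslift_nonvanishing; auto. intros z. apply hol_ccont, Hg. }
  replace (0 + (length l + 0))%nat with (length l) in P3 by lia.
  destruct (disc_pieces (fun z => f z / c)%C r (length l) phi Hr) as [eps [t [vs [Heps [Ht [Hd [Hvs Hsep]]]]]]]; auto.
  { intros z. now apply normalized_cont. }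
  { intros z Hz. apply (normalized_big f delta c); auto. }
  { lia. }
  assert (Hsym : forall v w, ~ piece f c t r eps v w -> ~ piece f c t r eps w v).
  { intros v w H H'. now apply H, piece_sym. }
  apply Rbar_le_trans with (ln (INR (length vs)) / 5).
  { simpl. apply Rmult_le_compat_r; [lra|]. apply ln_le; [apply lt_0_INR; lia|]. apply le_INR. lia. }
  apply (entropy_lower f delta (Cmod c + r) (eps / 3) (length vs)
    (fun i => closure (piece f c t r eps (nth i vs 0)))); auto; [lra|lia| |].
  - intros i j z w Hi Hj Hij Hz Hw. apply (piece_sep f c t r eps vs Heps Hvs (nth i vs 0) (nth j vs 0)); auto.
    + now apply nth_In.
    + now apply nth_In.
    + destruct (Nat.lt_total i j) as [H|[H|H]]; [|lia|apply Hsym];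
      apply (ForallOrdPairs_nth _ vs 0 _ _ Hsep); auto.
  - intros s Hs. destruct (horseshoe_itinerary f delta c t r eps vs Hf Hr Hc Hrc Hb0 Hb1 Hz0 Hz1 Heps Ht Hvs s Hs) as [p Hp].
    exists p. split; [|intros k; apply Hp]. intros k. destruct (Hp k) as [H1 [H2 _]]. auto.
Qed.

Theorem mainTheorem9 (f : C -> C) (delta : C) :
  transcendental_entire f ->
  delta <> RtoC 0 ->
  quasi_normal (rescaled f) (fun _ : C => True) ->
  htop_C2 (henon f delta) = p_infty.
Proof.
  intros [Hf Hnp] _ Hqn. apply entire_of_Defs in Hf.
  assert (H : forall L, (2 <= L)%nat -> Rbar_le (ln (INR L) / 5) (htop_C2 (henon f delta)))
    by (intros L; now apply henon_entropy_ge).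
  destruct (htop_C2 (henon f delta)) as [x| |]; auto; exfalso.
  - destruct (nfloor_ex (exp (5 * x))) as [n [_ Hn]]; [left; apply exp_pos|].
    specialize (H (n + 2)%nat ltac:(lia)). simpl in H.
    assert (5 * x < ln (INR (n + 2))).
    { rewrite <- (ln_exp (5 * x)). apply ln_increasing; [apply exp_pos|]. rewrite plus_INR. simpl. lra. }
    lra.
  - exact (H 2%nat (le_n 2)).
Qed.
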